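(* Let $\alpha\in(0,2]$, $\beta\in(0,1)$, and let $(E,\mathcal E,\mu)$ be a $\sigma$-finite measure space, $\mathcal A=\{A\in\mathcal E:\mu(A)<\infty\}$. Let $\{p_k\}_{k\in\mathbb N}$ be a nonincreasing sequence of strictly positive numbers such that $$\nu(t):=\max\{k\in\mathbb N:p_k\ge 1/t\}=t^\beta L(t),\qquad t>0,$$ where $L$ is slowly varying at $\infty$ (with $\max\emptyset=0$). For each $\rho>0$ let $\{N_k^{(\rho)}\}_{k\in\mathbb N}$ be independent Poisson point processes on $(E,\mathcal E)$, $N^{(\rho)}_k$ having mean measure $\rho p_k\mu$, and let $\{\varepsilon_k\}_{k\in\mathbb N}$ be i.i.d. real random variables, independent of the Poisson point processes, whose characteristic function $\phi(\theta)=\mathbb E e^{i\theta\varepsilon_1}$ satisfies, for some $\sigma_\varepsilon>0$, $$1-\phi(\theta)\sim\sigma_\varepsilon^\alpha|\theta|^\alpha\qquad\text{as }\theta\to0.$$ Define $$U_\rho(A):=\sum_{k\in\mathbb N}\varepsilon_k\mathbf 1_{\{N_k^{(\rho)}(A)\text{ odd}\}},\qquad \rho>0,\ A\in\mathcal A.$$ Then, as $\rho\to\infty$, $$\left(\frac{U_\rho(A)}{b_\rho}\right)_{A\in\mathcal A}\Longrightarrow\left(Y_{\alpha,\beta}(A)\right)_{A\in\mathcal A}$$ in the sense of convergence of finite-dimensional distributions, where $$b_\rho:=\left(\frac{\beta}{c_\beta}\rho^\beta L(\rho)\right)^{1/\alpha}\sigma_\varepsilon,\qquad c_\beta:=\frac{\beta2^{1-\beta}}{\Gamma(1-\beta)},$$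 and $Y_{\alpha,\beta}$ is the set-indexed Karlin stable process associated with $(E,\mathcal E,\mu)$.
   Context: Stable laws: $S_\alpha(\sigma,0,0)$ denotes the symmetric $\alpha$-stable (S$\alpha$S) law with characteristic function $\theta\mapsto\exp(-\sigma^\alpha|\theta|^\alpha)$, for $\alpha\in(0,2]$ (including the Gaussian case $\alpha=2$); $\sigma=0$ gives the point mass at $0$. S$\alpha$S random measure: an S$\alpha$S random measure $M$ with control measure $\kappa$ on a measurable space is a family of random variables $M(B)$, indexed by measurable $B$ with $\kappa(B)<\infty$, such that $M(B)\sim S_\alpha(\kappa(B)^{1/\alpha},0,0)$, the values on pairwise disjoint sets are independent, and $M(\bigcup_iB_i)=\sum_iM(B_i)$ almost surely for disjoint $B_i$ whose union has finite $\kappa$-measure. Write $\int\mathbf 1_B\,dM=M(B)$. Point measures: $\mathbb M_p(E)$ is the space of point measures $m=\sum_i\delta_{x_i}$ (countable sums, $x_i\in E$) on $(E,\mathcal E)$, with the $\sigma$-algebra generated by the maps $m\mapsto m(A)$, $A\in\mathcal E$. For $r>0$, $\mathbb P'_{r,\mu}$ is the law on $\mathbb M_p(E)$ of the Poisson point process on $(E,\mathcal E)$ with mean measure $r\mu$. Define the measure $\mu_\beta(\cdot):=c_\beta\int_0^\infty r^{-\beta-1}\,\mathbb P'_{r,\mu}(\cdot)\,dr$ on $\mathbb M_p(E)$. Set-indexed Karlin stable process: with $M_{\alpha,\beta}$ an S$\alpha$S random measure on $\mathbb M_p(E)$ with control measure $\mu_\beta$, $$Y_{\alpha,\beta}(A):=\int_{\mathbb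 M_p(E)}\mathbf 1_{\{m(A)\text{ odd}\}}\,M_{\alpha,\beta}(dm),\qquad A\in\mathcal A.$$ $\mathbb N=\{1,2,\dots\}$. *)

(* Defs.v *)
From HB Require Import structures.
From mathcomp Require Import all_boot all_order all_algebra.
From mathcomp Require Import all_classical all_reals all_analysis.
From mathcomp Require Import measurable_realfun.
From mathcomp Require Export complex.

Set Implicit Arguments.
Unset Strict Implicit.
Unset Printing Implicit Defensive.

Import Order.TTheory GRing.Theory Num.Theory.
Import numFieldNormedType.Exports.

Local Open Scope classical_set_scope.
Local Open Scope ring_scope.

Section independence.
Context d (Omega : measurableType d) (R : realType) (P : probability Omega R).
Local Open Scope ereal_scope.

Definition mutually_independent (I : eqType) (F : I -> set_system Omega) : Prop :=
  forall (s : seq I) (A : I -> set Omega), uniq s ->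
    (forall i, i \in s -> F i (A i)) ->
    P (\bigcap_(i in [set` s]) A i) = \prod_(i <- s) P (A i).

Definition independent_systems (F G : set_system Omega) : Prop :=
  forall A B, F A -> G B -> P (A `&` B) = P A * P B.

Definition sigma_of d' (T : measurableType d') (X : Omega -> T) :
    set_system Omega :=
  preimage_set_system setT X measurable.

Definition sigma_of_family (I : Type) d' (T : measurableType d')
    (X : I -> Omega -> T) : set_system Omega :=
  <<s \bigcup_i sigma_of (X i) >>.

Definition independent_family (I : eqType) d' (T : measurableType d')
    (X : I -> Omega -> T) : Prop :=
  mutually_independent (fun i => sigma_of (X i)).

Definition identically_distributed (I : Type) d' (T : measurableType d')
    (X : I -> Omega -> T) : Prop :=
  forall (i j : I) (B : set T), measurable B ->
    P (X i @^-1` B) = P (X j @^-1` B).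

End independence.

Section point_measures.
Context d (E : measurableType d) (R : realType).
Local Open Scope ereal_scope.

(* The index set I accounts for finite (possibly empty) as well as infinite
   sums; the points x i, i in I, may be repeated. *)
Definition is_point_measure (m : {measure set E -> \bar R}) : Prop :=
  exists (I : set nat) (x : nat -> E), forall A, measurable A ->
    m A = \esum_(i in I) \d_(x i) A.

Record point_measure := PointMeasure {
  point_measure_val :> {measure set E -> \bar R} ;
  point_measureP : is_point_measure point_measure_val }.

Lemma is_point_measure0 : is_point_measure mzero.
Proof. by exists set0, (fun=> point) => A _; rewrite esum_set0. Qed.

HB.instance Definition _ := gen_eqMixin point_measure.
HB.instance Definition _ := gen_choiceMixin point_measure.
HB.instance Definition _ :=
  isPointed.Build point_measure (PointMeasure is_point_measure0).

Definition point_measure_measurable : set_system point_measure :=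
  <<s \bigcup_(A in measurable)
        preimage_set_system setT (fun m : point_measure => m A)
          (measurable : set (set \bar R)) >>.

Let measurable0 : point_measure_measurable set0.
Proof. exact: sigma_algebra0. Qed.

Let measurableC (U : set point_measure) :
  point_measure_measurable U -> point_measure_measurable (~` U).
Proof. exact: sigma_algebraC. Qed.

Let measurableU (F : (set point_measure)^nat) :
  (forall i, point_measure_measurable (F i)) ->
  point_measure_measurable (\bigcup_i F i).
Proof. exact: sigma_algebra_bigcup. Qed.

Definition point_measure_display : measure_display.
Proof. by constructor. Qed.

HB.instance Definition _ :=
  @isMeasurable.Build point_measure_display point_measure
    point_measure_measurable measurable0 measurableC measurableU.

Definition odd_count (m : point_measure) (A : set E) : Prop :=
  exists n : nat, odd n /\ m A = n%:R%:E.

End point_measures.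

Section poisson_point_process.
Context d (E : measurableType d) (R : realType).
Local Open Scope ereal_scope.

(* The Poisson weights are written out because the library's poisson_pmf is
   identically 1, instead of the point mass at 0, when the rate is 0. *)
Definition poisson_point_process d' (Omega : measurableType d')
    (P : probability Omega R) (N : Omega -> point_measure E R)
    (nu : set E -> \bar R) : Prop :=
  [/\ measurable_fun setT N,
      forall A, measurable A -> nu A < +oo -> forall n : nat,
        P [set w | N w A = n%:R%:E] =
        (fine (nu A) ^+ n / n`!%:R * expR (- fine (nu A)))%:E,
      forall A, measurable A -> nu A = +oo -> P [set w | N w A = +oo] = 1
    & forall (I : finType) (A : I -> set E), (forall i, measurable (A i)) ->
        trivIset setT A ->
        independent_family P (fun i w => N w (A i)) ].

(* The law on point measures of the Poisson point process with mean measure nu.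
   For sigma-finite nu such a law exists, and it is unique on measurable sets
   since its finite-dimensional distributions are prescribed; the default value
   \d_point is then never used. *)
Definition poisson_law (nu : set E -> \bar R) :
    probability (point_measure E R) R :=
  xget (\d_point : probability (point_measure E R) R)
    [set Q : probability (point_measure E R) R |
      poisson_point_process Q id nu].

End poisson_point_process.

Section stable.
Context d (Omega : measurableType d) (R : realType) (P : probability Omega R).

Definition char_fun (X : Omega -> R) (theta : R) : R[i] :=
  (fine 'E_P[fun w => cos (theta * X w)]%E +i*
   fine 'E_P[fun w => sin (theta * X w)]%E)%C.

Definition sas_law (alpha sigma : R) (X : Omega -> R) : Prop :=
  measurable_fun setT X /\
  forall theta : R, char_fun X theta =
    (expR (- (sigma `^ alpha * `|theta| `^ alpha)))%:C%C.

(* M B is relevant only for measurable B of finite kappa-measure. *)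
Definition sas_random_measure d' (S : measurableType d') (alpha : R)
    (kappa : set S -> \bar R) (M : set S -> Omega -> R) : Prop :=
  [/\ forall B, measurable B -> (kappa B < +oo)%E ->
        sas_law alpha (fine (kappa B) `^ alpha^-1) (M B),
      forall (I : finType) (B : I -> set S),
        (forall i, measurable (B i) /\ (kappa (B i) < +oo)%E) ->
        trivIset setT B -> independent_family P (fun i => M (B i))
    & forall B : (set S)^nat, (forall i, measurable (B i)) ->
        trivIset setT B -> (kappa (\bigcup_i B i) < +oo)%E ->
        {ae P, forall w,
          series (fun i => M (B i) w) @ \oo --> M (\bigcup_i B i) w} ].

End stable.

Section karlin.
Context (R : realType).

Definition Gamma (s : R) : R :=
  \int[lebesgue_measure]_(x in `]0, +oo[) (x `^ (s - 1) * expR (- x)).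

Definition karlin_const (beta : R) : R := beta * 2 `^ (1 - beta) / Gamma (1 - beta).

Definition karlin_control d (E : measurableType d) (beta : R)
    (mu : set E -> \bar R) (B : set (point_measure E R)) : \bar R :=
  ((karlin_const beta)%:E *
   \int[lebesgue_measure]_(r in `]0%R, +oo[)
     ((r `^ (- beta - 1))%:E * poisson_law (fun A => r%:E * mu A) B))%E.

(* The set-indexed Karlin stable process driven by M:
   M is meant to be an SaS random measure with control measure
   karlin_control beta mu. *)
Definition karlin_process d (E : measurableType d) d' (Omega : measurableType d')
    (M : set (point_measure E R) -> Omega -> R) (A : set E) : Omega -> R :=
  M [set m | odd_count m A].

Definition odd_sum d (E : measurableType d) d' (Omega : measurableType d')
    (eps : nat -> Omega -> R) (N : nat -> Omega -> point_measure E R)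
    (A : set E) (w : Omega) : R :=
  limn (series (fun k => eps k w * \1_[set w' | odd_count (N k w') A] w)).

Definition slowly_varying (L : R -> R) : Prop :=
  [/\ exists2 X : R, 0 < X &
        measurable_fun `[X, +oo[ L /\ forall t, X <= t -> 0 < L t
    & forall lambda : R, 0 < lambda ->
        L (lambda * t) / L t @[t --> +oo] --> (1 : R)].

(* Sequences indexed by {1, 2, ...} are shifted to nat: p k is the term of index
   k + 1. So n = max {k >= 1 | p_k >= 1/t}, with max of the empty set being 0. *)
Definition is_count (p : nat -> R) (t : R) (n : nat) : Prop :=
  (forall k, 1 / t <= p k -> (k.+1 <= n)%N) /\
  (n = 0%N \/ exists2 k, n = k.+1 & 1 / t <= p k).

Definition cvg_fdd (J : Type) (D : set J) d (Omega : measurableType d)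
    (P : probability Omega R) (X : R -> J -> Omega -> R)
    d' (Omega' : measurableType d') (P' : probability Omega' R)
    (Y : J -> Omega' -> R) : Prop :=
  forall (n : nat) (A : 'I_n -> J), (forall i, D (A i)) ->
  forall f : 'rV[R]_n -> R, continuous f -> bounded_fun f ->
    'E_P[fun w => f (\row_i X rho (A i) w)]%E @[rho --> +oo] -->
    'E_P'[fun w => f (\row_i Y (A i) w)]%E.

End karlin.

(* Main.v *)
(* By independence, conditioning on which of the counts N_k(A_i) are odd gives
   E exp(i theta . U_rho / b) = prod_k (1 - sum_J (1 - phi(s_J / b)) q_k(J)),
   where s_J = sum_(i in J) theta_i and q_k(J) is the probability that
   J = {i : N_k(A_i) odd}.  A sum of parities of counts is the parity of the count
   of a symmetric difference, whose probability to be odd is explicit, so parity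
   inversion makes q_k(J) a linear combination of the terms
   1 - exp(-2 rho p_k mu(D)), D a symmetric difference of the A_i.  By Karlin,
   sum_k (1 - exp(-c rho p_k)) / nu(rho) tends to
   int_0^oo c exp(-c u) u^(-beta) du = beta int_0^oo (1 - exp(-c r)) r^(-beta-1) dr:
   dominated convergence for the integral of c exp(-c u) nu(rho / u) / nu(rho),
   followed by Tonelli.  The same inversion under the control measure identifies
   the limit as the joint characteristic function of Y.  Weak convergence then
   follows from tightness, which characteristic functions control near 0, and the
   uniform approximation on cubes of bounded continuous functions by bounded
   trigonometric polynomials. *)

Require Import Defs.
From HB Require Import structures.
From mathcomp Require Import all_boot all_order all_algebra.
From mathcomp Require Import all_classical all_reals all_analysis.
From mathcomp Require Import measurable_realfun.
From mathcomp Require Import ring lra.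

Set Implicit Arguments.
Unset Strict Implicit.
Unset Printing Implicit Defensive.

Import Order.TTheory GRing.Theory Num.Theory.
Import numFieldNormedType.Exports.

Local Open Scope classical_set_scope.
Local Open Scope ring_scope.

(** * Bounded random variables *)

(** At a fixed rho the sum over k is infinite, so every estimate is made on partial sums, uniformly
    in their length, and the length goes to infinity before rho does. Replacing each factor of the
    product by an exponential costs (sum_J gap_J + (sum_J tau_J)^2) sum_J sum_k q_k(J), where tau_J
    is a comparison value for 1 - phi(s_J / b) and gap_J its error. The last double sum has order
    nu(rho), and tau_J has order 1 / nu(rho) because b^alpha = (beta / c_beta) nu(rho) sigma^alpha;
    so the square is harmless and the gap has to be o(1 / nu(rho)). The values tau_J stay free:
    sigma^alpha |s_J / b|^alpha yields the limit, and 0 yields the bound on 1 - Re E exp(i t U / b)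
    near t = 0 from which tightness follows. The pattern in which every count is even has to be set
    apart: its control measure is infinite and its probabilities are not summable in k. For all
    other patterns the inversion leaves no constant term, which is what gives summability and
    integrability. The factor c_beta / beta of the control measure cancels against its inverse in
    b^alpha. *)

Section bounded_rv.
Context d (Omega : measurableType d) (R : realType) (P : probability Omega R).
Implicit Types X Y : Omega -> R.

Definition bounded_rv X : Prop :=
  measurable_fun setT X /\ exists C : R, forall w, `|X w| <= C.

Lemma bounded_rv_integrable X :
  bounded_rv X -> P.-integrable setT (EFin \o X).
Proof.
move=> [mX [C XC]]; apply: measurable_bounded_integrable => //.
  exact: le_lt_trans (@probability_le1 _ _ _ P _ measurableT) (ltry 1).
exists C; split; first exact: num_real.
by move=> M CM w _; apply: le_trans (XC w) (ltW CM).
Qed.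

Lemma bounded_rv_cst c : bounded_rv (fun=> c).
Proof. by split => //; exists `|c|. Qed.

Lemma bounded_rvD X Y :
  bounded_rv X -> bounded_rv Y -> bounded_rv (fun w => X w + Y w).
Proof.
move=> [mX [C XC]] [mY [D YD]]; split; first exact: measurable_funD.
by exists (C + D) => w; rewrite (le_trans (ler_normD _ _)) ?lerD.
Qed.

Lemma bounded_rvM X Y :
  bounded_rv X -> bounded_rv Y -> bounded_rv (fun w => X w * Y w).
Proof.
move=> [mX [C XC]] [mY [D YD]]; split; first exact: measurable_funM.
by exists (C * D) => w; rewrite normrM ler_pM.
Qed.

Lemma bounded_rvZ c X : bounded_rv X -> bounded_rv (fun w => c * X w).
Proof. by move=> bX; apply: bounded_rvM => //; exact: bounded_rv_cst. Qed.

Lemma bounded_rvN X : bounded_rv X -> bounded_rv (fun w => - X w).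
Proof.
move=> bX; rewrite (_ : (fun w => _) = (fun w => (-1) * X w)).
  exact: bounded_rvZ.
by apply/funext => w; rewrite mulN1r.
Qed.

Lemma bounded_rvB X Y :
  bounded_rv X -> bounded_rv Y -> bounded_rv (fun w => X w - Y w).
Proof. by move=> bX bY; apply: bounded_rvD => //; exact: bounded_rvN. Qed.

Lemma bounded_rv_norm X : bounded_rv X -> bounded_rv (fun w => `|X w|).
Proof.
move=> [mX [C XC]]; split; first exact: measurableT_comp.
by exists C => w; rewrite normr_id.
Qed.

Lemma bounded_rv_sum (I : Type) (s : seq I) (Q : pred I) (X : I -> Omega -> R) :
  (forall i, Q i -> bounded_rv (X i)) ->
  bounded_rv (fun w => \sum_(i <- s | Q i) X i w).
Proof.
move=> bX; elim: s => [|i s IH].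
  by under eq_fun do rewrite big_nil; exact: bounded_rv_cst.
under eq_fun do rewrite big_cons.
by case Qi: (Q i) => //; apply: bounded_rvD => //; exact: bX.
Qed.

Lemma bounded_rv_indic (A : set Omega) :
  measurable A -> bounded_rv (\1_A : Omega -> R).
Proof.
move=> mA; split => //; exists 1 => w.
by rewrite indicE; case: (_ \in _); rewrite ?normr1 ?normr0.
Qed.

Lemma bounded_rv_cos X : measurable_fun setT X -> bounded_rv (fun w => cos (X w)).
Proof.
move=> mX; split; last by exists 1 => w; exact: cos_max.
apply: measurableT_comp => //.
by apply: continuous_measurable_fun; exact: continuous_cos.
Qed.

Lemma bounded_rv_sin X : measurable_fun setT X -> bounded_rv (fun w => sin (X w)).
Proof.
move=> mX; split; last by exists 1 => w; exact: sin_max.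
apply: measurableT_comp => //.
by apply: continuous_measurable_fun; exact: continuous_sin.
Qed.

Lemma Rint_cst c : \int[P]_w c = c.
Proof.
rewrite Rintegral_cst//.
have -> : fine (P setT) = 1 by rewrite probability_setT.
by rewrite mulr1.
Qed.

Lemma RintD X Y : bounded_rv X -> bounded_rv Y ->
  \int[P]_w (X w + Y w) = \int[P]_w X w + \int[P]_w Y w.
Proof. by move=> bX bY; rewrite RintegralD//; exact: bounded_rv_integrable. Qed.

Lemma RintB X Y : bounded_rv X -> bounded_rv Y ->
  \int[P]_w (X w - Y w) = \int[P]_w X w - \int[P]_w Y w.
Proof. by move=> bX bY; rewrite RintegralB//; exact: bounded_rv_integrable. Qed.

Lemma RintZ c X : bounded_rv X -> \int[P]_w (c * X w) = c * \int[P]_w X w.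
Proof. by move=> bX; rewrite RintegralZl//; exact: bounded_rv_integrable. Qed.

Lemma Rint_sum (I : Type) (s : seq I) (Q : pred I) (X : I -> Omega -> R) :
  (forall i, Q i -> bounded_rv (X i)) ->
  \int[P]_w (\sum_(i <- s | Q i) X i w) = \sum_(i <- s | Q i) \int[P]_w X i w.
Proof.
move=> bX; elim: s => [|i s IH].
  by rewrite big_nil; under eq_Rintegral do rewrite big_nil; exact: Rint_cst.
rewrite big_cons; under eq_Rintegral do rewrite big_cons.
case Qi: (Q i) => //; rewrite RintD ?IH//; first exact: bX.
exact: bounded_rv_sum.
Qed.

Lemma le_Rint X Y : bounded_rv X -> bounded_rv Y -> (forall w, X w <= Y w) ->
  \int[P]_w X w <= \int[P]_w Y w.
Proof.
by move=> bX bY XY; apply: le_Rintegral => //; exact: bounded_rv_integrable.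
Qed.

Lemma norm_Rint_le X (Y : Omega -> R) : bounded_rv X -> bounded_rv Y ->
  (forall w, `|X w| <= Y w) -> `|\int[P]_w X w| <= \int[P]_w Y w.
Proof.
move=> bX bY XY; apply: le_trans (le_Rint (bounded_rv_norm bX) bY XY).
by apply: le_normr_Rintegral => //; exact: bounded_rv_integrable.
Qed.

Lemma norm_Rint_bound X c : bounded_rv X ->
  (forall w, `|X w| <= c) -> `|\int[P]_w X w| <= c.
Proof.
by move=> bX Xc; rewrite -[c]Rint_cst norm_Rint_le//; exact: bounded_rv_cst.
Qed.

Lemma Rint_indic (A : set Omega) :
  measurable A -> \int[P]_w (\1_A w : R) = fine (P A).
Proof. by move=> mA; rewrite /Rintegral integral_indic ?setIT. Qed.

Lemma EFin_Rint X : bounded_rv X ->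
  (\int[P]_w X w)%:E = (\int[P]_w (X w)%:E)%E.
Proof.
move=> bX; rewrite /Rintegral fineK//.
by apply: integrable_fin_num => //; exact: bounded_rv_integrable.
Qed.

Lemma Rint_dominated_cvg (X_ : nat -> Omega -> R) X (C : R) :
  (forall n, measurable_fun setT (X_ n)) -> measurable_fun setT X ->
  (forall n w, `|X_ n w| <= C) ->
  {ae P, forall w, X_ n w @[n --> \oo] --> X w} ->
  \int[P]_w X_ n w @[n --> \oo] --> \int[P]_w X w.
Proof.
move=> mX_ mX XC cX.
have ic : P.-integrable setT (EFin \o (fun=> C : R)).
  exact/bounded_rv_integrable/bounded_rv_cst.
have [] := @dominated_convergence _ _ _ P setT measurableT
  (fun n => EFin \o X_ n) (EFin \o X) (EFin \o (fun=> C : R)) _ _ _ ic.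
- by move=> n; exact/measurable_EFinP.
- exact/measurable_EFinP.
- by apply: filterS cX => w Xw _; apply/fine_cvgP; split => //; exact: nearW.
- by apply/aeW => w n _; rewrite /= lee_fin.
move=> iX _ cI; rewrite /Rintegral.
apply: fine_cvg; rewrite fineK; first exact: cI.
exact: integrable_fin_num iX.
Qed.

End bounded_rv.

(** * Uniform approximation by trigonometric polynomials *)

Section trigonometric_polynomials.
Context (R : realType) (n : nat).
Implicit Types (theta x : 'I_n -> R) (p q : ('I_n -> R) -> R).

Definition dotp theta x : R := \sum_i theta i * x i.

Lemma dotpDl t1 t2 x : dotp (fun i => t1 i + t2 i) x = dotp t1 x + dotp t2 x.
Proof. by rewrite -big_split; apply: eq_bigr => i _; rewrite mulrDl. Qed.

Lemma dotpBl t1 t2 x : dotp (fun i => t1 i - t2 i) x = dotp t1 x - dotp t2 x.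
Proof.
by rewrite -sumrB; apply: eq_bigr => i _; rewrite mulrBl.
Qed.

(** An inductive predicate lets the convergence of cosine and sine integrals pass to all
    trigonometric polynomials by induction, with no normal form to maintain. *)
Inductive trigpoly : (('I_n -> R) -> R) -> Prop :=
| trigpoly_cos theta : trigpoly (fun x => cos (dotp theta x))
| trigpoly_sin theta : trigpoly (fun x => sin (dotp theta x))
| trigpolyD p q : trigpoly p -> trigpoly q -> trigpoly (fun x => p x + q x)
| trigpolyZ c p : trigpoly p -> trigpoly (fun x => c * p x).

Lemma trigpoly_cst c : trigpoly (fun=> c).
Proof.
rewrite (_ : (fun=> c) = (fun x => c * cos (dotp (fun=> 0) x))).
  exact/trigpolyZ/trigpoly_cos.
apply/funext => x; rewrite [dotp _ _]big1 ?cos0 ?mulr1// => i _.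
by rewrite mul0r.
Qed.

Lemma trigpolyB p q :
  trigpoly p -> trigpoly q -> trigpoly (fun x => p x - q x).
Proof.
move=> tp tq; rewrite (_ : (fun x => _) = (fun x => p x + (-1) * q x)).
  exact/trigpolyD/trigpolyZ.
by apply/funext => x; rewrite mulN1r.
Qed.

(** Product-to-sum formulas turn a product of two generators into a combination of generators; the
    nested inductions distribute over sums and scalings. *)
Lemma trigpolyM p q :
  trigpoly p -> trigpoly q -> trigpoly (fun x => p x * q x).
Proof.
move=> tp; elim: tp q => [t|t|p1 p2 _ IH1 _ IH2|c p1 _ IH] q tq.
- elim: tq => [s|s|q1 q2 _ IH1 _ IH2|c q1 _ IH].
  + rewrite (_ : (fun x => _) = (fun x => 2^-1 *
      (cos (dotp (fun i => t i + s i) x) + cos (dotp (fun i => t i - s i) x)))).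
      by apply/trigpolyZ/trigpolyD; exact: trigpoly_cos.
    by apply/funext => x; rewrite dotpBl dotpDl cosB cosD; field.
  + rewrite (_ : (fun x => _) = (fun x => 2^-1 *
      (sin (dotp (fun i => t i + s i) x) - sin (dotp (fun i => t i - s i) x)))).
      by apply/trigpolyZ/trigpolyB; exact: trigpoly_sin.
    by apply/funext => x; rewrite dotpBl dotpDl sinB sinD; field.
  + rewrite (_ : (fun x => _) = (fun x => cos (dotp t x) * q1 x +
      cos (dotp t x) * q2 x)); first exact: trigpolyD.
    by apply/funext => x; rewrite mulrDr.
  + rewrite (_ : (fun x => _) = (fun x => c * (cos (dotp t x) * q1 x))).
      exact: trigpolyZ.
    by apply/funext => x; rewrite mulrCA.
- elim: tq => [s|s|q1 q2 _ IH1 _ IH2|c q1 _ IH].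
  + rewrite (_ : (fun x => _) = (fun x => 2^-1 *
      (sin (dotp (fun i => t i + s i) x) + sin (dotp (fun i => t i - s i) x)))).
      by apply/trigpolyZ/trigpolyD; exact: trigpoly_sin.
    by apply/funext => x; rewrite dotpBl dotpDl sinB sinD; field.
  + rewrite (_ : (fun x => _) = (fun x => 2^-1 *
      (cos (dotp (fun i => t i - s i) x) - cos (dotp (fun i => t i + s i) x)))).
      by apply/trigpolyZ/trigpolyB; exact: trigpoly_cos.
    by apply/funext => x; rewrite dotpBl dotpDl cosB cosD; field.
  + rewrite (_ : (fun x => _) = (fun x => sin (dotp t x) * q1 x +
      sin (dotp t x) * q2 x)); first exact: trigpolyD.
    by apply/funext => x; rewrite mulrDr.
  + rewrite (_ : (fun x => _) = (fun x => c * (sin (dotp t x) * q1 x))).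
      exact: trigpolyZ.
    by apply/funext => x; rewrite mulrCA.
- rewrite (_ : (fun x => _) = (fun x => p1 x * q x + p2 x * q x)).
    by apply: trigpolyD; [exact: IH1|exact: IH2].
  by apply/funext => x; rewrite mulrDl.
- rewrite (_ : (fun x => _) = (fun x => c * (p1 x * q x))).
    exact/trigpolyZ/IH.
  by apply/funext => x; rewrite mulrA.
Qed.

Lemma trigpoly_sum (I : Type) (s : seq I) (p : I -> ('I_n -> R) -> R) :
  (forall i, trigpoly (p i)) -> trigpoly (fun x => \sum_(i <- s) p i x).
Proof.
move=> tp; elim: s => [|i s IH].
  by under eq_fun do rewrite big_nil; exact: trigpoly_cst.
by under eq_fun do rewrite big_cons; exact: trigpolyD.
Qed.

Lemma trigpoly_prod (I : Type) (s : seq I) (p : I -> ('I_n -> R) -> R) :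
  (forall i, trigpoly (p i)) -> trigpoly (fun x => \prod_(i <- s) p i x).
Proof.
move=> tp; elim: s => [|i s IH].
  by under eq_fun do rewrite big_nil; exact: trigpoly_cst.
by under eq_fun do rewrite big_cons; exact: trigpolyM.
Qed.

Lemma trigpoly_coord_cos i a b : trigpoly (fun x => cos (a * x i + b)).
Proof.
pose t j : R := if j == i then a else 0.
have dE x : dotp t x = a * x i.
  rewrite /dotp (bigD1 i)//= /t eqxx big1 ?addr0// => j ji.
  by rewrite (negbTE ji) mul0r.
rewrite (_ : (fun x => _) =
    (fun x => cos b * cos (dotp t x) - sin b * sin (dotp t x))).
  by apply: trigpolyB; apply: trigpolyZ; constructor.
by apply/funext => x; rewrite dE cosD; ring.
Qed.

End trigonometric_polynomials.

(** * Fejer kernels on a uniform grid *)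

Section grid_kernel.
Context (R : realType).

(** Multiplying by 2 sin h, with h half the angular step, makes the sum telescope to two values of
    sine whose arguments differ by q full turns. The bounds on q put h in (0, pi), so that sin h can
    be cancelled. *)
Lemma sum_cos_grid (N q : nat) (c : R) : (0 < q < N)%N ->
  \sum_(j < N) cos (c + q%:R * (2 * pi * j%:R / N%:R)) = 0.
Proof.
move=> /andP[q0 qN]; have Nn : (0 < N)%N by rewrite (leq_trans _ qN).
have N0 : (0 : R) < N%:R by rewrite ltr0n.
pose h : R := q%:R * pi / N%:R.
have h0 : 0 < sin h.
  apply: sin_gt0_pi; rewrite /h divr_gt0 ?mulr_gt0 ?pi_gt0 ?ltr0n//=.
  by rewrite ltr_pdivrMr// mulrC ltr_pM2l ?pi_gt0// ltr_nat.
have sh : 2 * sin h != 0 by rewrite lt0r_neq0// mulr_gt0.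
apply: (mulfI sh).
pose s (j : nat) : R := sin (c + 2 * h * j%:R - h).
rewrite mulr0 mulr_sumr (eq_bigr (fun j : 'I_N => s j.+1 - s j)); last first.
  move=> j _; rewrite /s.
  have -> : c + 2 * h * j.+1%:R - h = c + 2 * h * j%:R + h.
    by rewrite -natr1; ring.
  have -> : q%:R * (2 * pi * j%:R / N%:R) = 2 * h * j%:R.
    by rewrite /h; field; rewrite gt_eqF.
  by rewrite sinB sinD; ring.
rewrite -(big_mkord xpredT (fun j => s j.+1 - s j)) telescope_sumr//.
rewrite /s mulr0 addr0.
have -> : c + 2 * h * N%:R - h = c - h + (pi *+ 2) *+ q.
  by rewrite /h -[_ *+ q]mulr_natr -[pi *+ 2]mulr_natr; field; rewrite gt_eqF.
by rewrite (periodicn (@sinD2pi R)) subrr.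
Qed.

Variable m : nat.
(** The kernel has frequencies up to m, and multiplying it by a cosine brings in m + 1; with m + 2
    nodes the orthogonality relations are exact for all of these. *)
Let N := m.+2.

Definition grid (j : nat) : R := 2 * pi * j%:R / N%:R - pi.

Let N0 : (0 : R) < N%:R. Proof. by rewrite ltr0n. Qed.

(** Discrete orthogonality: u and the shift of the nodes by pi only enter the phase c of
    [sum_cos_grid]. *)
Lemma sum_cos_gridB (a b : nat) (u : R) : (a < N)%N -> (b < N)%N ->
  \sum_(j < N) cos ((a%:R - b%:R) * (u - grid j)) = if a == b then N%:R else 0.
Proof.
wlog : a b / (a <= b)%N => [hw aN bN|].
  have [ab|/ltnW ba] := leqP a b; first exact: hw.
  rewrite eq_sym -hw//; apply: eq_bigr => j _.
  by rewrite -cosN; congr cos; ring.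
rewrite leq_eqVlt => /predU1P[->|ab] aN bN.
  rewrite eqxx (eq_bigr (fun=> 1)); last first.
    by move=> j _; rewrite subrr mul0r cos0.
  by rewrite sumr_const card_ord.
rewrite ltn_eqF// -[RHS](@sum_cos_grid N (b - a)
  (- (b - a)%:R * u - (b - a)%:R * pi)); last first.
  by rewrite subn_gt0 ab/= (leq_ltn_trans _ bN)// leq_subr.
apply: eq_bigr => j _; congr cos; rewrite /grid natrB 1?ltnW//.
by field; rewrite gt_eqF.
Qed.

(** The Fejer kernel |sum_(k <= m) exp(i k t)|^2, normalized to have total mass 1 on the grid. As a
    sum of squares it is visibly nonnegative. *)
Definition grid_kernel (t : R) : R := (N * m.+1)%:R^-1 *
  ((\sum_(k < m.+1) cos (k%:R * t)) ^+ 2 + (\sum_(k < m.+1) sin (k%:R * t)) ^+ 2).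

Lemma grid_kernel_ge0 t : 0 <= grid_kernel t.
Proof. by rewrite mulr_ge0 ?invr_ge0// addr_ge0// sqr_ge0. Qed.

Lemma grid_kernelE t : grid_kernel t = (N * m.+1)%:R^-1 *
  \sum_(k < m.+1) \sum_(l < m.+1) cos ((k%:R - l%:R) * t).
Proof.
congr (_ * _); rewrite !expr2 !big_distrlr/= -big_split; apply: eq_bigr => k _ /=.
by rewrite -big_split; apply: eq_bigr => l _ /=; rewrite mulrBl cosB.
Qed.

Lemma sum_grid_kernel u : \sum_(j < N) grid_kernel (u - grid j) = 1.
Proof.
under eq_bigr do rewrite grid_kernelE.
rewrite -mulr_sumr exchange_big/=.
under eq_bigr => k _.
  rewrite exchange_big/= (eq_bigr (fun l : 'I_m.+1 =>
    if l == k then N%:R else 0)); last first.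
    move=> l _; rewrite sum_cos_gridB ?(ltn_trans (ltn_ord _))//.
    by rewrite eq_sym.
  rewrite -big_mkcond big_pred1_eq.
  over.
rewrite /= sumr_const card_ord -[N%:R *+ _]mulr_natr -natrM mulVf//.
by rewrite pnatr_eq0 muln_eq0.
Qed.

(** Multiplication by the cosine shifts the frequency difference k - l by 1 up or down.
    Orthogonality then keeps m pairs out of m + 1 in each direction, so the mean of the cosine is m
    / (m + 1). *)
Lemma sum_grid_kernel_cos u :
  \sum_(j < N) grid_kernel (u - grid j) * (1 - cos (u - grid j)) = m.+1%:R^-1.
Proof.
have S1 : \sum_(j < N) \sum_(k < m.+1) \sum_(l < m.+1)
    cos ((k.+1%:R - l%:R) * (u - grid j)) = N%:R * m%:R.
  rewrite exchange_big/=.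
  under eq_bigr => k _.
    rewrite exchange_big/= (eq_bigr (fun l : 'I_m.+1 =>
      if (k.+1 == l)%N then N%:R else 0)); last first.
      move=> l _; rewrite sum_cos_gridB//.
        by rewrite ltnS ltn_ord.
      by rewrite (ltn_trans (ltn_ord _)).
    over.
  rewrite big_ord_recr/= [X in _ + X]big1 ?addr0; last first.
    by move=> l _; rewrite gtn_eqF// ltn_ord.
  rewrite (eq_bigr (fun=> N%:R)); last first.
    move=> k _; have km : (k.+1 < m.+1)%N by rewrite ltnS.
    rewrite (bigD1 (Ordinal km))//= eqxx big1 ?addr0// => l lk.
    by case: eqP => // kl; case/eqP: lk; apply: val_inj.
  by rewrite sumr_const card_ord -[N%:R *+ _]mulr_natr.
have S2 : \sum_(j < N) \sum_(k < m.+1) \sum_(l < m.+1)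
    cos ((k%:R - l.+1%:R) * (u - grid j)) = N%:R * m%:R.
  rewrite -[RHS]S1; apply: eq_bigr => j _; rewrite exchange_big/=.
  apply: eq_bigr => k _; apply: eq_bigr => l _.
  by rewrite -cosN; congr cos; ring.
under eq_bigr do rewrite mulrBr mulr1.
rewrite sumrB sum_grid_kernel.
rewrite (eq_bigr (fun j : 'I_N => (N * m.+1)%:R^-1 * (2^-1 *
   (\sum_(k < m.+1) \sum_(l < m.+1) cos ((k.+1%:R - l%:R) * (u - grid j)) +
    \sum_(k < m.+1) \sum_(l < m.+1) cos ((k%:R - l.+1%:R) * (u - grid j))))));
    last first.
  move=> j _; rewrite grid_kernelE -mulrA; congr (_ * _).
  rewrite -big_split/= big_distrl/= mulr_sumr; apply: eq_bigr => k _.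
  rewrite -big_split/= big_distrl/= mulr_sumr; apply: eq_bigr => l _.
  move: (u - grid j) => t.
  have -> : (k.+1%:R - l%:R) * t = (k%:R - l%:R) * t + t by rewrite -natr1; ring.
  have -> : (k%:R - l.+1%:R) * t = (k%:R - l%:R) * t - t by rewrite -natr1; ring.
  by rewrite cosB cosD; field.
rewrite -mulr_sumr -mulr_sumr big_split/= S1 S2 natrM -[in RHS]natr1.
rewrite -(natr1 m); field.
by rewrite natr1 !pnatr_eq0.
Qed.

Lemma grid_bounds (j : 'I_N) : - pi <= grid j <= pi.
Proof.
rewrite /grid; apply/andP; split.
  by rewrite lerDr !mulr_ge0 ?invr_ge0 ?pi_ge0.
rewrite lerBlDr ler_pdivrMr// -mulr2n -[pi *+ 2]mulr_natl.
by rewrite ler_pM2l ?mulr_gt0 ?pi_gt0// ler_nat ltnW.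
Qed.

(** Confining u to half a period gives |u - y| <= 3 pi / 2, so the difference cannot come back near
    2 pi, where the cosine is again close to 1. Up to pi the cosine decreases; from pi to 3 pi / 2
    it is nonpositive, whereas cos delta is nonnegative. *)
Lemma onem_cos_far (delta u y : R) : 0 <= delta <= pi / 2 ->
  - (pi / 2) <= u <= pi / 2 -> - pi <= y <= pi -> delta <= `|u - y| ->
  1 - cos delta <= 1 - cos (u - y).
Proof.
move=> /andP[d0 d2] /andP[u1 u2] /andP[y1 y2] duy.
rewrite lerD2l lerN2 -(cos_norm (u - y)).
have tle : `|u - y| <= pi + pi / 2 by rewrite ler_norml; apply/andP; split; lra.
have := pi_gt0 R => pi0.
have [tpi|tpi] := leP `|u - y| pi.
  by rewrite leNgt ltr_cos ?in_itv/= -?leNgt// ?normr_ge0 ?tpi// d0; lra.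
apply: (@le_trans _ _ 0); last first.
  by apply: cos_ge0_pihalf; apply/andP; split; lra.
rewrite -oppr_ge0.
have -> : - cos `|u - y| = cos (`|u - y| - pi).
  by rewrite cosB cospi sinpi mulr0 addr0 mulrN1.
by apply: cos_ge0_pihalf; apply/andP; split; lra.
Qed.

End grid_kernel.

Section trigpoly_approximation.
Context (R : realType) (n : nat).
Implicit Types (f : 'rV[R]_n -> R).

(** Only x is confined to the cube: the grid points that will stand for y fill a larger one. *)
Lemma uniform_continuity_cube f (T e : R) : continuous f -> 0 < e ->
  exists2 delta, 0 < delta & forall x y : 'I_n -> R, (forall i, `|x i| <= T) ->
    (forall i, `|x i - y i| < delta) ->
    `|f (\row_i x i) - f (\row_i y i)| <= e.
Proof.
move=> cf e0.
pose K := [set v : 'rV[R]_n | forall i, `[- T, T]%classic (v ord0 i)].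
have cK : compact K.
  by apply: (@rV_compact _ _ (fun=> `[- T, T]%classic)) => i; exact: segment_compact.
pose Q (r : R) (v : 'rV[R]_n) :=
  forall y : 'rV[R]_n, ball v r y -> `|f v - f y| <= e.
have : \forall r \near 0^'+, K `<=` Q r.
  move/compact_near_coveringP : cK; apply => v _.
  have /cvgrPdist_lt/(_ (e / 2)) := cf v.
  rewrite divr_gt0// => /(_ isT) /nbhs_ballP[r /= r0 rf].
  near=> v' d => y dy.
  have vv' : ball v (r / 2) v'.
    by near: v'; apply: nbhsx_ballx; rewrite divr_gt0.
  have dr : d <= r / 2 by near: d; apply: nbhs_right_le; rewrite divr_gt0.
  have vy : ball v r y.
    rewrite [r]splitr; apply: ball_triangle vv' _.
    exact: le_ball dr _ dy.
  have vv'r : ball v r v'.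
    by apply: le_ball vv'; rewrite ler_pdivrMr// ler_peMr ?ler1n// ltW.
  have := rf _ vv'r; have := rf _ vy => /=.
  rewrite -(subrKA (f v) (f v')) => h1 h2.
  rewrite (le_trans (ler_normD _ _))// [leRHS]splitr lerD//; last exact: ltW.
  by rewrite distrC ltW.
move/(filterI (nbhs_right_gt 0)) => /filter_ex[d [/= d0 dK]].
exists d => // x y xT xy; apply: dK.
  by move=> i /=; rewrite mxE in_itv/= -ler_norml.
by split => // i j; rewrite !mxE; exact: xy.
Unshelve. all: by end_near. Qed.

Lemma trigpoly_grid_kernel m i (a c : R) :
  trigpoly (fun x : 'I_n -> R => grid_kernel m (a * x i - c)).
Proof.
under eq_fun do rewrite grid_kernelE.
apply: trigpolyZ; apply: trigpoly_sum => k; apply: trigpoly_sum => l.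
have := trigpoly_coord_cos i ((k%:R - l%:R) * a) (- ((k%:R - l%:R) * c)).
by congr trigpoly; apply/funext => x; congr cos; ring.
Qed.

(* The approximant is a weighted average of the values of f at the points of a
   grid, with product Fejer weights: these sum to 1 exactly, and their mean of
   1 - cos tends to 0, so that the weights concentrate around x. *)
Lemma trigpoly_approx f (C T e : R) : continuous f -> (forall x, `|f x| <= C) ->
  0 < T -> 0 < e ->
  exists2 q : ('I_n -> R) -> R, trigpoly q /\ (forall x, `|q x| <= C) &
    forall x, (forall i, `|x i| <= T) -> `|q x - f (\row_i x i)| <= e.
Proof.
move=> cf fC T0 e0.
have C0 : 0 <= C by apply: le_trans (fC 0); rewrite normr_ge0.
have [d d0 dP] := uniform_continuity_cube T cf (divr_gt0 e0 (ltr0Sn R 1)).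
(* This scaling maps [-T, T] onto [-pi / 2, pi / 2], half a period, as [onem_cos_far] requires; the
   cap pi / 2 on [delta] below has the same purpose. *)
pose lam : R := pi / (2 * T).
have lam0 : 0 < lam by rewrite divr_gt0 ?pi_gt0 ?mulr_gt0.
have lamT x : `|x| <= T -> - (pi / 2) <= lam * x <= pi / 2.
  have -> : pi / 2 = lam * T :> R by rewrite /lam; field; rewrite gt_eqF.
  by rewrite -mulrN !ler_pM2l// -ler_norml.
pose delta : R := Num.min (lam * d) (pi / 2).
have delta0 : 0 < delta by rewrite lt_min mulr_gt0//= divr_gt0 ?pi_gt0.
have deltap : delta <= pi / 2 by rewrite ge_min lexx orbT.
pose kappa : R := 1 - cos delta.
have kappa0 : 0 < kappa.
  rewrite subr_gt0 -cos0 ltr_cos// in_itv/= ?lexx ?pi_ge0// ltW//=.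
  by rewrite (le_trans deltap)// ler_pdivrMr// ler_peMr ?ler1n ?pi_ge0.
(* Chebyshev's inequality: at a grid point far from x the error 2 C is at most [B] times a value of
   1 - cos, whose weighted mean is 1 / (m + 1) in each coordinate. *)
pose B : R := 2 * C / kappa.
have B0 : 0 <= B by rewrite divr_ge0 ?mulr_ge0// ltW.
have [m mP] : exists m, B * n%:R * m.+1%:R^-1 <= e / 2.
  exists (Num.truncn (B * n%:R / (e / 2))).
  rewrite ler_pdivrMr// -ler_pdivrMl ?divr_gt0// [leLHS]mulrC ltW//.
  exact: truncnS_gt.
pose w (x : 'I_n -> R) (j : {ffun 'I_n -> 'I_m.+2}) : R :=
  \prod_i grid_kernel m (lam * x i - grid R m (j i)).
pose z (j : {ffun 'I_n -> 'I_m.+2}) (i : 'I_n) : R := grid R m (j i) / lam.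
have w0 x j : 0 <= w x j by apply: prodr_ge0 => i _; exact: grid_kernel_ge0.
have w1 x : \sum_j w x j = 1.
  rewrite /w -(bigA_distr_bigA (fun i (j : 'I_m.+2) =>
    grid_kernel m (lam * x i - grid R m j))).
  by rewrite big1// => i _; exact: sum_grid_kernel.
(* The factor 1 - cos is put into coordinate i of the product only; the sums over the other
   coordinates equal 1. *)
have wcos x i : \sum_j w x j * (1 - cos (lam * x i - grid R m (j i))) = m.+1%:R^-1.
  pose G l (j : 'I_m.+2) := grid_kernel m (lam * x l - grid R m j) *
    (if l == i then 1 - cos (lam * x l - grid R m j) else 1).
  transitivity (\sum_(j : {ffun 'I_n -> 'I_m.+2}) \prod_l G l (j l)).
    apply: eq_bigr => j _; rewrite /G big_split/=; congr (_ * _).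
    by rewrite -big_mkcond big_pred1_eq.
  rewrite -(bigA_distr_bigA G) (bigD1 i)//= [X in _ * X]big1 ?mulr1.
    by rewrite /G eqxx; exact: sum_grid_kernel_cos.
  move=> l li; rewrite /G (negbTE li).
  by under eq_bigr do rewrite mulr1; exact: sum_grid_kernel.
exists (fun x => \sum_j f (\row_i z j i) * w x j).
  split.
    apply: trigpoly_sum => j; apply: trigpolyZ; apply: trigpoly_prod => i.
    exact: trigpoly_grid_kernel.
  move=> x; rewrite (le_trans (ler_norm_sum _ _ _))//.
  rewrite -[C]mulr1 -(w1 x) mulr_sumr; apply: ler_sum => j _.
  by rewrite normrM (ger0_norm (w0 _ _)) ler_wpM2r.
move=> x xT.
rewrite -[f (\row_i x i)]mulr1 -(w1 x) mulr_sumr -sumrB.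
rewrite (le_trans (ler_norm_sum _ _ _))//.
have key j : `|f (\row_i z j i) - f (\row_i x i)| <=
    e / 2 + B * \sum_i (1 - cos (lam * x i - grid R m (j i))).
  have c0 i : 0 <= 1 - cos (lam * x i - grid R m (j i)).
    by rewrite subr_ge0 cos_le1.
  have [near|] := pselect (forall i, `|x i - z j i| < d).
    rewrite distrC (le_trans (dP _ _ xT near))// lerDl mulr_ge0// sumr_ge0//.
  move=> /existsNP[i /negP]; rewrite -leNgt => far.
  rewrite ler_wpDl//; first by rewrite divr_ge0// ltW.
  apply: (@le_trans _ _ (2 * C)).
    by rewrite (le_trans (ler_normB _ _))// mulr_natl mulr2n lerD.
  rewrite /B -mulrA ler_peMr ?mulr_ge0// mulrC ler_pdivlMr// mul1r.
  rewrite (bigD1 i)//= ler_wpDr ?sumr_ge0//.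
  apply: onem_cos_far; rewrite ?(ltW delta0)//.
  - exact: lamT.
  - exact: grid_bounds.
  - have -> : lam * x i - grid R m (j i) = lam * (x i - z j i).
      by rewrite /z; field; rewrite gt_eqF.
    by rewrite normrM (gtr0_norm lam0) ge_min ler_pM2l// far.
apply: (@le_trans _ _ (\sum_j (e / 2 * w x j +
    B * \sum_i w x j * (1 - cos (lam * x i - grid R m (j i)))))).
  apply: ler_sum => j _.
  rewrite -mulrBl normrM (ger0_norm (w0 _ _)) (le_trans (ler_wpM2r _ (key j)))//.
  by rewrite -mulr_sumr le_eqVlt; apply/orP; left; apply/eqP; ring.
rewrite big_split/= -mulr_sumr w1 mulr1 -mulr_sumr exchange_big/=.
rewrite (eq_bigr (fun=> m.+1%:R^-1)); last by move=> i _; exact: wcos.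
rewrite sumr_const card_ord -[_ *+ n]mulr_natl mulrA [leRHS]splitr lerD2l.
exact: mP.
Qed.

End trigpoly_approximation.

(** * Tightness and the continuity theorem *)

Section tail_bound.
Context d (Omega : measurableType d) (R : realType) (P : probability Omega R).

Lemma measurable_norm_gt (X : Omega -> R) (T : R) :
  measurable_fun setT X -> measurable [set w | T < `|X w|].
Proof.
move=> mX; rewrite -[[set _ | _]]setTI.
exact: (measurable_fun_ltr (measurable_cst T) (measurableT_comp (@normr_measurable R setT) mX)).
Qed.

Lemma tail_cvg0 (X : Omega -> R) : measurable_fun setT X ->
  \int[P]_w \1_[set w | k%:R < `|X w|] w @[k --> \oo] --> (0 : R).
Proof.
move=> mX; rewrite -(@Rint_cst _ _ _ P 0).
apply: (@Rint_dominated_cvg _ _ _ _ _ _ 1) => //.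
- by move=> n; exact/measurable_indic/measurable_norm_gt.
- by move=> n w; rewrite indicE; case: (_ \in _); rewrite ?normr1 ?normr0.
apply: aeW => w; apply: cvg_near_cst; near=> k.
rewrite indicE memNset//= => kX.
have : `|X w| <= k%:R by near: k; exact: nbhs_infty_ger.
by rewrite leNgt kX.
Unshelve. all: by end_near. Qed.

(* Each x with |x| > T lies in exactly one dyadic shell 2^j T < |x| <= 2^(j+1) T,
   where 1 - cos (2^-j x / T) is bounded below. *)
Lemma tail_char_bound (X : Omega -> R) (C a T : R) : measurable_fun setT X ->
  0 < a -> 0 <= C -> 0 < T ->
  (forall theta, \int[P]_w (1 - cos (theta * X w)) <= C * `|theta| `^ a) ->
  \int[P]_w \1_[set w | T < `|X w|] w <=
    C / ((1 - cos 1) * (1 - 2^-1 `^ a)) * T^-1 `^ a.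
Proof.
move=> mX a0 C0 T0 hX.
have k0 : (0 : R) < 1 - cos 1.
  have := pi_ge2 R => pi2; rewrite subr_gt0 -[ltRHS]cos0.
  by rewrite ltr_cos ?in_itv/=; [exact: ltr01|apply/andP; split; lra..].
set r : R := 2^-1 `^ a.
have r1 : r < 1.
  have e1 : 1 `^ a = 1 :> R by rewrite powR1.
  rewrite -[ltRHS]e1 gt0_ltr_powR// ?nnegrE ?invr_ge0 ?ler0n//.
  by rewrite invf_lt1 ?ltr1n.
have r0 : 0 <= r by exact: powR_ge0.
(* Cutting off at 2^J T leaves finitely many shells, hence a finite sum of expectations bounded
   uniformly in J; dominated convergence then removes the cutoff. *)
pose S (J : nat) := [set w | T < `|X w| /\ `|X w| <= 2 ^+ J * T].
have mS J : measurable (S J).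
  have -> : S J = [set w | T < `|X w|] `\` [set w | 2 ^+ J * T < `|X w|].
    apply/seteqP; split => w /= [h1 h2]; split => //; last by rewrite leNgt; exact/negP.
    by apply/negP; rewrite -leNgt.
  by apply: measurableD; exact: measurable_norm_gt.
have bS J : \int[P]_w \1_(S J) w <= C / ((1 - cos 1) * (1 - r)) * T^-1 `^ a.
  have step w : \1_(S J) w <= \sum_(j < J)
      (1 - cos 1)^-1 * (1 - cos ((2^-1 ^+ j / T) * X w)).
    have c0 j : 0 <= (1 - cos 1)^-1 * (1 - cos ((2^-1 ^+ j / T) * X w)).
      by rewrite mulr_ge0 ?invr_ge0 ?(ltW k0)// subr_ge0 cos_le1.
    rewrite indicE; have [|_] := boolP (w \in S J); last by rewrite sumr_ge0.
    rewrite inE => -[]; elim: J => [|J IH] TX XJ.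
      by move: (lt_le_trans TX XJ); rewrite expr0 mul1r ltxx.
    rewrite big_ord_recr/=; have [XJ'|XJ'] := leP `|X w| (2 ^+ J * T).
      by rewrite ler_wpDr// IH.
    rewrite ler_wpDl ?sumr_ge0// mulrC ler_pdivlMr// mul1r lerD2l lerN2.
    rewrite -cos_norm normrM ger0_norm ?divr_ge0 ?exprn_ge0 ?(ltW T0)//.
    rewrite exprVn -invfM mulrC.
    have D0 : 0 < 2 ^+ J * T by rewrite mulr_gt0 ?exprn_gt0.
    have h1 : 1 <= `|X w| / (2 ^+ J * T) by rewrite ler_pdivlMr// mul1r ltW.
    have h2 : `|X w| / (2 ^+ J * T) <= 2.
      by rewrite ler_pdivrMr// mulrA -exprS.
    have := pi_ge2 R => pi2.
    by rewrite leNgt ltr_cos ?in_itv/=; [rewrite -leNgt|apply/andP; split; lra..].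
  apply: le_trans (le_Rint P _ _ step) _.
  - exact: bounded_rv_indic.
  - apply: bounded_rv_sum => j _; apply: bounded_rvZ.
    by apply: bounded_rvB; [exact: bounded_rv_cst|apply: bounded_rv_cos; exact: measurable_funM].
  rewrite Rint_sum; last first.
    move=> j _; apply: bounded_rvZ.
    by apply: bounded_rvB; [exact: bounded_rv_cst|apply: bounded_rv_cos; exact: measurable_funM].
  apply: (@le_trans _ _ (\sum_(j < J) (1 - cos 1)^-1 * (C * (T^-1 `^ a * r ^+ j)))).
    apply: ler_sum => j _; rewrite RintZ; last first.
      by apply: bounded_rvB; [exact: bounded_rv_cst|apply: bounded_rv_cos; exact: measurable_funM].
    rewrite ler_wpM2l ?invr_ge0 ?(ltW k0)// (le_trans (hX _))//.
    rewrite ger0_norm ?divr_ge0 ?exprn_ge0 ?(ltW T0)//.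
    rewrite powRM ?exprn_ge0 ?invr_ge0 ?(ltW T0)// [_ * T^-1 `^ a]mulrC.
    have -> : (2^-1 ^+ j) `^ a = r ^+ j :> R.
      by rewrite -!powR_mulrn ?invr_ge0// -!powRrM mulrC.
    by [].
  rewrite -mulr_sumr -mulr_sumr -mulr_sumr.
  have geo : \sum_(j < J) r ^+ j <= (1 - r)^-1.
    have -> : \sum_(j < J) r ^+ j = (1 - r ^+ J) / (1 - r).
      by rewrite -[1 - r ^+ J]opprB subrX1 -mulNr opprB mulrC mulKf// subr_eq0 gt_eqF.
    by rewrite ler_pdivrMr ?subr_gt0// mulVf ?subr_eq0 ?gt_eqF// lerBlDr lerDl exprn_ge0.
  rewrite [leRHS](_ : _ = (1 - cos 1)^-1 * (C * (T^-1 `^ a * (1 - r)^-1))).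
    by rewrite !ler_wpM2l ?invr_ge0 ?(ltW k0)// powR_ge0.
  by rewrite invfM; ring.
apply: (@cvgr_to_le _ \oo _ _ (fun J => \int[P]_w \1_(S J) w)); last exact: nearW.
apply: (@Rint_dominated_cvg _ _ _ _ _ _ 1) => //.
- by move=> n; exact: measurable_indic.
- exact/measurable_indic/measurable_norm_gt.
- by move=> n w; rewrite indicE; case: (_ \in _); rewrite ?normr1 ?normr0.
apply: aeW => w; apply: cvg_near_cst; near=> J; rewrite !indicE.
have XJ : `|X w| <= 2 ^+ J * T.
  rewrite -ler_pdivrMr//.
  have tJ : (Num.truncn (`|X w| / T) < J)%N by near: J; exact: nbhs_infty_gt.
  apply: le_trans (ltW (truncnS_gt _)) _.
  by rewrite -natrX ler_nat (leq_trans tJ)// ltnW// ltn_expl.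
suff -> : (w \in S J) = (w \in [set w | T < `|X w|]) by [].
by apply/idP/idP; rewrite !inE; [case|split].
Unshelve. all: by end_near. Qed.

End tail_bound.

Section continuous_functions_of_rvs.
Context d (Omega : measurableType d) (R : realType) (P : probability Omega R).
Context (n : nat).
Implicit Types (X : 'I_n -> Omega -> R).

Lemma measurable_dotp (theta : 'I_n -> R) X :
  (forall i, measurable_fun setT (X i)) ->
  measurable_fun setT (fun w => dotp theta (X ^~ w)).
Proof.
move=> mX; rewrite /dotp; apply: measurable_sum => i.
by apply: measurable_funM.
Qed.

Lemma bounded_rv_trigpoly (q : ('I_n -> R) -> R) X : trigpoly q ->
  (forall i, measurable_fun setT (X i)) -> bounded_rv (fun w => q (X ^~ w)).
Proof.
move=> tq mX; elim: tq => [t|t|p1 p2 _ IH1 _ IH2|c p1 _ IH].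
- exact/bounded_rv_cos/measurable_dotp.
- exact/bounded_rv_sin/measurable_dotp.
- exact: bounded_rvD.
- exact: bounded_rvZ.
Qed.

(** Measurability comes from the approximation theorem: on growing cubes f is approximated by
    trigonometric polynomials, so f of the random vector is a pointwise limit of measurable
    functions. *)
Lemma bounded_rv_continuous (f : 'rV[R]_n -> R) (C : R) X : continuous f ->
  (forall x, `|f x| <= C) ->
  (forall i, measurable_fun setT (X i)) ->
  bounded_rv (fun w => f (\row_i X i w)).
Proof.
move=> cf fC mX; split; last by exists C.
have /choice[q qP] (m : nat) : exists q : ('I_n -> R) -> R, trigpoly q /\
    forall x, (forall i, `|x i| <= m.+1%:R) ->
    `|q x - f (\row_i x i)| <= m.+1%:R^-1.
  have [q [tq _] qf] := @trigpoly_approx R n f C m.+1%:R m.+1%:R^-1 cf fC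
    (ltr0Sn _ _) ltac:(by rewrite invr_gt0).
  by exists q.
apply: (@measurable_fun_cvg _ _ _ _ (fun m w => q m (X ^~ w))).
  by move=> m; have [] := bounded_rv_trigpoly (qP m).1 mX.
move=> w _; apply/cvgrPdist_le => e e0; near=> m.
rewrite distrC (le_trans ((qP m).2 _ _))//.
  near: m.
  suff : forall i, \forall m \near \oo, `|X i w| <= m.+1%:R.
    by move/filter_forall.
  by move=> i; near=> m; rewrite (@le_trans _ _ m%:R) ?ler_nat//; near: m; exact: nbhs_infty_ger.
have em : e^-1 <= m%:R by near: m; exact: nbhs_infty_ger.
rewrite invf_ple ?posrE// (le_trans em)// ler_nat//.
Unshelve. all: by end_near. Qed.

(** Inside the cube the integrands differ by at most e. Outside it they differ by at most 2 C, and a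
    union bound over coordinates controls the probability. *)
Lemma trigpoly_cube_dist (f : 'rV[R]_n -> R) (q : ('I_n -> R) -> R) (C T e eta : R) X :
  continuous f -> (forall x, `|f x| <= C) ->
  trigpoly q -> (forall x, `|q x| <= C) -> 0 <= e ->
  (forall x, (forall i, `|x i| <= T) -> `|q x - f (\row_i x i)| <= e) ->
  (forall i, measurable_fun setT (X i)) ->
  (forall i, \int[P]_w \1_[set w | T < `|X i w|] w <= eta) ->
  `|\int[P]_w q (X ^~ w) - \int[P]_w f (\row_i X i w)| <=
    e + 2 * C * (n%:R * eta).
Proof.
move=> cf fC tq qC e0 qf mX tail.
have C0 : 0 <= C by apply: le_trans (fC 0); rewrite normr_ge0.
have bq := bounded_rv_trigpoly tq mX.
have bf := bounded_rv_continuous cf fC mX.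
have b1 i : bounded_rv (\1_[set w | T < `|X i w|] : Omega -> R).
  exact/bounded_rv_indic/measurable_norm_gt.
rewrite -RintB//.
apply: (@le_trans _ _ (\int[P]_w (e + 2 * C * \sum_i \1_[set w | T < `|X i w|] w))).
  apply: norm_Rint_le.
  - exact: bounded_rvB.
  - apply: bounded_rvD; first exact: bounded_rv_cst.
    exact/bounded_rvZ/bounded_rv_sum.
  move=> w; have s0 : 0 <= \sum_i \1_[set w | T < `|X i w|] w :> R.
    by apply: sumr_ge0 => i _; rewrite indicE.
  have [|] := pselect (forall i, `|X i w| <= T).
    by move=> /qf h; rewrite (le_trans h)// lerDl mulr_ge0// mulr_ge0.
  move=> /existsNP[i /negP]; rewrite -ltNge => Ti.
  rewrite ler_wpDl// (@le_trans _ _ (2 * C))//.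
    by rewrite (le_trans (ler_normB _ _))// mulr_natl mulr2n lerD.
  rewrite ler_peMr ?mulr_ge0// (bigD1 i)//= indicE mem_set//= ler_wpDr//.
  by apply: sumr_ge0 => j _; rewrite indicE.
rewrite RintD ?Rint_cst; [|exact: bounded_rv_cst|exact/bounded_rvZ/bounded_rv_sum].
rewrite lerD2l RintZ; last exact: bounded_rv_sum.
rewrite ler_wpM2l ?mulr_ge0// Rint_sum//.
rewrite mulr_natl -[n in leRHS]card_ord -sumr_const; exact: ler_sum.
Qed.

End continuous_functions_of_rvs.

Section levy_continuity.
Context (R : realType) (n : nat) (I : Type) (F : set_system I) {FF : ProperFilter F}.
Context d (Omega : measurableType d) (P : probability Omega R).
Context d' (Omega' : measurableType d') (P' : probability Omega' R).
Context (X : I -> 'I_n -> Omega -> R) (Y : 'I_n -> Omega' -> R).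
Hypothesis mX : \forall t \near F, forall i, measurable_fun setT (X t i).
Hypothesis mY : forall i, measurable_fun setT (Y i).
Hypothesis cvg_cos : forall theta : 'I_n -> R,
  \int[P]_w cos (dotp theta ((X t) ^~ w)) @[t --> F] -->
  \int[P']_w cos (dotp theta (Y ^~ w)).
Hypothesis cvg_sin : forall theta : 'I_n -> R,
  \int[P]_w sin (dotp theta ((X t) ^~ w)) @[t --> F] -->
  \int[P']_w sin (dotp theta (Y ^~ w)).
Hypothesis char_bound : forall i : 'I_n, exists C a : R, [/\ 0 <= C, 0 < a &
  \forall t \near F, forall theta : R,
    \int[P]_w (1 - cos (theta * X t i w)) <= C * `|theta| `^ a].

Lemma cvg_trigpoly (q : ('I_n -> R) -> R) : trigpoly q ->
  \int[P]_w q ((X t) ^~ w) @[t --> F] --> \int[P']_w q (Y ^~ w).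
Proof.
elim=> [t|t|p1 p2 tp1 IH1 tp2 IH2|c p1 tp1 IH]; [exact: cvg_cos|exact: cvg_sin|..].
- have bp1 := bounded_rv_trigpoly tp1 mY; have bp2 := bounded_rv_trigpoly tp2 mY.
  rewrite RintD//; apply: cvg_trans (cvgD IH1 IH2).
  apply: near_eq_cvg; near=> t.
  rewrite RintD//; apply: bounded_rv_trigpoly => //; by near: t.
- have bp1 := bounded_rv_trigpoly tp1 mY.
  rewrite RintZ//; apply: cvg_trans (cvgM (cvg_cst c) IH).
  apply: near_eq_cvg; near=> t.
  rewrite RintZ//; apply: bounded_rv_trigpoly => //; by near: t.
Unshelve. all: by end_near. Qed.

(** [char_bound] is uniform for t near [F], so [tail_char_bound] gives one threshold for all those
    t; Y is a fixed vector and needs only continuity of measure. *)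
Lemma uniform_tails (eta : R) : 0 < eta -> exists T : R, [/\ 0 < T,
  forall i, \int[P']_w \1_[set w | T < `|Y i w|] w <= eta &
  \forall t \near F, forall i, \int[P]_w \1_[set w | T < `|X t i w|] w <= eta].
Proof.
move=> eta0.
have mono d0 (O : measurableType d0) (Q : probability O R) (Z : O -> R) S T :
    measurable_fun setT Z -> S <= T -> \int[Q]_w \1_[set w | S < `|Z w|] w <= eta ->
    \int[Q]_w \1_[set w | T < `|Z w|] w <= eta.
  move=> mZ ST; apply: le_trans; apply: le_Rint.
  - exact/bounded_rv_indic/measurable_norm_gt.
  - exact/bounded_rv_indic/measurable_norm_gt.
  move=> w; rewrite !indicE ler_nat; have [|//] := boolP (w \in [set w | T < `|Z w|]).
  by rewrite inE/= => TZ; rewrite mem_set//=; exact: le_lt_trans TZ.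
have /choice[SY SYP] (i : 'I_n) : exists S : R, 0 < S /\
    \int[P']_w \1_[set w | S < `|Y i w|] w <= eta.
  have /cvgr0_norm_le/(_ eta eta0) := tail_cvg0 P' (mY i).
  move=> [k _ /(_ k.+1)/=]; rewrite leqnSn => /(_ isT) h.
  by exists k.+1%:R; split => //; exact: le_trans (ler_norm _) h.
have /choice[SX SXP] (i : 'I_n) : exists S : R, 0 < S /\
    \forall t \near F, \int[P]_w \1_[set w | S < `|X t i w|] w <= eta.
  have [C [a [C0 a0 hC]]] := char_bound i.
  pose K := C / ((1 - cos 1) * (1 - 2^-1 `^ a)).
  have [S S0 hS] : exists2 S : R, 0 < S & K * S^-1 `^ a <= eta.
    (* For this S one has S^(-a) = eta / (|K| + 1); the added 1 keeps S positive when K vanishes. *)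
    exists (((`|K| + 1) / eta) `^ a^-1).
      by rewrite powR_gt0// divr_gt0// ltr_wpDl.
    rewrite -powR_inv1 ?powR_ge0// -!powRrM mulN1r mulrN mulVf ?gt_eqF//.
    rewrite powR_inv1 ?divr_ge0 ?ler_wpDl// ?(ltW eta0)//.
    rewrite invf_div mulrCA ler_piMr ?(ltW eta0)// ler_pdivrMr ?ltr_wpDl// mul1r.
    by rewrite (le_trans (ler_norm _))// lerDl.
  exists S; split => //; near=> t.
  apply: le_trans hS; apply: tail_char_bound => //.
    by move: (i); near: t.
  by near: t.
(* The sum dominates every threshold at once, and the added 1 keeps T positive when n = 0. *)
pose T := \sum_i (SX i + SY i) + 1.
have XT i : SX i <= T /\ SY i <= T.
  have x0 j : 0 <= SX j + SY j.
    by have [/ltW ? _] := SXP j; have [/ltW ? _] := SYP j; rewrite addr_ge0.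
  have [/ltW ? _] := SXP i; have [/ltW ? _] := SYP i.
  rewrite /T (bigD1 i)//=.
  have : 0 <= \sum_(j < n | j != i) (SX j + SY j) by apply: sumr_ge0.
  by move=> ?; split; lra.
exists T; split.
- rewrite ltr_wpDl// sumr_ge0// => i _.
  by have [/ltW ? _] := SXP i; have [/ltW ? _] := SYP i; rewrite addr_ge0.
- by move=> i; apply: mono (XT i).2 (SYP i).2.
- have := filter_forall FF (fun i => (SXP i).2) => hX; near=> t => i.
  apply: mono (XT i).1 _; first by move: (i); near: t.
  by move: (i); near: t.
Unshelve. all: by end_near. Qed.

Lemma levy_continuity (f : 'rV[R]_n -> R) (C : R) :
  continuous f -> (forall x, `|f x| <= C) ->
  \int[P]_w f (\row_i X t i w) @[t --> F] --> \int[P']_w f (\row_i Y i w).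
Proof.
move=> cf fC; apply/cvgrPdist_le => e e0.
have C0 : 0 <= C by apply: le_trans (fC 0); rewrite normr_ge0.
(* Leaving the cube then costs at most e / 8. Two comparisons at 2 e / 8 each and one limit at e / 8
   make 5 e / 8 in total. *)
pose eta := e / 8 / (2 * C * n%:R + 1).
have D0 : 0 < 2 * C * n%:R + 1 by rewrite ltr_wpDl// !mulr_ge0.
have eta0 : 0 < eta by rewrite !divr_gt0.
have etaC : 2 * C * (n%:R * eta) <= e / 8.
  rewrite mulrA /eta mulrCA ler_piMr ?divr_ge0 ?(ltW e0)//.
  by rewrite ler_pdivrMr// mul1r lerDl.
have [T [T0 tY tX]] := uniform_tails eta0.
have e8 : 0 < e / 8 by rewrite divr_gt0.
have [q [tq qC] qf] := trigpoly_approx cf fC T0 e8.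
have := cvg_trigpoly tq => /cvgrPdist_le/(_ (e / 8) e8) qXY.
near=> t.
have qY := trigpoly_cube_dist (P := P') cf fC tq qC (ltW e8) qf mY tY.
have qX : `|\int[P]_w q (X t ^~ w) - \int[P]_w f (\row_i X t i w)| <=
    e / 8 + 2 * C * (n%:R * eta).
  apply: (trigpoly_cube_dist cf fC tq qC (ltW e8) qf).
    by near: t.
  by near: t.
have : `|\int[P']_w q (Y ^~ w) - \int[P]_w q (X t ^~ w)| <= e / 8 by near: t.
move: qX qY; rewrite !ler_norml.
move=> /andP[? ?] /andP[? ?] /andP[? ?]; apply/andP; split; lra.
Unshelve. all: by end_near. Qed.

End levy_continuity.

(** * Independence and characteristic functions *)

Section indep_integral.
Context d (Omega : measurableType d) (R : realType) (P : probability Omega R).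

(** W carries a product already treated and need not be an indicator, so independence enters as a
    factorization against level sets of f. Approximating f by multiples of 1 / M on such level sets
    extends it to f itself. *)
Lemma indep_Rint (W f : Omega -> R) (c : R) : bounded_rv W -> bounded_rv f ->
  (forall B : set R, measurable B ->
    \int[P]_w (W w * \1_(f @^-1` B) w) = c * fine (P (f @^-1` B))) ->
  \int[P]_w (W w * f w) = c * \int[P]_w f w.
Proof.
move=> bW bf H; have [mW [CW WC]] := bW; have [mf [C fC]] := bf.
have mfB B : measurable B -> measurable (f @^-1` B).
  by move=> mB; rewrite -[f @^-1` B]setTI; exact: mf.
(* The shift makes the function nonnegative, so that it can be rounded down by truncation. Taking B
   = setT in [H] identifies c with the integral of W, which undoes the shift. *)
pose g w := f w + C.
have bg : bounded_rv g by apply: bounded_rvD => //; exact: bounded_rv_cst.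
have C0 : 0 <= C by apply: le_trans (fC point); rewrite normr_ge0.
have CW0 : 0 <= CW by apply: le_trans (WC point); rewrite normr_ge0.
have gC w : 0 <= g w <= 2 * C.
  by have := fC w; rewrite ler_norml /g => /andP[? ?]; apply/andP; split; lra.
suff: `|\int[P]_w (W w * g w) - c * \int[P]_w g w| = 0.
  move/eqP; rewrite normr_eq0 subr_eq0 => /eqP.
  rewrite /g RintD ?Rint_cst//; last exact: bounded_rv_cst.
  under eq_Rintegral do rewrite mulrDr.
  rewrite RintD; [|exact: bounded_rvM|by apply: bounded_rvM => //; exact: bounded_rv_cst].
  have -> : \int[P]_w (W w * C) = c * C.
    rewrite RintegralZr//; last exact: bounded_rv_integrable.
    congr (_ * _); have := H setT measurableT.
    rewrite preimage_setT probability_setT mulr1 => <-.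
    by apply: eq_Rintegral => w _; rewrite indicT mulr1.
  by rewrite mulrDr => /addIr.
apply/eqP; rewrite eq_le normr_ge0 andbT; apply/ler_addgt0Pr => e e0; rewrite add0r.
(* Chosen so that the rounding error, at most (CW + |c|) / M, is below e. *)
pose M := (Num.truncn ((CW + `|c|) / e)).+1.
have M0 : (0 : R) < M%:R by rewrite ltr0n.
pose N := (Num.truncn (2 * C * M%:R)).+1.
pose B (k : nat) : set R := [set x | k%:R <= M%:R * (x + C) < k.+1%:R].
have mB k : measurable (B k).
  rewrite (_ : B k = `[k%:R / M%:R - C, k.+1%:R / M%:R - C[%classic).
    exact: measurable_itv.
  apply/seteqP; split => x; rewrite /B /= in_itv/= lerBlDr ltrBrDr.
    by rewrite ler_pdivrMr// ltr_pdivlMr// [_ * M%:R]mulrC.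
  by rewrite ler_pdivrMr// ltr_pdivlMr// [_ * M%:R]mulrC.
pose h w : R := \sum_(k < N) k%:R / M%:R * \1_(f @^-1` B k) w.
have b1 (k : nat) : bounded_rv (\1_(f @^-1` B k) : Omega -> R).
  exact/bounded_rv_indic/mfB.
have bh : bounded_rv h by apply: bounded_rv_sum => k _; exact: bounded_rvZ.
have gh w : `|g w - h w| <= M%:R^-1.
  have /andP[g0 g2] := gC w.
  pose k0 := Num.truncn (M%:R * g w).
  have k0N : (k0 < N)%N.
    by rewrite /k0 /N ltnS le_truncn// mulrC ler_wpM2r// ltW.
  have /andP[k1 k2] : k0%:R <= M%:R * g w < k0.+1%:R.
    by apply: truncn_itv; rewrite mulr_ge0// ltW.
  rewrite /h (bigD1 (Ordinal k0N))//= big1 => [|k kk].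
    rewrite indicE mem_set ?mulr1 ?addr0; last by apply/andP.
    rewrite ger0_norm ?subr_ge0; last by rewrite ler_pdivrMr// mulrC.
    rewrite [leRHS](_ : _ = k0.+1%:R / M%:R - k0%:R / M%:R); last first.
      by rewrite -mulrBl -natrB// subSnn mul1r.
    by rewrite lerD2r ler_pdivlMr// mulrC ltW.
  rewrite indicE memNset ?mulr0// => /andP[h1 h2].
  have : (k < k0.+1)%N by rewrite -(ltr_nat R); exact: le_lt_trans k2.
  have : (k0 < k.+1)%N by rewrite -(ltr_nat R); exact: le_lt_trans h2.
  rewrite !ltnS => q1 q2; move/eqP : kk; apply; apply: val_inj => /=.
  by apply/eqP; rewrite eqn_leq q1 q2.
have Wh : \int[P]_w (W w * h w) = c * \int[P]_w h w.
  rewrite /h Rint_sum; last by move=> k _; exact: bounded_rvZ.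
  rewrite mulr_sumr; under eq_Rintegral do rewrite mulr_sumr.
  rewrite Rint_sum; last by move=> k _; apply/bounded_rvM/bounded_rvZ.
  apply: eq_bigr => k _; under eq_Rintegral do rewrite mulrCA.
  rewrite RintZ; last exact: bounded_rvM.
  by rewrite RintZ// Rint_indic ?H//; [ring|exact: mfB].
have -> : \int[P]_w (W w * g w) - c * \int[P]_w g w =
    \int[P]_w (W w * (g w - h w)) - c * \int[P]_w (g w - h w).
  under [in RHS]eq_Rintegral do rewrite mulrBr.
  by rewrite !RintB//; [rewrite Wh; ring|exact: bounded_rvM..].
have bgh := bounded_rvB bg bh.
rewrite (le_trans (ler_normB _ _))// normrM.
apply: (@le_trans _ _ ((CW + `|c|) / M%:R)).
  rewrite mulrDl lerD//.
    apply: norm_Rint_bound; first exact: bounded_rvM.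
    by move=> w; rewrite normrM ler_pM.
  by rewrite ler_wpM2l// norm_Rint_bound.
rewrite ler_pdivrMr// -ler_pdivrMl// [leLHS]mulrC ltW//.
exact: truncnS_gt.
Qed.

End indep_integral.

Section complex_expectation.
Context d (Omega : measurableType d) (R : realType) (P : probability Omega R).
Implicit Types X : Omega -> R.

Definition cexp X : R[i] := (\int[P]_w cos (X w) +i* \int[P]_w sin (X w))%C.

Lemma char_funE X theta : char_fun P X theta = cexp (fun w => theta * X w).
Proof. by rewrite /char_fun !expectation.unlock. Qed.

(** The variances of cos X and sin X add up to 1 minus the squared modulus, because cos^2 + sin^2 =
    1. *)
Lemma norm_cexp_le1 X : measurable_fun setT X -> `|cexp X| <= 1.
Proof.
move=> mX; rewrite normc_def /cexp/=.
have bc := bounded_rv_cos mX; have bs := bounded_rv_sin mX.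
set c := \int[P]_w cos (X w); set s := \int[P]_w sin (X w).
suff cs : c ^+ 2 + s ^+ 2 <= 1.
  by rewrite -[1]/(1%:C)%C lecR -[leRHS]sqrtr1 ler_wsqrtr.
have : 0 <= \int[P]_w ((cos (X w) - c) * (cos (X w) - c) +
    (sin (X w) - s) * (sin (X w) - s)).
  by apply: Rintegral_ge0 => w _; rewrite -!expr2 addr_ge0// sqr_ge0.
under eq_Rintegral => w _.
  have -> : (cos (X w) - c) * (cos (X w) - c) + (sin (X w) - s) * (sin (X w) - s)
      = 1 + c ^+ 2 + s ^+ 2 - (2 * c * cos (X w) + 2 * s * sin (X w)).
    apply/eqP; rewrite -subr_eq0; apply/eqP.
    transitivity (cos (X w) ^+ 2 + sin (X w) ^+ 2 - 1); first by ring.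
    by rewrite cos2Dsin2 subrr.
  over.
rewrite RintB ?Rint_cst; [|exact: bounded_rv_cst|].
  rewrite RintD ?RintZ//; [|exact: bounded_rvZ..].
  by rewrite -/c -/s => h; rewrite -subr_ge0 (le_trans h)// le_eqVlt; apply/orP; left; apply/eqP; ring.
by apply: bounded_rvD; exact: bounded_rvZ.
Qed.

(** The event G, with r in the role of its probability, makes the induction go through: the
    constraint on the variable split off is absorbed into G, and its probability into r. Later G is
    an event on the Poisson processes. Real and imaginary parts are coupled by the addition
    formulas, hence the conjunction. *)
Lemma indep_cexp_sum (I : eqType) (s : seq I) (X : I -> Omega -> R)
    (G : set Omega) (r : R) :
  uniq s -> (forall i, measurable_fun setT (X i)) -> measurable G ->
  (forall A : I -> set R, (forall i, measurable (A i)) ->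
    fine (P ((\bigcap_(i in [set` s]) X i @^-1` A i) `&` G)) =
    (\prod_(i <- s) fine (P (X i @^-1` A i))) * r) ->
  \int[P]_w (cos (\sum_(i <- s) X i w) * \1_G w) = complex.Re (\prod_(i <- s) cexp (X i)) * r /\
  \int[P]_w (sin (\sum_(i <- s) X i w) * \1_G w) = complex.Im (\prod_(i <- s) cexp (X i)) * r.
Proof.
move=> + mX; elim: s G r => [|k s IH] G r /=.
  move=> _ mG /(_ (fun=> setT) (fun=> measurableT)).
  rewrite big_nil set_nil bigcap_set0 setTI mul1r => GE.
  rewrite !big_nil; split; under eq_Rintegral do rewrite big_nil ?cos0 ?sin0.
    by under eq_Rintegral do rewrite mul1r; rewrite Rint_indic// mul1r.
  by under eq_Rintegral do rewrite mul0r; rewrite Rint_cst mul0r.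
move=> /andP[ks us] mG H.
have mXB i B : measurable B -> measurable (X i @^-1` B).
  by move=> mB; rewrite -[_ @^-1` _]setTI; exact: mX.
have mS : measurable_fun setT (fun w => \sum_(i <- s) X i w) by exact: measurable_sum.
have bG : bounded_rv (\1_G : Omega -> R) by exact: bounded_rv_indic.
(* Moves the constraint on X k from the list of variables into the event, for use with the induction
   hypothesis. *)
have step B : measurable B -> forall (A : I -> set R), (forall i, measurable (A i)) ->
    fine (P ((\bigcap_(i in [set` s]) X i @^-1` A i) `&` (X k @^-1` B `&` G))) =
    (\prod_(i <- s) fine (P (X i @^-1` A i))) * (fine (P (X k @^-1` B)) * r).
  move=> mB A mA; pose A' i := if i == k then B else A i.
  have A's i : i \in s -> A' i = A i.
    by move=> si; rewrite /A'; case: eqP => // ik; move: si; rewrite ik (negbTE ks).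
  have -> : (\bigcap_(i in [set` s]) X i @^-1` A i) `&` (X k @^-1` B `&` G) =
      (\bigcap_(i in [set` k :: s]) X i @^-1` A' i) `&` G.
    apply/seteqP; split => w /=.
      move=> [h [hB hG]]; split => // i /=; rewrite inE => /predU1P[->|si].
        by rewrite /A' eqxx.
      by rewrite A's//; exact: h.
    move=> [h hG]; split.
      by move=> i /= si; rewrite -A's//; apply: h; rewrite /= inE si orbT.
    by split => //; have := h k; rewrite /A' eqxx; apply; rewrite /= mem_head.
  rewrite H; last by move=> i; rewrite /A'; case: ifP.
  rewrite big_cons /A' eqxx mulrCA mulrA; congr (_ * _ * _).
  rewrite big_seq [RHS]big_seq; apply: eq_bigr => i si.
  by rewrite -/(A' i) A's.
pose Wc w := cos (\sum_(i <- s) X i w) * \1_G w.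
pose Ws w := sin (\sum_(i <- s) X i w) * \1_G w.
have bWc : bounded_rv Wc by apply: bounded_rvM => //; exact: bounded_rv_cos.
have bWs : bounded_rv Ws by apply: bounded_rvM => //; exact: bounded_rv_sin.
set Pi := \prod_(i <- s) cexp (X i) in IH *.
have indicI' B w : \1_(X k @^-1` B `&` G) w = \1_G w * \1_(X k @^-1` B) w :> R.
  by rewrite setIC indicI.
have HWc g : measurable_fun setT g -> forall B : set R, measurable B ->
    \int[P]_w (Wc w * \1_((g \o X k) @^-1` B) w) =
    complex.Re Pi * r * fine (P ((g \o X k) @^-1` B)).
  move=> mg B mB; have mgB : measurable (g @^-1` B).
    by rewrite -[_ @^-1` _]setTI; exact: mg.
  have [+ _] := IH _ _ us (measurableI _ _ (mXB k _ mgB) mG) (step _ mgB).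
  under eq_Rintegral do rewrite indicI' mulrA.
  by rewrite comp_preimage => ->; ring.
have HWs g : measurable_fun setT g -> forall B : set R, measurable B ->
    \int[P]_w (Ws w * \1_((g \o X k) @^-1` B) w) =
    complex.Im Pi * r * fine (P ((g \o X k) @^-1` B)).
  move=> mg B mB; have mgB : measurable (g @^-1` B).
    by rewrite -[_ @^-1` _]setTI; exact: mg.
  have [_ +] := IH _ _ us (measurableI _ _ (mXB k _ mgB) mG) (step _ mgB).
  under eq_Rintegral do rewrite indicI' mulrA.
  by rewrite comp_preimage => ->; ring.
have mcos : measurable_fun setT (@cos R).
  by apply: continuous_measurable_fun; exact: continuous_cos.
have msin : measurable_fun setT (@sin R).
  by apply: continuous_measurable_fun; exact: continuous_sin.
have bcX := bounded_rv_cos (mX k); have bsX := bounded_rv_sin (mX k).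
have cc := indep_Rint bWc bcX (HWc _ mcos).
have cs := indep_Rint bWc bsX (HWc _ msin).
have sc := indep_Rint bWs bcX (HWs _ mcos).
have ss := indep_Rint bWs bsX (HWs _ msin).
rewrite big_cons -/Pi; split.
  under eq_Rintegral => w _.
    rewrite big_cons cosD mulrBl.
    rewrite (_ : cos (X k w) * _ * _ = Wc w * cos (X k w)); last by rewrite /Wc; ring.
    rewrite (_ : sin (X k w) * _ * _ = Ws w * sin (X k w)); last by rewrite /Ws; ring.
    over.
  rewrite /= RintB; [|exact: bounded_rvM..].
  by rewrite cc ss; case: Pi {IH HWc HWs cc cs sc ss} => a b /=; ring.
under eq_Rintegral => w _.
  rewrite big_cons sinD mulrDl.
  rewrite (_ : sin (X k w) * _ * _ = Wc w * sin (X k w)); last by rewrite /Wc; ring.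
  rewrite (_ : cos (X k w) * _ * _ = Ws w * cos (X k w)); last by rewrite /Ws; ring.
  over.
rewrite /= RintD; [|exact: bounded_rvM..].
by rewrite cs sc; case: Pi {IH HWc HWs cc cs sc ss} => a b /=; ring.
Qed.

Lemma cexp_sum_indep (I : eqType) (s : seq I) (X : I -> Omega -> R) :
  uniq s -> (forall i, measurable_fun setT (X i)) -> independent_family P X ->
  cexp (fun w => \sum_(i <- s) X i w) = \prod_(i <- s) cexp (X i).
Proof.
move=> us mX iX.
have [] := indep_cexp_sum (G := setT) (r := 1) us mX measurableT.
  move=> A mA; rewrite setIT mulr1.
  rewrite (iX s (fun i => X i @^-1` A i) us).
    rewrite (eq_bigr (fun i => (fine (P (X i @^-1` A i)))%:E)) ?prodEFin//.
    move=> i _; rewrite fineK// fin_num_measure//.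
    by rewrite -[_ @^-1` _]setTI; exact: mX.
  by move=> i _; exists (A i) => //; rewrite setTI.
rewrite !mulr1.
under eq_Rintegral do rewrite indicT mulr1; move=> hc.
under eq_Rintegral do rewrite indicT mulr1; move=> hs.
by rewrite /cexp hc hs; case: (\prod_(i <- s) _).
Qed.

End complex_expectation.

(** * Parity of Poisson counts *)

Section odd_counts.
Context d (E : measurableType d) (R : realType).

Lemma measurable_count (A : set E) (B : set (\bar R)) :
  measurable A -> measurable B ->
  measurable [set m : point_measure E R | B (m A)].
Proof.
move=> mA mB; apply: sub_sigma_algebra; exists A => //; exists B => //.
by rewrite setTI.
Qed.

Lemma measurable_odd_count (A : set E) : measurable A ->
  measurable [set m : point_measure E R | odd_count m A].
Proof.
move=> mA; rewrite (_ : [set _ | _] = \bigcup_(n in [set n | odd n])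
    [set m : point_measure E R | [set n%:R%:E] (m A)]).
  by apply: bigcup_measurable => n _; exact: measurable_count.
by apply/seteqP; split => m /= => [[n [on mn]]|[n on mn]]; exists n.
Qed.

Definition odd_countb (m : point_measure E R) (A : set E) : bool :=
  `[< odd_count m A >].

Lemma odd_countb_nat (m : point_measure E R) A (k : nat) :
  m A = k%:R%:E -> odd_countb m A = odd k.
Proof.
move=> mA; apply/asboolP/idP => [[l [ol]]|ok]; last by exists k.
by rewrite mA => -[] /(congr1 (@Num.truncn R)); rewrite !natrK => ->.
Qed.

(** Points of the intersection are counted twice and vanish modulo 2. The three counts are assumed
    finite because an infinite count is by definition not odd, which would break additivity of
    parity. *)
Lemma odd_countb_setY (m : point_measure E R) A B (a b c : nat) :
  measurable A -> measurable B -> m (A `\` B) = a%:R%:E ->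
  m (B `\` A) = b%:R%:E -> m (A `&` B) = c%:R%:E ->
  odd_countb m (A `+` B) = odd_countb m A (+) odd_countb m B.
Proof.
move=> mA mB ma mb mc.
have mA' : m A = (a + c)%:R%:E.
  rewrite (measureDI m mA mB) natrD EFinD -ma -mc//.
have mB' : m B = (b + c)%:R%:E.
  rewrite (measureDI m mB mA) natrD EFinD -mb -mc//; congr (_ + _)%E.
  by rewrite setIC.
have mY : m (A `+` B) = (a + b)%:R%:E.
  rewrite /setY measureU ?natrD ?EFinD -?ma -?mb//; [exact: measurableD..|].
  by apply/seteqP; split => // x /= [[? ?] [? ?]].
rewrite (odd_countb_nat mA') (odd_countb_nat mB') (odd_countb_nat mY).
by rewrite !oddD; case: (odd a); case: (odd b); case: (odd c).
Qed.

Context d' (Omega : measurableType d') (P : probability Omega R).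
Context (N : Omega -> point_measure E R) (nu : set E -> \bar R).
Hypothesis PN : poisson_point_process P N nu.

Lemma measurable_preimage_ppp (B : set (point_measure E R)) :
  measurable B -> measurable (N @^-1` B).
Proof. by case: PN => mN _ _ _ mB; rewrite -[_ @^-1` _]setTI; exact: mN. Qed.

(** The predicate S is arbitrary so that one computation covers both the total mass, with [predT],
    and the probability of an odd count. *)
Lemma cvg_poisson_count (A : set E) (S : pred nat) : measurable A -> (nu A < +oo)%E ->
  series (fun n => (S n)%:R * (fine (nu A) ^+ n / n`!%:R * expR (- fine (nu A))))
    @ \oo -->
  fine (P [set w | exists2 n, S n & N w A = n%:R%:E]).
Proof.
move=> mA nuA; case: PN => _ Ppmf _ _.
pose F n := if S n then [set w | N w A = n%:R%:E] else set0.
have mF n : measurable (F n).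
  rewrite /F; case: (S n) => //.
  exact: (measurable_preimage_ppp (measurable_count mA (emeasurable_set1 n%:R%:E))).
have FE : \bigcup_n F n = [set w | exists2 n, S n & N w A = n%:R%:E].
  apply/seteqP; split => [w [n _]|w [n Sn Nn]]; rewrite /F.
    by case: ifP => // Sn Nn; exists n.
  by exists n => //; rewrite Sn.
have tF : trivIset setT F.
  apply/trivIsetP => i j _ _ ij; rewrite /F.
  case: ifP => _; last by rewrite set0I.
  case: ifP => _; last by rewrite setI0.
  apply/seteqP; split => // w /= [-> []] /(congr1 (@Num.truncn R)).
  by rewrite !natrK => /eqP; rewrite (negbTE ij).
have mU : measurable (\bigcup_n F n) by exact: bigcupT_measurable.
have := measure_semi_sigma_additive (s := P) F mF tF mU.
rewrite FE in mU *.
rewrite -[X in _ --> X -> _]fineK ?fin_num_measure// => /fine_cvgP[_].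
rewrite (_ : _ \o _ = series (fun n => (S n)%:R *
  (fine (nu A) ^+ n / n`!%:R * expR (- fine (nu A))))) //.
apply/funext => k /=; rewrite (eq_bigr (fun n => ((S n)%:R *
  (fine (nu A) ^+ n / n`!%:R * expR (- fine (nu A))))%:E)) ?sumEFin//.
move=> n _; rewrite /F; case: ifP => _; first by rewrite mul1r Ppmf.
by rewrite mul0r measure0.
Qed.

(** The Poisson weights already sum to exp(l) exp(-l) = 1, which leaves no mass for other values. *)
Lemma ae_count_nat (A : set E) : measurable A -> (nu A < +oo)%E ->
  {ae P, forall w, exists n : nat, N w A = n%:R%:E}.
Proof.
move=> mA nuA; have h := cvg_poisson_count (S := predT) mA nuA.
pose B := [set w | exists2 n : nat, predT n & N w A = n%:R%:E].
have BE : B = N @^-1` (\bigcup_n [set m : point_measure E R | [set n%:R%:E] (m A)]).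
  by apply/seteqP; split => w /= [n _ Nn]; exists n.
have mB : measurable B.
  rewrite BE; apply: measurable_preimage_ppp.
  by apply: bigcupT_measurable => n; exact: measurable_count.
have PB : P B = 1%E.
  rewrite -[LHS]fineK ?fin_num_measure//; congr EFin.
  set l := fine (nu A) in h.
  have : series (exp_coeff l) k * expR (- l) @[k --> \oo] --> expR l * expR (- l).
    by apply: cvgM; [exact: is_cvg_series_exp_coeff|exact: cvg_cst].
  rewrite expRN mulfV ?gt_eqF ?expR_gt0// -expRN => h'.
  apply: (cvg_unique _ h) => //; apply: cvg_trans h'.
  apply: near_eq_cvg; apply: nearW => k.
  rewrite /series/= mulr_suml; apply: eq_bigr => n _.
  by rewrite mul1r /exp_coeff.
exists (~` B); split; first exact: measurableC.
- by rewrite probability_setC// PB subee.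
- by move=> w /= nB [n _ Nn]; apply: nB; exists n.
Qed.

(** Half the difference of the series of exp(l) and exp(-l) keeps the odd terms, so the probability
    is exp(-l) sinh l. *)
Lemma prob_odd_count (A : set E) : measurable A -> (nu A < +oo)%E ->
  fine (P (N @^-1` [set m | odd_count m A])) = (1 - expR (- (2 * fine (nu A)))) / 2.
Proof.
move=> mA nuA; have h := cvg_poisson_count (S := odd) mA nuA.
rewrite (_ : _ @^-1` _ = [set w | exists2 n, odd n & N w A = n%:R%:E]); last first.
  by apply/seteqP; split => w /= => [[n [on nn]]|[n on nn]]; exists n.
set l := fine (nu A) in h *.
have h' : (series (exp_coeff l) k - series (exp_coeff (- l)) k) * (expR (- l) / 2)
    @[k --> \oo] --> (expR l - expR (- l)) * (expR (- l) / 2).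
  apply: cvgM; last exact: cvg_cst.
  by apply: cvgB; exact: is_cvg_series_exp_coeff.
have -> : (1 - expR (- (2 * l))) / 2 = (expR l - expR (- l)) * (expR (- l) / 2).
  rewrite [RHS]mulrA [in RHS]mulrBl -!expRD subrr expR0; congr ((1 - expR _) / _); ring.
apply/esym/(cvg_unique _ h') => //; apply: cvg_trans h.
apply: near_eq_cvg; apply: nearW => k.
rewrite /series/= -sumrB mulr_suml; apply: eq_bigr => n _.
rewrite /exp_coeff/= exprNn -signr_odd; case: (odd n) => /=; first by field.
by rewrite expr0 mul1r subrr !mul0r.
Qed.

End odd_counts.

(** * Inversion from parities of symmetric differences to parity patterns *)

Section parity_inversion.
Context (R : realType) (n : nat).
Implicit Types (J K : {set 'I_n}) (o : 'I_n -> bool).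

Definition xorb_over o K : bool := \big[addb/false]_(i <- enum K) o i.

(** A Walsh coefficient of the indicator of the pattern J: the character of K at J, divided by 2^n.
    The minus sign comes from (-1)^x = 1 - 2 x for a bit x. *)
Definition parity_coef J K : R := - (\prod_(i in K) (-1) ^+ (i \in J)) / 2 ^+ n.

Lemma signr_xorb_over o K :
  (-1) ^+ xorb_over o K = \prod_(i in K) (-1) ^+ o i :> R.
Proof.
rewrite -[RHS]big_enum /xorb_over; elim: (enum K) => [|i s IH].
  by rewrite !big_nil expr0.
by rewrite !big_cons signr_addb IH.
Qed.

(* Expanding the products of 1 + (-1)^[i in J] (-1)^(o i), resp. of
   1 + (-1)^[i in J], over the subsets K gives 2^n [o = J], resp. 0. *)
Lemma parity_indicator o J : J != finset.set0 ->
  ([forall i, o i == (i \in J)])%:R =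
  \sum_K parity_coef J K * (2 * (xorb_over o K)%:R) :> R.
Proof.
move=> J0.
have expand (s : 'I_n -> R) : \prod_i (1 + s i) = \sum_(K : {set 'I_n}) \prod_(i in K) s i.
  rewrite (eq_bigr (fun i => s i + 1)); last by move=> i _; rewrite addrC.
  by rewrite bigA_distr; apply: eq_bigr => K _; rewrite -big_mkcond.
have E0 : \sum_(K : {set 'I_n}) \prod_(i in K) (-1) ^+ (i \in J) = 0 :> R.
  rewrite -expand; have [j jJ] := set0Pn _ J0.
  by rewrite (bigD1 j)//= jJ expr1 subrr mul0r.
have EJ : \sum_(K : {set 'I_n}) \prod_(i in K) ((-1) ^+ (i \in J) * (-1) ^+ o i) =
    2 ^+ n * ([forall i, o i == (i \in J)])%:R :> R.
  rewrite -expand; have [/forallP oJ|] := boolP [forall i, o i == (i \in J)].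
    rewrite (eq_bigr (fun=> 2)) ?prodr_const ?card_ord ?mulr1// => i _.
    by rewrite (eqP (oJ i)) -expr2 sqrr_sign.
  move=> /forallPn[j oj]; rewrite mulr0 (bigD1 j)//=.
  have -> : (-1) ^+ (j \in J) * (-1) ^+ o j = -1 :> R.
    by move: oj; case: (o j); case: (j \in J) => //= _; rewrite ?expr0 ?expr1 ?mulr1 ?mul1r.
  by rewrite subrr mul0r.
apply: (@mulfI _ (2 ^+ n)); first by rewrite expf_neq0// pnatr_eq0.
transitivity (\sum_(K : {set 'I_n}) (\prod_(i in K) ((-1) ^+ (i \in J) * (-1) ^+ o i) -
    \prod_(i in K) (-1) ^+ (i \in J)) : R).
  by rewrite sumrB E0 subr0 EJ.
rewrite mulr_sumr; apply: eq_bigr => K _.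
rewrite big_split/= -(signr_xorb_over o) /parity_coef.
set p := \prod_(i in K) _.
have -> : 2 ^+ n * (- p / 2 ^+ n * (2 * (xorb_over o K)%:R)) =
    - p * (2 * (xorb_over o K)%:R).
  by field; rewrite expf_neq0// pnatr_eq0.
by case: (xorb_over o K) => /=; rewrite ?expr0 ?expr1; ring.
Qed.

End parity_inversion.

Section parity_patterns.
Context d (E : measurableType d) (R : realType) (n : nat) (A : 'I_n -> set E).
Hypothesis mA : forall i, measurable (A i).
Implicit Types (J K : {set 'I_n}).

Definition symdiff K : set E := \big[setY/set0]_(i <- enum K) A i.

Definition parity_set J : set (point_measure E R) :=
  [set m | forall i, odd_countb m (A i) = (i \in J)].

Lemma measurable_symdiff_seq (s : seq 'I_n) : measurable (\big[setY/set0]_(i <- s) A i).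
Proof.
elim: s => [|i s IH]; first by rewrite big_nil.
by rewrite big_cons /setY; apply: measurableU; exact: measurableD.
Qed.

Lemma measurable_parity_set J : measurable (parity_set J).
Proof.
rewrite (_ : parity_set J = \bigcap_(i in [set: 'I_n])
    (if i \in J then [set m | odd_count m (A i)]
     else ~` [set m | odd_count m (A i)])).
  apply: fin_bigcap_measurable => // i _.
  by case: ifP => _; [|apply: measurableC]; exact: measurable_odd_count.
apply/seteqP; split => m /= h i.
  by move=> _; have := h i; case: ifP => _ /= /asboolP.
have := h i I; rewrite /odd_countb; case: ifP => _ /= hm; first exact/asboolP.
exact/asboolPn.
Qed.

Lemma trivIset_parity_set : trivIset setT parity_set.
Proof.
apply/trivIsetP => J K _ _ JK; apply/seteqP; split => // m /= [hJ hK].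
by case/eqP: JK; apply/setP => i; rewrite -hJ -hK.
Qed.

Lemma parity_set_indic (m : point_measure E R) J :
  \1_(parity_set J) m = ([forall i, odd_countb m (A i) == (i \in J)])%:R :> R.
Proof.
rewrite indicE; congr (_%:R); congr nat_of_bool; apply/idP/forallP.
  by rewrite inE => h i; rewrite h.
by move=> h; rewrite inE => i; exact/eqP.
Qed.

Context d' (Omega : measurableType d') (P : probability Omega R).
Context (N : Omega -> point_measure E R) (nu : {measure set E -> \bar R}).
Hypothesis PN : poisson_point_process P N nu.
Hypothesis nuA : forall i, (nu (A i) < +oo)%E.

Lemma symdiff_seq_lty (s : seq 'I_n) : (nu (\big[setY/set0]_(i <- s) A i) < +oo)%E.
Proof.
elim: s => [|i s IH]; first by rewrite big_nil measure0.
rewrite big_cons; apply: (@le_lt_trans _ _ (nu (A i `|` \big[setY/set0]_(j <- s) A j))).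
  apply: le_measure; rewrite ?inE.
  - by apply: measurableU; apply: measurableD => //; exact: measurable_symdiff_seq.
  - by apply: measurableU => //; exact: measurable_symdiff_seq.
  - by move=> x [[? _]|[? _]]; [left|right].
apply: le_lt_trans (measureU2 _ _ _) _ => //; first exact: measurable_symdiff_seq.
by apply: lte_add_pinfty; [exact: nuA|exact: IH].
Qed.

(** The identity holds almost surely only: it needs finite counts on the three pieces of each
    symmetric difference. *)
Lemma ae_odd_countb_symdiff (s : seq 'I_n) :
  {ae P, forall w, odd_countb (N w) (\big[setY/set0]_(i <- s) A i) =
                   \big[addb/false]_(i <- s) odd_countb (N w) (A i)}.
Proof.
elim: s => [|i s IH].
  apply: aeW => w; rewrite !big_nil; apply/asboolPn => -[k [ok]].
  by rewrite measure0 => -[] /(congr1 (@Num.truncn R)); rewrite natrK truncn0 => k0; move: ok; rewrite -k0.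
set B := \big[setY/set0]_(j <- s) A j in IH.
have mB : measurable B by exact: measurable_symdiff_seq.
have fB : (nu B < +oo)%E by exact: symdiff_seq_lty.
have fS (C D : set E) : measurable C -> measurable D -> C `<=` D ->
    (nu D < +oo)%E -> (nu C < +oo)%E.
  by move=> mC mD CD; apply: le_lt_trans; apply: le_measure; rewrite ?inE.
have c1 := ae_count_nat PN (measurableD (mA i) mB)
  (fS _ _ (measurableD (mA i) mB) (mA i) (@subDsetl _ _ _) (nuA i)).
have c2 := ae_count_nat PN (measurableD mB (mA i))
  (fS _ _ (measurableD mB (mA i)) mB (@subDsetl _ _ _) fB).
have c3 := ae_count_nat PN (measurableI _ _ (mA i) mB)
  (fS _ _ (measurableI _ _ (mA i) mB) mB (@subIsetr _ _ _) fB).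
apply: filterS2 IH (filterI c1 (filterI c2 c3)) => w hB [[a ha] [[b hb] [c hc]]].
by rewrite !big_cons -hB -/B (odd_countb_setY _ mB ha hb hc).
Qed.

Lemma bounded_rv_xorb_over K :
  bounded_rv (fun w => (xorb_over (fun i => odd_countb (N w) (A i)) K)%:R : R).
Proof.
split; last by exists 1 => w; case: xorb_over; rewrite ?normr1 ?normr0.
rewrite (_ : (fun w => _) = (fun w => \sum_(J : {set 'I_n})
    (xorb_over (fun i => i \in J) K)%:R * \1_(N @^-1` parity_set J) w)).
  apply: measurable_sum => J; apply: measurable_funM => //.
  apply: measurable_indic; apply: (measurable_preimage_ppp PN).
  exact: measurable_parity_set.
apply/funext => w; pose J0 := [set i | odd_countb (N w) (A i)]%SET.
rewrite (bigD1 J0)//= big1 ?addr0 => [|J JJ0].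
  rewrite indicE mem_set ?mulr1; last by move=> i; rewrite inE.
  by congr ((nat_of_bool _)%:R); apply: eq_bigr => i _; rewrite inE.
rewrite indicE memNset ?mulr0// => h; case/eqP: JJ0.
by apply/setP => i; rewrite -h inE.
Qed.

Lemma prob_xorb_over K :
  \int[P]_w ((xorb_over (fun i => odd_countb (N w) (A i)) K)%:R : R) =
  (1 - expR (- (2 * fine (nu (symdiff K))))) / 2.
Proof.
have mS : measurable (symdiff K) by exact: measurable_symdiff_seq.
rewrite -(prob_odd_count PN mS (symdiff_seq_lty _)).
have mN := measurable_preimage_ppp PN (measurable_odd_count mS).
rewrite -Rint_indic//; congr fine; apply: ae_eq_integral => //.
- by apply/measurable_EFinP; case: (bounded_rv_xorb_over K).
- exact/measurable_EFinP/measurable_indic.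
have := ae_odd_countb_symdiff (enum K).
by apply: filterS => w h _ /=; rewrite /xorb_over -h indicE.
Qed.

(** For nonempty J the inversion has no constant term, so the probability is a combination of terms
    1 - exp(-x) alone. Each of these is O(x) at 0, which later allows summing over k and integrating
    against r^(-beta-1). *)
Lemma prob_parity_set J : J != finset.set0 ->
  fine (P (N @^-1` parity_set J)) =
  \sum_K parity_coef R J K * (1 - expR (- (2 * fine (nu (symdiff K))))).
Proof.
move=> J0.
have mJ : measurable (N @^-1` parity_set J).
  by apply: (measurable_preimage_ppp PN); exact: measurable_parity_set.
rewrite -Rint_indic//.
under eq_Rintegral => w _.
  rewrite (_ : \1_(_) w = \1_(parity_set J) (N w)) // parity_set_indic.
  rewrite parity_indicator//.
  over.
have bx K := bounded_rv_xorb_over K.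
rewrite /= Rint_sum; last by move=> K _; do 2 apply: bounded_rvZ.
apply: eq_bigr => K _; rewrite RintZ; last exact: bounded_rvZ.
by rewrite RintZ// prob_xorb_over; congr (_ * _); field.
Qed.

End parity_patterns.

Section poisson_law_exists.
Context d (E : measurableType d) (R : realType).
Context d' (Omega : measurableType d') (P : probability Omega R).
Context (N : Omega -> point_measure E R) (nu : set E -> \bar R).
Hypothesis PN : poisson_point_process P N nu.

(** The distribution of N is a witness, so the choice made by [xget] does not fall back on its
    default. *)
Lemma poisson_lawP : poisson_point_process (poisson_law nu) id nu.
Proof.
have [mN pmf infty ind] := PN.
pose X : {mfun Omega >-> point_measure E R} :=
  HB.pack N (@isMeasurableFun.Build _ _ _ _ N mN).
apply: (@xgetPex _ (\d_point : probability (point_measure E R) R)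
  [set Q : probability (point_measure E R) R | poisson_point_process Q id nu]).
exists (distribution P X : probability (point_measure E R) R); split => //=.
move=> I A mA tA s B us sB.
apply: (ind I A mA tA s (fun i => N @^-1` B i) us).
by move=> i /sB[C mC <-]; exists C.
Qed.

End poisson_law_exists.

Section poisson_parity.
Context d (E : measurableType d) (R : realType) (mu : {measure set E -> \bar R}).
Context d' (Omega : measurableType d') (P : probability Omega R).
Context (N : Omega -> point_measure E R) (r : R).
Hypothesis r0 : 0 < r.
Hypothesis PN : poisson_point_process P N (fun A => (r%:E * mu A)%E).

Let nu : {measure set E -> \bar R} := mscale (NngNum (ltW r0)) mu.

Let nu_lty A : (mu A < +oo)%E -> (nu A < +oo)%E.
Proof. by move=> fA; rewrite /nu/= /mscale/= lte_mul_pinfty// lee_fin ltW. Qed.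

Let fine_nu A : (mu A < +oo)%E -> fine (nu A) = r * fine (mu A).
Proof.
move=> fA; rewrite /nu/= /mscale/= fineM// ge0_fin_numE//.
Qed.

Lemma prob_scaled_odd_count A : measurable A -> (mu A < +oo)%E ->
  fine (P (N @^-1` [set m | odd_count m A])) =
  (1 - expR (- (2 * (r * fine (mu A))))) / 2.
Proof. by move=> mA fA; rewrite (prob_odd_count PN mA (nu_lty fA)) fine_nu. Qed.

Lemma prob_scaled_parity_set (n : nat) (A : 'I_n -> set E) (J : {set 'I_n}) :
  (forall i, measurable (A i)) -> (forall i, (mu (A i) < +oo)%E) ->
  J != finset.set0 ->
  fine (P (N @^-1` parity_set A J)) =
  \sum_K parity_coef R J K * (1 - expR (- (2 * (r * fine (mu (symdiff A K)))))).
Proof.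
move=> mA fA J0.
rewrite (@prob_parity_set _ _ _ _ _ mA _ _ _ _ nu PN (fun i => nu_lty (fA i)) _ J0).
apply: eq_bigr => K _; rewrite fine_nu//.
exact: symdiff_seq_lty.
Qed.

End poisson_parity.

(** * Karlin's sums and the control measure *)

Lemma integral_indicr d (T : measurableType d) (R : realType)
    (mu : {measure set T -> \bar R}) (D A : set T) (f : T -> \bar R) :
  (\int[mu]_(x in D) (f x * (\1_A x)%:E) = \int[mu]_(x in D `&` A) f x)%E.
Proof.
rewrite integral_mkcondr; apply: eq_integral => x _.
by rewrite patchE indicE; case: ifP => _; rewrite ?mule1 ?mule0.
Qed.

Section power_integrals.
Context (R : realType).
Local Notation leb := (@lebesgue_measure R).
Implicit Types (b c g r u : R).

Lemma continuous_powR_gt0 g u : 0 < u -> {for u, continuous (fun x => x `^ g)}.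
Proof.
move=> u0; apply: differentiable_continuous; apply/derivable1_diffP.
by apply: derivable_powR; rewrite in_itv/= andbT.
Qed.

Lemma integral_powRN_tail b u : 0 < b -> 0 < u ->
  (\int[leb]_(r in `[u, +oo[) (b * r `^ (- b - 1))%:E = (u `^ (- b))%:E)%E.
Proof.
move=> b0 u0.
rewrite (@ge0_continuous_FTC2y _ _ (fun r => - r `^ (- b)) _ 0).
- by rewrite sub0e EFinN oppeK.
- by move=> x _; rewrite mulr_ge0 ?powR_ge0// ltW.
- apply: continuous_in_subspaceT => x; rewrite inE/= in_itv/= andbT => ux.
  apply: cvgM; first exact: cvg_cst.
  by apply: continuous_powR_gt0; exact: lt_le_trans ux.
- rewrite -oppr0; apply: cvgN.
  apply/cvgrPdist_le => e e0; near=> r.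
  have r0 : 0 < r by near: r; exact: nbhs_pinfty_gt.
  rewrite sub0r normrN ger0_norm ?powR_ge0// powRN.
  rewrite invf_ple ?posrE ?powR_gt0//.
  have : (e^-1) `^ b^-1 <= r by near: r; exact: nbhs_pinfty_ge.
  move/(ge0_ler_powR (ltW b0)); rewrite !nnegrE powR_ge0 (ltW r0) -powRrM mulVf ?gt_eqF//.
  by rewrite powRr1 ?invr_ge0 ?(ltW e0)//; apply.
- move=> x ux; apply: derivableN; apply: derivable_powR.
  by rewrite in_itv/= andbT (lt_trans u0).
- by apply: cvg_at_right_filter; apply: cvgN; exact: continuous_powR_gt0.
- move=> x; rewrite in_itv/= andbT => ux; have x0 := lt_trans u0 ux.
  rewrite derive1N; last by apply: derivable_powR; rewrite in_itv/= andbT.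
  by rewrite powR_derive1 ?in_itv/= ?andbT// mulNr opprK.
Unshelve. all: by end_near. Qed.

(** The integrand is singular at 0: the fundamental theorem of calculus bounds the integrals over
    [a n, 1] by 1 / (1 - g), and monotone convergence reaches the endpoint. *)
Lemma integral_powRN_near0 g : 0 <= g < 1 ->
  (\int[leb]_(u in `]0%R, 1%R]) (u `^ (- g))%:E < +oo)%E.
Proof.
move=> /andP[g0 g1].
have g1' : 0 < 1 - g by rewrite subr_gt0.
pose D : set R := `]0, 1]%classic.
(* The offset 2 makes a n < 1 from the first index on. *)
pose a (n : nat) : R := n.+2%:R^-1.
have a0 n : 0 < a n by rewrite invr_gt0.
have a1 n : a n < 1 by rewrite invf_lt1// ltr1n.
pose h (n : nat) (u : R) : \bar R := ((u `^ (- g))%:E * (\1_`[a n, 1%R]%classic u)%:E)%E.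
have I n : (\int[leb]_(u in `]0%R, 1%R]) h n u <= ((1 - g)^-1)%:E)%E.
  rewrite integral_indicr.
  have -> : `]0, 1]%classic `&` `[a n, 1]%classic = `[a n, 1]%classic :> set R.
    apply/seteqP; split => [x []//|x /= xa]; split => //; move: xa.
    by rewrite !in_itv/= => /andP[ax ->]; rewrite andbT (lt_le_trans _ ax).
  rewrite (@continuous_FTC2 _ _ (fun u => (1 - g)^-1 * u `^ (1 - g))) => //.
  - rewrite powR1 mulr1 -EFinB lee_fin lerBlDr lerDl mulr_ge0 ?powR_ge0//.
    by rewrite invr_ge0 ltW.
  - apply: continuous_in_subspaceT => x; rewrite inE/= in_itv/= => /andP[ax _].
    by apply: continuous_powR_gt0; exact: lt_le_trans ax.
  - split.
    + move=> x; rewrite in_itv/= => /andP[ax _].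
      by apply: derivableM => //; apply: derivable_powR; rewrite in_itv/= andbT (lt_trans _ ax).
    + by apply: cvg_at_right_filter; apply: cvgM; [exact: cvg_cst|exact: continuous_powR_gt0].
    + by apply: cvg_at_left_filter; apply: cvgM; [exact: cvg_cst|exact: continuous_powR_gt0].
  - move=> x; rewrite in_itv/= => /andP[ax _].
    have x0 : 0 < x by rewrite (lt_trans _ ax).
    rewrite derive1Ml; last by apply: derivable_powR; rewrite in_itv/= andbT.
    rewrite powR_derive1 ?in_itv/= ?andbT// mulrA mulVf ?gt_eqF// mul1r.
    by congr (_ `^ _); ring.
have mh n : measurable_fun D (h n).
  apply: emeasurable_funM.
    by apply/measurable_EFinP; apply: measurable_funTS; exact: measurable_powR.
  by apply/measurable_EFinP; apply: measurable_funTS; exact: measurable_indic.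
have h0 n u : D u -> (0 <= h n u)%E.
  by move=> _; rewrite mule_ge0 ?lee_fin ?powR_ge0// indicE.
have ndh u : D u -> {homo h ^~ u : n m / (n <= m)%N >-> (n <= m)%E}.
  move=> _ n m nm; rewrite lee_wpmul2l ?lee_fin ?powR_ge0// !indicE ler_nat.
  have [|//] := boolP (u \in `[a n, 1]%classic); rewrite inE/= in_itv/= => /andP[au u1].
  rewrite mem_set//= in_itv/= u1 andbT (le_trans _ au)// lef_pV2 ?posrE//.
  by rewrite ler_nat !ltnS.
have mcv := @cvg_monotone_convergence _ _ _ leb _ (measurable_itv _) h mh h0 ndh.
have -> : (\int[leb]_(u in D) (u `^ (- g))%:E = \int[leb]_(u in D) limn (h ^~ u))%E.
  apply: eq_integral => u; rewrite inE /D/= in_itv/= => /andP[u0 u1].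
  apply/esym/cvg_lim => //; apply: cvg_near_cst; near=> n.
  rewrite /h indicE mem_set ?mule1//= in_itv/= u1 andbT.
  rewrite invf_ple ?posrE//.
  have : u^-1 <= n%:R by near: n; exact: nbhs_infty_ger.
  by move/le_trans; apply; rewrite ler_nat (leq_trans (leqnSn _)).
apply: le_lt_trans (ltry (1 - g)^-1).
apply: (@cvge_to_le _ _ _ _ _ _ _ mcv); exact: nearW.
Unshelve. all: by end_near. Qed.

End power_integrals.

Section exponential_weight.
Context (R : realType).
Local Notation leb := (@lebesgue_measure R).
Implicit Types (b c g r u : R).

(** The exponential density of rate c on the half-line. It also makes sense for c = 0, where it
    vanishes; this is the case of null sets. *)
Definition wexp c u : R := c * expR (- c * u).

Lemma wexp_ge0 c u : 0 <= c -> 0 <= wexp c u.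
Proof. by move=> c0; rewrite mulr_ge0 ?expR_ge0. Qed.

Lemma measurable_wexp c : measurable_fun setT (wexp c).
Proof. by apply: measurable_funM => //; apply: measurableT_comp => //; exact: measurable_funM. Qed.

Lemma measurable_wexpE c (D : set R) : measurable_fun D (fun u => (wexp c u)%:E).
Proof. by apply/measurable_EFinP; apply: measurable_funTS; exact: measurable_wexp. Qed.

Lemma integral_wexp_itv c r : 0 < c -> 0 < r ->
  (\int[leb]_(u in `]0%R, r]) (wexp c u)%:E = (1 - expR (- (c * r)))%:E)%E.
Proof.
move=> c0 r0; rewrite integral_itv_obnd_cbnd; last exact: measurable_wexpE.
transitivity (exponential_prob c `[0, r]).
  apply: eq_integral => u; rewrite inE/= in_itv/= => /andP[u0 _].
  by rewrite exponential_pdfE.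
by rewrite exponential_prob_itv0c// mulNr EFinB.
Qed.

Lemma integral_wexp c : 0 < c -> (\int[leb]_(u in `]0%R, +oo[) (wexp c u)%:E = 1)%E.
Proof.
move=> c0; rewrite integral_itv_obnd_cbnd; last exact: measurable_wexpE.
rewrite -(integral_exponential_pdf c0) integral_mkcond; apply: eq_integral => u _.
by rewrite /exponential_pdf !patchE; case: ifP.
Qed.

Lemma measurable_powRE g (D : set R) : measurable_fun D (fun u => (u `^ g)%:E).
Proof. by apply/measurable_EFinP; apply: measurable_funTS; exact: measurable_powR. Qed.

Lemma measurable_wexp_powRE c g (D : set R) :
  measurable_fun D (fun u => (wexp c u * u `^ g)%:E).
Proof.
apply/measurable_EFinP; apply: measurable_funTS.
by apply: measurable_funM; [exact: measurable_wexp|exact: measurable_powR].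
Qed.

Lemma integral_wexp_powRN_lty c g : 0 < c -> 0 <= g < 1 ->
  (\int[leb]_(u in `]0%R, +oo[) (wexp c u * u `^ (- g))%:E < +oo)%E.
Proof.
move=> c0 /andP[g0 g1]; pose D : set R := `]0, +oo[%classic.
pose I : set R := `]0, 1]%classic.
have mD : measurable D by exact: measurable_itv.
have mI : measurable I by exact: measurable_itv.
have mp : measurable_fun D (fun u => ((u `^ (- g))%:E * (\1_I u)%:E)%E).
  apply: emeasurable_funM; first exact: measurable_powRE.
  by apply/measurable_EFinP; apply: measurable_funTS; exact: measurable_indic.
have p0 u : D u -> (0 <= (u `^ (- g))%:E * (\1_I u)%:E)%E.
  by move=> _; rewrite mule_ge0 ?lee_fin ?powR_ge0// indicE.
(* On (0, 1] the density is at most c and the power is integrable; beyond 1 the power is at most 1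
   and the density is integrable. *)
apply: (@le_lt_trans _ _ (\int[leb]_(u in D)
    (c%:E * ((u `^ (- g))%:E * (\1_I u)%:E) + (wexp c u)%:E))%E).
  apply: ge0_le_integral => //.
  - by move=> u _; rewrite lee_fin mulr_ge0 ?powR_ge0 ?wexp_ge0// ltW.
  - exact: measurable_wexp_powRE.
  - apply: emeasurable_funD; last exact: measurable_wexpE.
    by apply: emeasurable_funM.
  - move=> u; rewrite /D/= in_itv/= andbT => u0.
    rewrite -!EFinM -EFinD lee_fin indicE.
    have w0 : 0 <= wexp c u by rewrite wexp_ge0// ltW.
    have [u1|u1] := leP u 1.
      rewrite mem_set ?mulr1; last by rewrite /I/= in_itv/= u0.
      rewrite ler_wpDr// ler_wpM2r ?powR_ge0// /wexp ler_piMr ?(ltW c0)//.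
      by rewrite -[leRHS]expR0 ler_expR mulNr oppr_le0 mulr_ge0// ltW.
    rewrite ler_wpDl ?mulr_ge0 ?powR_ge0 ?(ltW c0)//.
    rewrite ler_piMr// -[leRHS](powRr0 u) ler_powR ?(ltW u1)// oppr_le0//.
rewrite ge0_integralD//; last first.
- exact: measurable_wexpE.
- by move=> u _; rewrite lee_fin wexp_ge0// ltW.
- by apply: emeasurable_funM.
- by move=> u Du; rewrite mule_ge0 ?p0// lee_fin ltW.
rewrite [X in (_ + X)%E]integral_wexp// ge0_integralZl//; last by rewrite lee_fin ltW.
rewrite lte_add_pinfty ?ltry// lte_mul_pinfty ?lee_fin ?(ltW c0)//.
rewrite integral_indicr (_ : D `&` I = I); last first.
  apply/seteqP; split => [x []//|x Ix]; split => //; move: Ix.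
  by rewrite /I /D/= !in_itv/= andbT => /andP[].
by apply: integral_powRN_near0; rewrite g0.
Qed.

(** Both sides are iterated integrals of the density at u times b r^(-b-1) over u <= r: integrating
    first in r gives u^(-b), first in u gives 1 - exp(-c r). *)
Lemma integral_wexp_tonelli b c : 0 < b -> 0 < c ->
  (\int[leb]_(r in `]0%R, +oo[) (b * r `^ (- b - 1) * (1 - expR (- (c * r))))%:E =
   \int[leb]_(u in `]0%R, +oo[) (wexp c u * u `^ (- b))%:E)%E.
Proof.
move=> b0 c0; pose D : set R := `]0, +oo[%classic.
have mD : measurable D by exact: measurable_itv.
pose h r := b * r `^ (- b - 1).
have h0 r : 0 <= h r by rewrite mulr_ge0 ?powR_ge0 ?ltW.
have w0 u : 0 <= wexp c u by rewrite wexp_ge0// ltW.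
have mh (A : set R) : measurable_fun A (fun r => (h r)%:E).
  by apply/measurable_EFinP; apply: measurable_funTS; apply: measurable_funM.
pose L : set (R * R) := [set z | z.1 <= z.2].
pose F (z : R * R) : \bar R := ((wexp c z.1 * \1_D z.1 * (h z.2 * \1_D z.2))%:E * (\1_L z)%:E)%E.
have mL : measurable L.
  rewrite -[L]setTI; apply: (measurable_fun_ler measurable_fst measurable_snd) => //.
have mF : measurable_fun setT F.
  apply: emeasurable_funM; last exact/measurable_EFinP/measurable_indic.
  apply/measurable_EFinP; apply: measurable_funM; apply: measurable_funM.
  - by apply: (measurableT_comp (measurable_wexp c)).
  - by apply: (measurableT_comp (measurable_indic _)).
  - by apply: (measurableT_comp (f := h)) => //; apply/measurable_EFinP; exact: mh.
  - by apply: (measurableT_comp (measurable_indic _)).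
have F0 z : (0 <= F z)%E.
  rewrite /F -EFinM lee_fin; apply: mulr_ge0; last by rewrite indicE.
  apply: mulr_ge0; apply: mulr_ge0; [exact: w0|by rewrite indicE|exact: h0|by rewrite indicE].
have := fubini_tonelli (m1 := leb) (m2 := leb) F mF F0.
rewrite [X in X = _](_ : _ = \int[leb]_(u in D) (wexp c u * u `^ (- b))%:E)%E; last first.
  rewrite [RHS]integral_mkcond; apply: eq_integral => u _; rewrite patchE.
  have [uD|uD] := boolP (u \in D); last first.
    by rewrite integral0_eq// => r _; rewrite /F/= indicE (negbTE uD) mulr0 mul0r mul0e.
  have u0 : 0 < u by move: uD; rewrite inE /D/= in_itv/= andbT.
  transitivity (\int[leb]_r ((wexp c u)%:E * (h r)%:E * (\1_(`[u, +oo[%classic : set R) r)%:E))%E.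
    apply: eq_integral => r _; rewrite /F/= [\1_D u]indicE uD mulr1.
    move: (h r) (wexp c u) => hr wu.
    rewrite -!EFinM -!mulrA; congr EFin; congr (_ * (_ * _)); rewrite !indicE -natrM mulnb.
    congr ((nat_of_bool _)%:R).
    apply/andP/idP => [[]|]; rewrite !inE /D /L/= !in_itv/= !andbT// => ur.
    by split => //; exact: lt_le_trans ur.
  rewrite integral_indicr setTI.
  rewrite ge0_integralZl//; last 3 first.
  - exact: mh.
  - by move=> r _; rewrite lee_fin.
  - by rewrite lee_fin.
  by rewrite integral_powRN_tail// EFinM.
move=> ->; rewrite [LHS]integral_mkcond; apply: eq_integral => r _; rewrite !patchE.
have [rD|rD] := boolP (r \in D); last first.
  by rewrite integral0_eq// => u _; rewrite /F/= [\1_D r]indicE (negbTE rD) !mulr0 mul0e.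
have r0 : 0 < r by move: rD; rewrite inE /D/= in_itv/= andbT.
transitivity (\int[leb]_u ((h r)%:E * (wexp c u)%:E * (\1_(`]0%R, r]%classic : set R) u)%:E))%E; last first.
  apply: eq_integral => u _; rewrite /F/= [\1_D r]indicE rD mulr1.
  move: (h r) (wexp c u) => hr wu.
  have -> : \1_(`]0%R, r]%classic : set R) u = \1_D u * \1_L (u, r) :> R.
    rewrite !indicE -natrM mulnb; congr ((nat_of_bool _)%:R).
    apply/idP/andP => [|[]]; rewrite !inE /D /L/= !in_itv/= ?andbT; last by move=> -> ->.
    by move=> /andP[-> ->].
  by rewrite -!EFinM; congr EFin; ring.
rewrite integral_indicr setTI ge0_integralZl//; last 3 first.
- exact: measurable_wexpE.
- by move=> u _; rewrite lee_fin.
- by rewrite lee_fin.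
by rewrite integral_wexp_itv// EFinM.
Qed.
End exponential_weight.

(** * The regularly varying counting function *)

Section counting_function.
Context (R : realType) (beta : R) (p : nat -> R) (nu : R -> nat) (L : R -> R).
Hypothesis hbeta : 0 < beta < 1.
Hypothesis hp0 : forall k, 0 < p k.
Hypothesis hp : forall j k, (j <= k)%N -> p k <= p j.
Hypothesis hnu : forall t, 0 < t -> is_count p t (nu t).
Hypothesis hL : slowly_varying L.
Hypothesis hnuL : forall t, 0 < t -> (nu t)%:R = t `^ beta * L t.
Local Notation leb := (@lebesgue_measure R).

Let beta0 : 0 < beta. Proof. by case/andP: hbeta. Qed.
Let beta1 : beta < 1. Proof. by case/andP: hbeta. Qed.

Lemma lt_count t k : 0 < t -> (k < nu t)%N = (1 / t <= p k).
Proof.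
move=> t0; have [h1 h2] := hnu t0; apply/idP/idP; last exact: h1.
case: h2 => [->//|[j -> tj]]; rewrite ltnS => kj.
exact: le_trans tj (hp kj).
Qed.

Lemma count_homo s t : 0 < s -> s <= t -> (nu s <= nu t)%N.
Proof.
move=> s0 st; have t0 : 0 < t := lt_le_trans s0 st.
have [_ [->//|[j -> sj]]] := hnu s0.
rewrite lt_count// (le_trans _ sj)// !div1r lef_pV2// posrE//.
Qed.

Lemma cvg_count : (nu t)%:R @[t --> +oo] --> (+oo : set_system R).
Proof.
apply/cvgryPge => A; near=> t.
pose k := Num.truncn `|A|.
apply: (@le_trans _ _ k.+1%:R).
  by rewrite (le_trans (ler_norm A))// ltW// truncnS_gt.
have t0 : 0 < t by near: t; exact: nbhs_pinfty_gt.
rewrite ler_nat lt_count// div1r invf_ple ?posrE; [|exact: t0|exact: hp0].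
by near: t; apply: nbhs_pinfty_ge; exact: num_real.
Unshelve. all: by end_near. Qed.

Lemma count_ratio lambda : 0 < lambda ->
  (nu (lambda * t))%:R / (nu t)%:R @[t --> +oo] --> lambda `^ beta.
Proof.
move=> l0; have [_ /(_ lambda l0) h] := hL.
rewrite -[X in _ --> X]mulr1.
apply: cvg_trans (cvgM (cvg_cst (lambda `^ beta)) h).
apply: near_eq_cvg; near=> t.
have t0 : 0 < t by near: t; exact: nbhs_pinfty_gt.
rewrite !hnuL ?mulr_gt0// powRM ?(ltW t0) ?(ltW l0)// invfM.
set a := t `^ beta; have a0 : a != 0 by rewrite gt_eqF// powR_gt0.
transitivity (lambda `^ beta * (a * a^-1) * (L (lambda * t) / L t)); last by rewrite /=; ring.
by rewrite mulfV// mulr1.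
Unshelve. all: by end_near. Qed.

(* Iterating nu (2 t) <= 2^g nu t along dyadic multiples replaces Potter's bound;
   monotonicity of nu takes care of the intermediate points. *)
Lemma count_potter : exists T K g : R, [/\ 0 < T, 0 <= K, 0 <= g < 1 &
  forall t u, T <= t -> 0 < u -> u <= 1 ->
    (nu (t / u))%:R <= K * u `^ (- g) * (nu t)%:R].
Proof.
(* Any exponent strictly between beta and 1 works: above beta it leaves room in the limit 2^beta of
   the doubling ratio, below 1 it keeps u^(-g) integrable at 0. *)
pose g := (beta + 1) / 2.
have g0 : 0 < g by rewrite divr_gt0// addr_gt0.
have g1 : g < 1 by rewrite /g; have := beta1; lra.
have gb : beta < g by rewrite /g; have := beta1; lra.
have b2 : 2 `^ beta < 2 `^ g :> R.
  rewrite /powR pnatr_eq0/= ltr_expR ltr_pM2r// ln_gt0// ltr1n//.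
have [T [T0 hT]] : exists T : R, 0 < T /\ forall t, T <= t ->
    (nu (2 * t))%:R <= 2 `^ g * (nu t)%:R.
  have := cvgr_le _ (count_ratio (ltr0Sn R 1)) _ b2.
  move=> [M [_ hM]].
  have n0 : \forall t \near +oo, (0 : R) < (nu t)%:R.
    by move/cvgryPgt : cvg_count; exact.
  case: n0 => [M' [_ hM']].
  exists (`|M| + `|M'| + 1); split; first by rewrite ltr_wpDl// addr_ge0.
  move=> t ht; rewrite -ler_pdivrMr.
    apply: hM; apply: lt_le_trans ht; rewrite (le_lt_trans (ler_norm M))//.
    by rewrite -addrA ltrDl ltr_wpDl.
  apply: hM'; apply: lt_le_trans ht; rewrite (le_lt_trans (ler_norm M'))//.
  by rewrite addrAC ltrDr ltr_wpDl.
have iterT t j : T <= t -> (nu (2 ^+ j * t))%:R <= (2 `^ g) ^+ j * (nu t)%:R.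
  move=> Tt; elim: j => [|j IH]; first by rewrite !expr0 !mul1r.
  rewrite !exprS -!mulrA (le_trans (hT _ _))//.
    rewrite (le_trans Tt)// ler_peMl ?(le_trans (ltW T0))//.
    by rewrite exprn_ege1// ler1n.
  by rewrite ler_wpM2l ?powR_ge0.
exists T, (2 `^ g), g; split => //; first by rewrite (ltW g0).
move=> t u Tt u0 u1.
have t0 : 0 < t := lt_le_trans T0 Tt.
(* Dyadic bracketing of 1 / u: the upper power serves monotonicity, the lower one turns (2^g)^j into
   u^(-g) at the price of one factor 2^g, which is K. *)
have [j [j1 j2]] : exists j : nat, 2 ^+ j <= u^-1 /\ u^-1 <= 2 ^+ j.+1.
  have iu1 : 1 <= u^-1 by rewrite invf_ge1.
  have [m um] : exists m : nat, u^-1 <= 2 ^+ m.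
    exists (Num.truncn u^-1).+1.
    rewrite (le_trans (ltW (truncnS_gt _)))// -natrX ler_nat ltnW// ltn_expl//.
  elim: m um => [|m IH] um.
    by exists 0%N; rewrite expr0 iu1 (le_trans um)// expr0 exprn_ege1// ler1n.
  by have [/IH//|/ltW um'] := leP u^-1 (2 ^+ m); exists m.
apply: (@le_trans _ _ (nu (2 ^+ j.+1 * t))%:R).
  by rewrite ler_nat count_homo ?divr_gt0// mulrC ler_wpM2r// ltW.
rewrite (le_trans (iterT _ _ Tt))// ler_wpM2r// exprS ler_wpM2l ?powR_ge0//.
have -> : (2 `^ g) ^+ j = (2 ^+ j) `^ g :> R.
  by rewrite -!powR_mulrn ?powR_ge0// -!powRrM mulrC.
have -> : u `^ (- g) = u^-1 `^ g by rewrite -powR_inv1 ?(ltW u0)// -powRrM mulN1r.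
rewrite ge0_ler_powR ?(ltW g0)// nnegrE ?exprn_ge0//.
by rewrite invr_ge0 ltW.
Unshelve. all: by end_near. Qed.

Lemma nneseries_lt_count (m : nat) :
  (\sum_(k <oo) ((k < m)%N%:R : R)%:E = m%:R%:E)%E.
Proof.
apply/cvg_lim => //; apply: cvg_near_cst; near=> n.
have mn : (m <= n)%N by near: n; exact: nbhs_infty_ge.
rewrite sumEFin; congr EFin; rewrite (big_cat_nat (leq0n m) mn)/=.
rewrite [X in _ + X]big_nat_cond [X in _ + X]big1 ?addr0; last first.
  by move=> i /andP[/andP[mi _] _]; rewrite ltnNge mi.
rewrite big_nat_cond (eq_bigr (fun=> 1)); last by move=> i /andP[/andP[_ ->]].
by rewrite -big_nat_cond sumr_const_nat subn0.
Unshelve. all: by end_near. Qed.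

(** Since p k >= u / rho means u <= rho p k, the count is a sum of indicators in u. This gives
    measurability in u and prepares the exchange of sum and integral. *)
Lemma count_eseries rho u : 0 < rho -> 0 < u ->
  ((nu (rho / u))%:R%:E =
   \sum_(k <oo) (\1_(`]0%R, (rho * p k)%R]%classic : set R) u : R)%:E)%E.
Proof.
move=> r0 u0; rewrite -nneseries_lt_count.
apply: eq_eseriesr => k _; rewrite indicE lt_count ?divr_gt0//; congr ((nat_of_bool _)%:R%:E).
rewrite div1r invf_div ler_pdivrMr// [p k * _]mulrC.
by apply/idP/idP; rewrite inE/= in_itv/= u0.
Qed.

(** Each term is the integral of [wexp c] over (0, rho p k]; summing the indicators under the
    integral restores the count. *)
Lemma sum_exp_count c rho : 0 < c -> 0 < rho ->
  (\sum_(k <oo) (1 - expR (- (c * (rho * p k))))%:E =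
   \int[leb]_(u in `]0%R, +oo[) (wexp c u * (nu (rho / u))%:R)%:E)%E.
Proof.
move=> c0 r0; pose D : set R := `]0, +oo[%classic.
have mD : measurable D by exact: measurable_itv.
rewrite (eq_eseriesr (g := fun k => (\int[leb]_(u in D)
    ((wexp c u)%:E * (\1_(`]0%R, (rho * p k)%R]%classic : set R) u)%:E))%E)); last first.
  move=> k _; rewrite integral_indicr -integral_wexp_itv ?mulr_gt0//.
  congr integral; apply/seteqP; split => [x xI|x []//]; split => //; move: xI.
  by rewrite /D/= !in_itv/= andbT => /andP[].
rewrite -integral_nneseries//; last 2 first.
- move=> k; apply: emeasurable_funM; first exact: measurable_wexpE.
  by apply/measurable_EFinP; apply: measurable_funTS; exact: measurable_indic.
- by move=> k u _; rewrite mule_ge0// lee_fin ?wexp_ge0 ?(ltW c0)// indicE.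
apply: eq_integral => u; rewrite inE /D/= in_itv/= andbT => u0.
rewrite nneseriesZl; last by move=> k _; rewrite lee_fin indicE.
by rewrite [RHS]EFinM count_eseries.
Qed.

Lemma measurable_count_inv rho : 0 < rho ->
  measurable_fun (`]0, +oo[%classic : set R) (fun u : R => (nu (rho / u))%:R : R).
Proof.
move=> r0; apply/measurable_EFinP.
apply: (@eq_measurable_fun _ _ _ _ _ (fun u =>
  (\sum_(k <oo) (\1_(`]0%R, (rho * p k)%R]%classic : set R) u : R)%:E)%E)).
  by move=> u; rewrite inE/= in_itv/= andbT => u0; rewrite -count_eseries.
apply: ge0_emeasurable_sum; first by move=> k u _ _; rewrite lee_fin indicE.
by move=> k _; apply/measurable_EFinP; apply: measurable_funTS; exact: measurable_indic.
Qed.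

End counting_function.

Lemma cvg_series_nneseries (R : realType) (f : nat -> R) :
  (forall k, 0 <= f k) -> (\sum_(k <oo) (f k)%:E < +oo)%E ->
  series f @ \oo --> fine (\sum_(k <oo) (f k)%:E)%E.
Proof.
move=> f0 fy.
have fin : (\sum_(k <oo) (f k)%:E)%E \is a fin_num.
  by rewrite ge0_fin_numE// nneseries_ge0// => k _; rewrite lee_fin.
have : cvgn (eseries (EFin \o f)).
  by apply: is_cvg_nneseries => k _ _; rewrite lee_fin.
rewrite /eseries => /cvg_ex[l hl].
have lE : (\sum_(k <oo) (f k)%:E)%E = l by apply/cvg_lim.
rewrite lE in fin *; move: hl; rewrite -(fineK fin) => /fine_cvgP[_].
by rewrite (_ : _ \o _ = series f)//; apply/funext => n /=; rewrite sumEFin.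
Qed.

Section karlin_sum.
Context (R : realType) (beta : R) (p : nat -> R) (nu : R -> nat) (L : R -> R).
Hypothesis hbeta : 0 < beta < 1.
Hypothesis hp0 : forall k, 0 < p k.
Hypothesis hp : forall j k, (j <= k)%N -> p k <= p j.
Hypothesis hnu : forall t, 0 < t -> is_count p t (nu t).
Hypothesis hL : slowly_varying L.
Hypothesis hnuL : forall t, 0 < t -> (nu t)%:R = t `^ beta * L t.
Local Notation leb := (@lebesgue_measure R).

(** For c > 0 this is c^beta Gamma(1 - beta), and it is 0 for c = 0. It is kept as an integral
    because the sums over k and the control measure both produce it in this form. *)
Definition exp_weight_moment (c : R) : R :=
  \int[leb]_(u in `]0%R, +oo[) (wexp c u * u `^ (- beta)).

Definition karlin_sum (c rho : R) : R :=
  fine (\sum_(k <oo) (1 - expR (- (c * (rho * p k))))%:E)%E.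

Let t0 k c rho : 0 <= c -> 0 < rho -> 0 <= 1 - expR (- (c * (rho * p k))).
Proof. by move=> c0 r0; rewrite subr_ge0 expR_le1 oppr_le0 mulr_ge0// mulr_ge0// ltW. Qed.

Let D : set R := `]0, +oo[%classic.
Let mD : measurable D. Proof. exact: measurable_itv. Qed.

(* The part of the dominating function near 0 comes from count_potter, the
   constant 1 from the monotonicity of nu. *)
Lemma karlin_domination (c : R) : 0 < c -> exists (T : R) (g : R -> R),
  [/\ 0 < T, leb.-integrable D (EFin \o g),
    forall rho, T <= rho -> (0 < nu rho)%N &
    forall rho u, T <= rho -> D u ->
      wexp c u * ((nu (rho / u))%:R / (nu rho)%:R) <= g u].
Proof.
move=> c0; have [T [K [g [T0 K0 g01 hT]]]] := count_potter hbeta hp0 hp hnu hL hnuL.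
have hH s t := count_homo hp hnu (s := s) (t := t).
(* Beyond 1 / p 0 the count is at least 1, so that dividing by it is meaningful. *)
pose T' := Num.max T (p 0%N)^-1.
have T'0 : 0 < T' by rewrite lt_max T0.
have n0 rho : T' <= rho -> (0 < nu rho)%N.
  move=> Tr; have r0 := lt_le_trans T'0 Tr.
  rewrite (lt_count hp hnu)// div1r invf_ple ?posrE// (le_trans _ Tr)//.
  by rewrite le_max lexx orbT.
exists T', (fun u => K * (wexp c u * u `^ (- g)) + wexp c u); split => //.
  have i1 : leb.-integrable D (fun u => (wexp c u * u `^ (- g))%:E).
    apply/integrableP; split; first exact: measurable_wexp_powRE.
    apply: le_lt_trans (integral_wexp_powRN_lty c0 g01).
    rewrite le_eqVlt; apply/orP; left; apply/eqP; apply: eq_integral => u _.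
    by rewrite gee0_abs// lee_fin mulr_ge0 ?powR_ge0// wexp_ge0// ltW.
  have i2 : leb.-integrable D (fun u => (wexp c u)%:E).
    apply/integrableP; split; first exact: measurable_wexpE.
    apply: (@le_lt_trans _ _ 1%E); last exact: ltry.
    rewrite -(integral_wexp c0) le_eqVlt; apply/orP; left; apply/eqP.
    by apply: eq_integral => u _; rewrite gee0_abs// lee_fin wexp_ge0// ltW.
  rewrite (_ : EFin \o _ = (fun u => K%:E * (wexp c u * u `^ (- g))%:E)%E \+
    (fun u => (wexp c u)%:E))%E; last by [].
  by apply: integrableD => //; exact: integrableZl.
move=> rho u Tr; rewrite /D/= in_itv/= andbT => u0.
have r0 := lt_le_trans T'0 Tr.
have w0 : 0 <= wexp c u by rewrite wexp_ge0// ltW.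
have nr : (0 : R) < (nu rho)%:R by rewrite ltr0n n0.
have [u1|u1] := leP u 1.
  rewrite ler_wpDr// [leRHS]mulrCA ler_wpM2l// ler_pdivrMr// hT//.
  by rewrite (le_trans _ Tr)// le_max lexx.
apply: (@le_trans _ _ (wexp c u)); last first.
  by rewrite lerDr; apply: mulr_ge0 => //; apply: mulr_ge0 => //; exact: powR_ge0.
rewrite ler_piMr// ler_pdivrMr// mul1r ler_nat.
by rewrite hH ?divr_gt0// ler_pdivrMr// ler_peMr// ltW.
Qed.

Lemma karlin_sumE (c rho : R) : 0 < c -> 0 < rho -> (0 < nu rho)%N ->
  (\sum_(k <oo) (1 - expR (- (c * (rho * p k))))%:E =
   (nu rho)%:R%:E * \int[leb]_(u in D)
     (wexp c u * ((nu (rho / u))%:R / (nu rho)%:R))%:E)%E.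
Proof.
move=> c0 r0 n0; rewrite (sum_exp_count hp0 hp hnu c0 r0).
rewrite -ge0_integralZl//; last 2 first.
- apply/measurable_EFinP; apply: measurable_funM; first exact: measurable_funTS (measurable_wexp c).
  by apply: measurable_funM => //; exact: (measurable_count_inv hp hnu r0).
- by move=> u _; rewrite lee_fin mulr_ge0 ?wexp_ge0 ?divr_ge0// ltW.
apply: eq_integral => u _; rewrite -EFinM; congr EFin.
by rewrite [RHS]mulrCA; congr (_ * _); rewrite [RHS]mulrC divfK// pnatr_eq0 -lt0n.
Qed.

Lemma karlin_sum_lty (c : R) : 0 <= c -> \forall rho \near +oo,
  (\sum_(k <oo) (1 - expR (- (c * (rho * p k))))%:E < +oo)%E.
Proof.
rewrite le_eqVlt => /predU1P[<-|c0].
  apply: nearW => rho; rewrite eseries0// => k _ _.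
  by rewrite mul0r oppr0 expR0 subrr.
have [T [g [T0 ig Tn hg]]] := karlin_domination c0.
near=> rho; have Tr : T <= rho by near: rho; apply: nbhs_pinfty_ge; exact: num_real.
have r0 := lt_le_trans T0 Tr.
rewrite karlin_sumE// ?Tn// lte_mul_pinfty ?lee_fin//.
have := @integrable_lty _ _ _ leb D mD _ ig; apply: le_lt_trans; apply: ge0_le_integral => //.
- by move=> u _; rewrite lee_fin mulr_ge0 ?wexp_ge0 ?divr_ge0// ltW.
- apply/measurable_EFinP; apply: measurable_funM; first exact: measurable_funTS (measurable_wexp c).
  by apply: measurable_funM => //; exact: (measurable_count_inv hp hnu r0).
- exact: measurable_int ig.
- by move=> u Du; rewrite lee_fin hg.
Unshelve. all: by end_near. Qed.

Lemma cvg_karlin_sum (c : R) : 0 <= c ->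
  karlin_sum c rho / (nu rho)%:R @[rho --> +oo] --> exp_weight_moment c.
Proof.
(* The value c = 0 does occur: it belongs to symmetric differences of measure 0, among them the
   empty one. *)
rewrite le_eqVlt => /predU1P[<-|c0].
  have -> : exp_weight_moment 0 = 0.
    rewrite /exp_weight_moment /Rintegral integral0_eq// => u _.
    by rewrite /wexp !mul0r.
  rewrite (_ : (fun rho => _) = (fun=> 0)); first exact: cvg_cst.
  apply/funext => rho; rewrite /karlin_sum eseries0 ?mul0r// => k _ _.
  by rewrite mul0r oppr0 expR0 subrr.
have [T [g [T0 ig Tn hg]]] := karlin_domination c0.
apply/cvg_pinftyP => v vy.
(* Dominated convergence is stated along sequences and asks for a bound at every index; raising the
   sequence to at least T changes only finitely many terms. *)
pose v' n := Num.max (v n) T.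
have v'T n : T <= v' n by rewrite /v' le_max lexx orbT.
have v'0 n : 0 < v' n := lt_le_trans T0 (v'T n).
have v'y : v' n @[n --> \oo] --> +oo.
  apply/cvgryPge => A; have /cvgryPge/(_ A) := vy; apply: filterS => n Av.
  by rewrite /v' le_max Av.
pose f n u : R := wexp c u * ((nu (v' n / u))%:R / (nu (v' n))%:R).
have f0 n u : 0 <= f n u by rewrite mulr_ge0 ?wexp_ge0 ?divr_ge0// ltW.
have mf n : measurable_fun D (EFin \o f n).
  have r0 := v'0 n.
  apply/measurable_EFinP; apply: measurable_funM; first exact: measurable_funTS (measurable_wexp c).
  by apply: measurable_funM => //; exact: (measurable_count_inv hp hnu r0).
have [] := @dominated_convergence _ _ _ leb D mD (fun n => EFin \o f n)
    (fun u => (wexp c u * u `^ (- beta))%:E) (EFin \o g) mf _ _ ig.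
- exact: measurable_wexp_powRE.
- apply: aeW => u; rewrite /D/= in_itv/= andbT => u0.
  apply/fine_cvgP; split; first exact: nearW.
  apply: cvgM; first exact: cvg_cst.
  have := count_ratio hL hnuL (lambda := u^-1); rewrite invr_gt0 => /(_ u0) /cvg_pinftyP/(_ _ v'y).
  rewrite -powR_inv1 ?(ltW u0)// -powRrM mulN1r.
  apply: cvg_trans; apply: near_eq_cvg; apply: nearW => n /=.
  by rewrite powR_inv1 ?(ltW u0)// [u^-1 * _]mulrC.
- apply: aeW => u n Du; rewrite gee0_abs ?lee_fin ?f0//.
  exact: hg.
move=> iw _ cI.
have : fine (\int[leb]_(u in D) (f n u)%:E) @[n --> \oo] --> exp_weight_moment c.
  apply: fine_cvg; rewrite /exp_weight_moment /Rintegral fineK; first exact: cI.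
  exact: (@integrable_fin_num _ _ _ leb D mD _ iw).
apply: cvg_trans; apply: near_eq_cvg.
have /cvgryPge/(_ T) := vy; apply: filterS => n Tv.
have v'v : v' n = v n by rewrite /v'; apply/max_idPl.
rewrite /karlin_sum karlin_sumE -?v'v// ?Tn// fineM//; last first.
  rewrite ge0_fin_numE; last by apply: integral_ge0 => u _; rewrite lee_fin f0.
  have := @integrable_lty _ _ _ leb D mD _ ig; apply: le_lt_trans; apply: ge0_le_integral => //.
  - by move=> u _; rewrite lee_fin; exact: f0.
  - exact: mf.
  - exact: measurable_int ig.
  - by move=> u Du; rewrite lee_fin hg.
by rewrite mulrAC divff ?mul1r// pnatr_eq0 -lt0n Tn.
Qed.

End karlin_sum.

(** * Evaluation of the control measure *)

Section karlin_control_formula.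
Context (R : realType) (beta : R).
Hypothesis hbeta : 0 < beta < 1.
Local Notation leb := (@lebesgue_measure R).

Let beta0 : 0 < beta. Proof. by case/andP: hbeta. Qed.
Let beta01 : 0 <= beta < 1. Proof. by case/andP: hbeta => /ltW -> ->. Qed.
Let D : set R := `]0, +oo[%classic.
Let mD : measurable D. Proof. exact: measurable_itv. Qed.

Lemma exp_weight_momentE c : 0 < c ->
  (\int[leb]_(u in D) (wexp c u * u `^ (- beta))%:E =
   (exp_weight_moment beta c)%:E)%E.
Proof.
move=> c0; rewrite /exp_weight_moment /Rintegral fineK// ge0_fin_numE.
  exact: integral_wexp_powRN_lty.
by apply: integral_ge0 => u _; rewrite lee_fin mulr_ge0 ?powR_ge0 ?wexp_ge0// ltW.
Qed.

(** Gamma(1 - beta) is the moment above at c = 1, and on (0, 1] the integrand is at least the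
    exponential density, whose mass there is 1 - exp(-1). *)
Lemma Gamma_gt0 : 0 < Gamma (1 - beta).
Proof.
have -> : Gamma (1 - beta) = exp_weight_moment beta 1.
  rewrite /Gamma /exp_weight_moment; apply: eq_Rintegral => u _.
  by rewrite /wexp mul1r mulN1r mulrC; congr (_ * _ `^ _); ring.
rewrite -lte_fin -exp_weight_momentE//.
apply: (@lt_le_trans _ _ (\int[leb]_(u in D) ((wexp 1 u)%:E * (\1_(`]0%R, 1%R]%classic : set R) u)%:E))%E).
  rewrite integral_indicr (_ : D `&` _ = `]0, 1]%classic).
    by rewrite integral_wexp_itv// lte_fin mulr1 subr_gt0 expR_lt1 oppr_lt0.
  apply/seteqP; split => [x []//|x Ix]; split => //; move: Ix.
  by rewrite /D/= !in_itv/= andbT => /andP[].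
have w0 u : 0 <= wexp 1 u :> R by rewrite wexp_ge0.
apply: ge0_le_integral => //.
- by move=> u _; rewrite -EFinM lee_fin mulr_ge0// indicE.
- apply: emeasurable_funM; first exact: measurable_wexpE.
  by apply/measurable_EFinP; apply: measurable_funTS; exact: measurable_indic.
- exact: measurable_wexp_powRE.
move=> u; rewrite /D/= in_itv/= andbT => u0.
rewrite -EFinM lee_fin ler_wpM2l// indicE.
have [|_] := boolP (u \in _); last exact: powR_ge0.
rewrite inE/= in_itv/= u0/= => u1.
rewrite powRN invf_ge1 ?powR_gt0//.
by rewrite -(powRr0 u) ger_powR ?u0 ?u1// ltW.
Qed.

Lemma karlin_const_gt0 : 0 < karlin_const beta.
Proof. by rewrite /karlin_const divr_gt0 ?Gamma_gt0// mulr_gt0// powR_gt0. Qed.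

Lemma integrable_powR_onem_exp c : 0 <= c ->
  leb.-integrable D (fun r => (r `^ (- beta - 1) * (1 - expR (- (c * r))))%:E) /\
  (\int[leb]_(r in D) (r `^ (- beta - 1) * (1 - expR (- (c * r))))%:E =
   (beta^-1 * exp_weight_moment beta c)%:E)%E.
Proof.
have mf : measurable_fun D (fun r => (r `^ (- beta - 1) * (1 - expR (- (c * r))))%:E).
  apply/measurable_EFinP; apply: measurable_funTS; apply: measurable_funM => //.
  apply: measurable_funB => //; apply: measurableT_comp => //.
  by apply: measurableT_comp => //; exact: measurable_funM.
rewrite le_eqVlt => /predU1P[c0|c0].
  rewrite -c0 /exp_weight_moment /Rintegral integral0_eq; last first.
    by move=> u _; rewrite /wexp !mul0r.
  have z r : (r `^ (- beta - 1) * (1 - expR (- (0 * r))))%:E = 0%E.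
    by rewrite mul0r oppr0 expR0 subrr mulr0.
  rewrite mulr0; split; last by rewrite integral0_eq.
  by under eq_fun do rewrite z; exact: integrable0.
have f0 r : D r -> (0 <= (r `^ (- beta - 1) * (1 - expR (- (c * r))))%:E)%E.
  rewrite /D/= in_itv/= andbT => r0.
  by rewrite lee_fin mulr_ge0 ?powR_ge0// subr_ge0 expR_le1 oppr_le0 mulr_ge0// ltW.
have I : (\int[leb]_(r in D) (r `^ (- beta - 1) * (1 - expR (- (c * r))))%:E =
   (beta^-1 * exp_weight_moment beta c)%:E)%E.
  rewrite EFinM -exp_weight_momentE// -(integral_wexp_tonelli beta0 c0).
  under [in RHS]eq_integral do rewrite -mulrA EFinM.
  rewrite ge0_integralZl//; last by rewrite lee_fin ltW.
  by rewrite muleA -EFinM mulVf ?mul1e// gt_eqF.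
split => //; apply/integrableP; split => //.
apply: (@le_lt_trans _ _ (beta^-1 * exp_weight_moment beta c)%:E); last exact: ltry.
rewrite -I le_eqVlt; apply/orP; left; apply/eqP; apply: eq_integral => r.
by rewrite inE => /f0 h; rewrite gee0_abs.
Qed.

(** The coefficients a i have no fixed sign, so the integral is split by linearity, each term being
    integrable by itself. *)
Lemma karlin_controlE d (E : measurableType d) (mu : set E -> \bar R)
    (B : set (point_measure E R)) (I : finType) (a c : I -> R) :
  (forall i, 0 <= c i) ->
  (forall r, 0 < r -> fine (poisson_law (fun A => (r%:E * mu A)%E) B) =
    \sum_i a i * (1 - expR (- (c i * r)))) -> measurable B ->
  karlin_control beta mu B =
  (karlin_const beta / beta * \sum_i a i * exp_weight_moment beta (c i))%:E.
Proof.
move=> c0 hB mB; rewrite /karlin_control.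
have -> : (\int[leb]_(r in D) ((r `^ (- beta - 1))%:E *
    poisson_law (fun A => (r%:E * mu A)%E) B) =
    \int[leb]_(r in D) (\sum_(i <- index_enum I)
      (a i)%:E * (r `^ (- beta - 1) * (1 - expR (- (c i * r))))%:E))%E.
  apply: eq_integral => r; rewrite inE /D/= in_itv/= andbT => r0.
  rewrite -[poisson_law _ B]fineK ?fin_num_measure// hB//.
  rewrite -EFinM mulr_sumr -sumEFin; apply: eq_bigr => i _.
  by rewrite -EFinM; congr EFin; ring.
rewrite integral_sum//; last first.
  by move=> i; apply: integrableZl => //; case: (integrable_powR_onem_exp (c0 i)).
rewrite (eq_bigr (fun i => (a i * (beta^-1 * exp_weight_moment beta (c i)))%:E)).
  rewrite sumEFin -EFinM; congr EFin; rewrite -mulrA; congr (_ * _).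
  by rewrite mulr_sumr; apply: eq_bigr => i _; ring.
move=> i _; have [ii iE] := integrable_powR_onem_exp (c0 i).
by rewrite integralZl// iE EFinM.
Qed.

End karlin_control_formula.

(** * The Karlin stable process *)

Section independent_families.
Context d (Omega : measurableType d) (R : realType) (P : probability Omega R).

Lemma independent_family_scale (I : eqType) (X : I -> Omega -> R) (a : I -> R) :
  independent_family P X -> independent_family P (fun i w => a i * X i w).
Proof.
move=> iX s B us sB; apply: iX => // i /sB[C mC <-].
exists ((fun x => a i * x) @^-1` C); last by [].
by rewrite -[_ @^-1` _]setTI; apply: mulrl_measurable.
Qed.

Lemma ae_eq_cexp (X Y : Omega -> R) : measurable_fun setT X -> measurable_fun setT Y ->
  {ae P, forall w, X w = Y w} -> cexp P X = cexp P Y.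
Proof.
move=> mX mY XY; rewrite /cexp; congr (_ +i* _)%C; congr fine;
  apply: ae_eq_integral => //.
- by apply/measurable_EFinP; case: (bounded_rv_cos mX).
- by apply/measurable_EFinP; case: (bounded_rv_cos mY).
- by apply: filterS XY => w -> _.
- by apply/measurable_EFinP; case: (bounded_rv_sin mX).
- by apply/measurable_EFinP; case: (bounded_rv_sin mY).
- by apply: filterS XY => w -> _.
Qed.

End independent_families.

Section limit_process.
Context (R : realType) (alpha beta : R) (d : measure_display) (E : measurableType d).
Context (mu : {measure set E -> \bar R}).
Context d' (Omega : measurableType d') (P : probability Omega R).
Context (M : set (point_measure E R) -> Omega -> R).
Hypothesis halpha : 0 < alpha.
Hypothesis hbeta : 0 < beta < 1.
Hypothesis plaw : forall r, 0 < r ->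
  poisson_point_process (poisson_law (fun A => (r%:E * mu A)%E) : probability _ R) id
    (fun A => (r%:E * mu A)%E).
Hypothesis hM : sas_random_measure P alpha (karlin_control beta mu) M.
Context (n : nat) (A : 'I_n -> set E).
Hypothesis mA : forall i, measurable (A i).
Hypothesis fA : forall i, (mu (A i) < +oo)%E.

Definition subset_sum (theta : 'I_n -> R) (J : {set 'I_n}) : R := \sum_(i in J) theta i.

Definition parity_moment (J : {set 'I_n}) : R := karlin_const beta / beta *
  \sum_K parity_coef R J K * exp_weight_moment beta (2 * fine (mu (symdiff A K))).

Lemma karlin_control_parity_set J : J != finset.set0 ->
  karlin_control beta mu (parity_set A J) = (parity_moment J)%:E.
Proof.
move=> J0; rewrite (@karlin_controlE _ _ hbeta _ _ _ _ {set 'I_n} (parity_coef R J)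
  (fun K => 2 * fine (mu (symdiff A K))))//.
- move=> r r0; have := prob_scaled_parity_set r0 (plaw r0) mA fA J0.
  rewrite preimage_id => ->.
  by apply: eq_bigr => K _; congr (_ * (1 - expR (- _))); ring.
- exact: measurable_parity_set.
Qed.

Lemma karlin_control_odd_lty i :
  (karlin_control beta mu [set m | odd_count m (A i)] < +oo)%E.
Proof.
rewrite (@karlin_controlE _ _ hbeta _ _ _ _ 'I_1 (fun=> 2^-1)
  (fun=> 2 * fine (mu (A i)))) ?ltry//.
- move=> r r0; have := prob_scaled_odd_count r0 (plaw r0) (mA i) (fA i).
  rewrite preimage_id big_ord1 => ->; rewrite [LHS]mulrC.
  by congr (_ * (1 - expR (- _))); ring.
- exact: measurable_odd_count.
Qed.

Lemma karlin_control_set0 : karlin_control beta mu set0 = 0%E.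
Proof.
rewrite /karlin_control integral0_eq ?mule0// => r _.
by rewrite measure0 mule0.
Qed.

(** The all-even pattern has infinite control measure, since its probability tends to 1 as r tends
    to 0. Putting [set0] in its place keeps a disjoint family of finite measure indexed by all
    subsets. *)
Let B (J : {set 'I_n}) : set (point_measure E R) :=
  if J == finset.set0 then set0 else parity_set A J.

Let mB J : measurable (B J).
Proof. by rewrite /B; case: eqP => // _; exact: measurable_parity_set. Qed.

Let fB J : (karlin_control beta mu (B J) < +oo)%E.
Proof.
rewrite /B; case: eqP => [_|/eqP J0]; first by rewrite karlin_control_set0.
by rewrite karlin_control_parity_set// ltry.
Qed.

Let tB : trivIset setT B.
Proof.
apply/trivIsetP => J K _ _ JK; rewrite /B.
case: eqP => _; first by rewrite set0I.
case: eqP => _; first by rewrite setI0.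
by have /trivIsetP := @trivIset_parity_set _ E R _ A; apply.
Qed.

Lemma measurable_karlin_process i : measurable_fun setT (karlin_process M (A i)).
Proof.
have [h _ _] := hM.
by case: (h _ (measurable_odd_count (mA i)) (karlin_control_odd_lty i)).
Qed.

(** The event that the count of A i is odd is the disjoint union of the patterns containing i.
    Additivity of M is given for sequences only, so the finite list of patterns is padded with
    [set0]. *)
Lemma karlin_process_decomp i : {ae P, forall w,
  karlin_process M (A i) w = \sum_(J : {set 'I_n} | i \in J) M (B J) w}.
Proof.
have [_ _ h] := hM.
pose s := enum [pred J : {set 'I_n} | i \in J].
pose F k := if (k < size s)%N then B (nth finset.set0 s k) else set0.
have mF k : measurable (F k) by rewrite /F; case: ifP.
have tF : trivIset setT F.
  apply/trivIsetP => j k _ _ jk; rewrite /F.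
  case: ifP => js; last by rewrite set0I.
  case: ifP => ks; last by rewrite setI0.
  have /trivIsetP := tB; apply => //.
  by rewrite nth_uniq// enum_uniq.
have UF : \bigcup_k F k = [set m | odd_count m (A i)].
  apply/seteqP; split => m /=.
    move=> [k _]; rewrite /F; case: ifP => // ks; rewrite /B; case: ifP => // _ /(_ i) oi.
    have := mem_nth finset.set0 ks; rewrite mem_enum inE => iJ.
    by move: oi; rewrite iJ => /asboolP.
  move=> om; pose J : {set 'I_n} := [set j | odd_countb m (A j)]%SET.
  have iJ : i \in J by rewrite inE; exact/asboolP.
  have sJ : J \in s by rewrite mem_enum.
  exists (index J s) => //; rewrite /F index_mem sJ nth_index//.
  rewrite /B; case: eqP => [J0|_]; first by move: iJ; rewrite J0 inE.
  by move=> j; rewrite inE.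
have := h F mF tF; rewrite UF => /(_ (karlin_control_odd_lty i)).
apply: filterS => w cw.
(* The convergent series has [M set0 w] as all its late terms, and these tend to 0. *)
have M0 : M set0 w = 0.
  have := cvg_series_cvg_0 (cvgP _ cw) => c0.
  apply/esym/(cvg_unique _ c0) => //; apply: cvg_near_cst; near=> k.
  rewrite /F ifF//; apply/negbTE; rewrite -leqNgt.
  by near: k; exact: nbhs_infty_ge.
rewrite /karlin_process; apply: (cvg_unique _ cw) => //.
apply: cvg_near_cst; near=> k.
have sk : (size s <= k)%N by near: k; exact: nbhs_infty_ge.
rewrite /series/= (big_cat_nat (leq0n (size s)) sk)/= [X in _ + X]big_nat_cond.
rewrite [X in _ + X]big1 ?addr0; last first.
  by move=> j /andP[/andP[sj _] _]; rewrite /F ltnNge sj.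
rewrite -[RHS]big_enum -/s (big_nth finset.set0) big_nat_cond [RHS]big_nat_cond.
by apply: eq_bigr => j /andP[/andP[_ js] _]; rewrite /F js.
Unshelve. all: by end_near. Qed.

(** Exchanging sums turns the linear combination into sum_J s_J M(B J), whose terms are independent
    and stable with scale given by the control measure. *)
Lemma cexp_karlin_process (theta : 'I_n -> R) :
  cexp P (fun w => dotp theta ((fun i => karlin_process M (A i)) ^~ w)) =
  (expR (- \sum_(J : {set 'I_n} | J != finset.set0)
     parity_moment J * `|subset_sum theta J| `^ alpha))%:C%C.
Proof.
have [hs hi _] := hM.
have mM J : measurable_fun setT (M (B J)) by case: (hs _ (mB J) (fB J)).
have -> : cexp P (fun w => dotp theta ((fun i => karlin_process M (A i)) ^~ w)) =
    cexp P (fun w => \sum_(J : {set 'I_n}) subset_sum theta J * M (B J) w).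
  apply: ae_eq_cexp.
  - by apply: measurable_dotp => i; exact: measurable_karlin_process.
  - by apply: measurable_sum => J; exact: measurable_funM.
  have := filter_forall (ae_filter_ringOfSetsType P) karlin_process_decomp.
  apply: filterS => w h; rewrite /dotp.
  under eq_bigr do rewrite h mulr_sumr.
  rewrite (exchange_big_dep xpredT)//=.
  by apply: eq_bigr => J _; rewrite mulr_suml.
rewrite cexp_sum_indep ?index_enum_uniq//; last 2 first.
- by move=> J; exact: measurable_funM.
- by apply: independent_family_scale; apply: hi.
rewrite (eq_bigr (fun J => (expR (- (if J != finset.set0 then
    parity_moment J * `|subset_sum theta J| `^ alpha else 0)))%:C%C)); last first.
  move=> J _; rewrite -char_funE; have [_ ->] := hs _ (mB J) (fB J).
  (* For the empty pattern the subset sum is 0, and 0 to the power alpha is 0 because alpha > 0. *)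
  congr (expR (- _))%:C%C; have [J0|J0] := eqVneq J finset.set0.
    rewrite /subset_sum J0 big_set0 normr0 powR0 ?mulr0// gt_eqF//.
  congr (_ * _); rewrite -powRrM mulVf ?gt_eqF// powRr1.
    by rewrite /B (negbTE J0) karlin_control_parity_set.
  apply: fine_ge0; rewrite /karlin_control mule_ge0//.
    by rewrite lee_fin ltW// karlin_const_gt0.
  by apply: integral_ge0 => r _; rewrite mule_ge0// lee_fin powR_ge0.
by rewrite -rmorph_prod -expR_sum sumrN -big_mkcond.
Qed.

End limit_process.

(** * The randomized sums *)

Section independence_lemmas.
Context d (Omega : measurableType d) (R : realType) (P : probability Omega R).

Lemma independent_family_inj (I J : eqType) d' (T : measurableType d')
    (X : J -> Omega -> T) (g : I -> J) : injective g ->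
  independent_family P X -> independent_family P (fun i => X (g i)).
Proof.
move=> gI iX s B us sB.
(* Transports the events along g without an inverse: by injectivity the intersection has one member
   at j = g i with i in s, and is the whole space at indices outside the image of s. *)
pose B' j := \bigcap_(i in [set i | i \in s /\ g i = j]) B i.
have B'E i : i \in s -> B' (g i) = B i.
  move=> si; apply/seteqP; split => [w h|w Bw k [_ /gI ->]//].
  by apply: h; split.
have := iX (map g s) B'; rewrite (map_inj_uniq gI) => /(_ us) h.
rewrite (_ : \bigcap_(i in [set` s]) B i = \bigcap_(j in [set` map g s]) B' j).
  rewrite h ?big_map; last by move=> j /mapP[i si ->]; rewrite B'E//; exact: sB.
  by rewrite big_seq [RHS]big_seq; apply: eq_bigr => i si; rewrite B'E.
apply/seteqP; split => w hw j /=.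
  by move=> /mapP[i si ->]; rewrite B'E//; exact: hw.
by move=> sj; rewrite -B'E//; apply: hw; exact: map_f.
Qed.

(** Independence of the variables and the point processes is assumed for the generated
    sigma-algebras; this places joint events of finitely many of them there. *)
Lemma sigma_of_family_bigcap (I J : Type) d' (T : measurableType d')
    (X : J -> Omega -> T) (g : I -> J) (D : set I) (B : I -> set Omega) :
  finite_set D -> (forall i, sigma_of (X (g i)) (B i)) ->
  sigma_of_family X (\bigcap_(i in D) B i).
Proof.
move=> fD sB.
apply: (@fin_bigcap_measurable _ (g_sigma_algebraType (\bigcup_j sigma_of (X j)))) => //.
by move=> i _; apply: sub_sigma_algebra; exists (g i).
Qed.

Lemma identically_distributed_cexp (X : nat -> {RV P >-> R}) k s :
  identically_distributed P (fun k => X k : Omega -> R) ->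
  cexp P (fun w => s * X k w) = char_fun P (X 0%N) s.
Proof.
move=> idX; rewrite char_funE.
have eqd (f : R -> R) : bounded_rv f ->
    \int[P]_w f (X k w) = \int[P]_w f (X 0%N w).
  move=> bf; have [mf _] := bf.
  have step j : \int[P]_w f (X j w) = fine (\int[distribution P (X j)]_y (f y)%:E)%E.
    congr fine; rewrite integral_distribution//; first exact/measurable_EFinP.
    have b : bounded_rv (f \o X j).
      by case: bf => _ [C fC]; split; [exact: measurableT_comp|exists C => w; exact: fC].
    exact: (bounded_rv_integrable P b).
  rewrite !step; congr fine; apply: eq_measure_integral => B mB _.
  exact: idX.
have mM : measurable_fun setT (fun y : R => s * y) by exact: measurable_funM.
rewrite /cexp; congr (_ +i* _)%C.
  exact: (eqd (fun y => cos (s * y)) (bounded_rv_cos mM)).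
exact: (eqd (fun y => sin (s * y)) (bounded_rv_sin mM)).
Qed.

End independence_lemmas.

Section partial_sums.
Context (R : realType) (d : measure_display) (E : measurableType d).
Context d1 (Omega : measurableType d1) (P : probability Omega R).
Context (N : nat -> Omega -> point_measure E R) (eps : nat -> {RV P >-> R}).
Hypothesis mN : forall k, measurable_fun setT (N k).
Hypothesis N_indep : independent_family P N.
Hypothesis eps_indep : independent_family P (fun k => eps k : Omega -> R).
Hypothesis eps_id : identically_distributed P (fun k => eps k : Omega -> R).
Hypothesis eps_N : independent_systems P
  (sigma_of_family (fun k => eps k : Omega -> R)) (sigma_of_family N).
Context (n : nat) (A : 'I_n -> set E) (theta : 'I_n -> R).
Hypothesis mA : forall i, measurable (A i).

Definition parity_prob k (J : {set 'I_n}) : R := fine (P (N k @^-1` parity_set A J)).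

Definition parity_pattern k w : {set 'I_n} := [set i | odd_countb (N k w) (A i)]%SET.

Let mNJ k J : measurable (N k @^-1` parity_set A J).
Proof. by rewrite -[_ @^-1` _]setTI; apply: mN => //; exact: measurable_parity_set. Qed.

Lemma parity_patternP k w J : (parity_set A J) (N k w) <-> parity_pattern k w = J.
Proof.
split=> [h|<- i]; last by rewrite inE.
by apply/setP => i; rewrite inE h.
Qed.

(** On the event [G f] that the k-th pattern is f k for all k < m, the sum is a linear combination
    of the variables with constant coefficients. Its integral factorizes, and distributivity turns
    the sum over all f back into a product of sums. *)
Lemma cexp_partial_sum m :
  cexp P (fun w => \sum_(k < m) eps k w * subset_sum theta (parity_pattern k w)) =
  \prod_(k < m) \sum_J char_fun P (eps 0%N) (subset_sum theta J) * (parity_prob k J)%:C%C.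
Proof.
pose G (f : {ffun 'I_m -> {set 'I_n}}) : set Omega :=
  \bigcap_(k in [set` index_enum 'I_m]) N k @^-1` parity_set A (f k).
have mG f : measurable (G f) by apply: fin_bigcap_measurable => // k _; exact: mNJ.
have Nind := independent_family_inj (@ord_inj m) N_indep.
have eind := independent_family_inj (@ord_inj m) eps_indep.
have PG f : fine (P (G f)) = \prod_(k < m) parity_prob k (f k).
  rewrite (Nind _ (fun k => N k @^-1` parity_set A (f k)) (index_enum_uniq _)).
    rewrite (eq_bigr (fun k : 'I_m => (parity_prob k (f k))%:E)) ?prodEFin//.
    by move=> k _; rewrite /parity_prob fineK// fin_num_measure.
  by move=> k _; exists (parity_set A (f k)); [exact: measurable_parity_set|rewrite setTI].
pose X (f : {ffun 'I_m -> {set 'I_n}}) (k : 'I_m) w := subset_sum theta (f k) * eps k w.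
have mX f k : measurable_fun setT (X f k) by exact: measurable_funM.
have XG f := @indep_cexp_sum _ _ _ P _ (index_enum 'I_m) (X f) (G f)
  (\prod_(k < m) parity_prob k (f k)) (index_enum_uniq _) (mX f) (mG f).
have {}XG f : \int[P]_w (cos (\sum_(k < m) X f k w) * \1_(G f) w) =
    complex.Re (\prod_(k < m) cexp P (X f k)) * \prod_(k < m) parity_prob k (f k) /\
  \int[P]_w (sin (\sum_(k < m) X f k w) * \1_(G f) w) =
    complex.Im (\prod_(k < m) cexp P (X f k)) * \prod_(k < m) parity_prob k (f k).
  apply: XG => B mB; rewrite eps_N.
  - rewrite fineM ?fin_num_measure//; last first.
      apply: fin_bigcap_measurable => // k _.
      by rewrite -[_ @^-1` _]setTI; exact: mX.
    rewrite PG; congr (_ * _).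
    have iX := independent_family_scale (a := fun k => subset_sum theta (f k)) eind.
    rewrite (iX _ (fun k => X f k @^-1` B k) (index_enum_uniq _)).
      rewrite (eq_bigr (fun k : 'I_m => (fine (P (X f k @^-1` B k)))%:E)) ?prodEFin//.
      move=> k _; rewrite fineK// fin_num_measure//.
      by rewrite -[_ @^-1` _]setTI; exact: mX.
    by move=> k _; exists (B k) => //; rewrite setTI.
  - apply: (sigma_of_family_bigcap (g := @nat_of_ord m)) => // k.
    exists ((fun x => subset_sum theta (f k) * x) @^-1` B k); last by rewrite setTI.
    by rewrite -[_ @^-1` _]setTI; apply: mulrl_measurable.
  - apply: (sigma_of_family_bigcap (g := @nat_of_ord m)) => // k.
    exists (parity_set A (f k)); last by rewrite setTI.
    exact: measurable_parity_set.
pose f0 w : {ffun 'I_m -> {set 'I_n}} := [ffun k : 'I_m => parity_pattern k w].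
have G0 w f : \1_(G f) w = (f == f0 w)%:R :> R.
  rewrite indicE; congr ((nat_of_bool _)%:R); apply/idP/eqP.
    rewrite inE => h; apply/ffunP => k; rewrite ffunE; apply/esym/parity_patternP.
    by apply: h; rewrite /= mem_index_enum.
  by move=> ->; rewrite inE => k _ /=; rewrite ffunE; exact/parity_patternP.
have decomp (h : R -> R) w :
    h (\sum_(k < m) eps k w * subset_sum theta (parity_pattern k w)) =
    \sum_f h (\sum_(k < m) X f k w) * \1_(G f) w.
  rewrite [RHS](bigD1 (f0 w))//= [X in _ + X]big1 ?addr0 => [|f ff0]; last first.
    by rewrite G0 (negbTE ff0) mulr0.
  rewrite G0 eqxx mulr1; congr h; apply: eq_bigr => k _.
  by rewrite /X ffunE mulrC.
have mS f : measurable_fun setT (fun w => \sum_(k < m) X f k w) by exact: measurable_sum.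
have b1 f : bounded_rv (\1_(G f) : Omega -> R) by exact: bounded_rv_indic.
rewrite bigA_distr_bigA/= /cexp.
under eq_Rintegral do rewrite decomp.
under [X in (_ +i* X)%C]eq_Rintegral do rewrite decomp.
rewrite !Rint_sum; last 2 first.
- by move=> f _; apply: bounded_rvM => //; exact: bounded_rv_sin.
- by move=> f _; apply: bounded_rvM => //; exact: bounded_rv_cos.
rewrite (eq_bigr (fun f : {ffun 'I_m -> {set 'I_n}} =>
  (\int[P]_w (cos (\sum_(k < m) X f k w) * \1_(G f) w) +i*
   \int[P]_w (sin (\sum_(k < m) X f k w) * \1_(G f) w))%C)); last first.
  move=> f _; rewrite big_split/= -rmorph_prod (XG f).1 (XG f).2.
  rewrite (eq_bigr (fun k : 'I_m => cexp P (X f k))); last first.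
    by move=> k _; rewrite identically_distributed_cexp.
  by case: (\prod_(k < m) cexp P (X f k)) => a b; rewrite /real_complex_def; simpc.
by elim/big_rec3: _ => // f a b c _ <-; simpc.
Qed.

End partial_sums.

Section measurable_limn.
Context d (T : measurableType d) (R : realType).

Lemma cvg_limn_esup_einf (u : (\bar R)^nat) :
  limn_esup u = limn_einf u -> u @ \oo --> limn_esup u.
Proof.
move=> ul; apply: (@squeeze_cvge _ _ _ _ (einfs u) _ (esups u)).
- apply: nearW => n; apply/andP; split.
    by apply: ereal_inf_lbound; exists n => /=.
  by apply: ereal_sup_ubound; exists n => /=.
- by rewrite ul limn_einf_lim; exact: is_cvg_einfs.
- by rewrite limn_esup_lim; exact: is_cvg_esups.
Qed.

(* Where the sequence does not converge, limn is the junk value point. *)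
Lemma measurable_limn (h : nat -> T -> R) :
  (forall n, measurable_fun setT (h n)) ->
  measurable_fun setT (fun x => limn (h ^~ x)).
Proof.
move=> mh.
pose s x := limn_esup (fun n => (h n x)%:E).
pose i x := limn_einf (fun n => (h n x)%:E).
have ms : measurable_fun setT s.
  by apply: measurable_fun_limn_esup => n; exact/measurable_EFinP.
have mi : measurable_fun setT i.
  rewrite (_ : i = fun x => - limn_esup (fun n => (- h n x)%:E))%E.
    apply/measurableT_comp => //; apply: measurable_fun_limn_esup => n.
    by apply/measurable_EFinP; exact: measurable_funN.
  apply/funext => x; rewrite -[RHS]limn_einfN; congr limn_einf.
  by apply/funext => n /=; rewrite opprK.
rewrite (_ : (fun x => _) =
    (fun x => if (s x == i x) && (s x \is a fin_num) then fine (s x) else point)).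
  apply: measurable_fun_ifT => //; last exact: measurableT_comp.
  apply: measurable_and; first exact: measurable_fun_eqe.
  apply: (measurable_fun_bool true) => //=.
  rewrite [X in measurable X](_ : _ = setT `&` [set x | s x \is a fin_num]).
    exact: emeasurable_fin_num.
  by [].
apply/funext => x; case: ifPn => [/andP[/eqP si fs]|ns].
  apply/cvg_lim => //.
  have := cvg_limn_esup_einf si; rewrite -/(s x) -[X in _ --> X -> _](fineK fs).
  by move=> /fine_cvgP[_].
apply: dvgP => /cvg_ex[l hl]; move/negP: ns; apply.
have hE : (fun n => (h n x)%:E) @ \oo --> l%:E by apply/fine_cvgP; split => //; exact: nearW.
have [-> ->] : s x = l%:E /\ i x = l%:E; last by rewrite eqxx.
have := cvg_limn_einf_sup hE.
rewrite /s /i is_cvg_limn_esupE ?is_cvg_limn_einfE; [|by apply/cvg_ex; exists l%:E..].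
by rewrite (cvg_lim _ hE).
Qed.

End measurable_limn.

Section odd_sum.
Context (R : realType) (d : measure_display) (E : measurableType d).
Context d1 (Omega : measurableType d1) (P : probability Omega R).
Context (N : nat -> Omega -> point_measure E R) (eps : nat -> {RV P >-> R}).
Hypothesis mN : forall k, measurable_fun setT (N k).
Context (A : set E).
Hypothesis mA : measurable A.

Let mO k : measurable [set w | odd_count (N k w) A].
Proof.
rewrite -[[set _ | _]]setTI.
exact: (mN k measurableT (measurable_odd_count mA)).
Qed.

Definition odd_term k w : R := eps k w * \1_[set w' | odd_count (N k w') A] w.

Lemma measurable_odd_term k : measurable_fun setT (odd_term k).
Proof. by apply: measurable_funM => //; exact: measurable_indic. Qed.

Lemma measurable_odd_sum : measurable_fun setT (odd_sum eps N A).
Proof.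
by apply: measurable_limn => m; apply: measurable_sum => k; exact: measurable_odd_term.
Qed.

(** By Borel-Cantelli almost surely only finitely many counts are odd, so the series is eventually
    constant and [limn] is its genuine limit. *)
Lemma ae_cvg_odd_sum :
  (\sum_(k <oo) P [set w | odd_count (N k w) A] < +oo)%E ->
  {ae P, forall w, series (fun k => odd_term k w) @ \oo --> odd_sum eps N A w}.
Proof.
move=> sP; have P0 := lim_sup_set_cvg0 mO sP.
exists (lim_sup_set (fun k => [set w | odd_count (N k w) A])); split => //.
  apply: bigcap_measurable => // m _; apply: bigcup_measurable => k _; exact: mO.
move=> w /= nw; apply: contrapT => /existsNP[m /not_implyP[_ nm]]; apply: nw.
have fin k : (m <= k)%N -> odd_term k w = 0.
  move=> mk; rewrite /odd_term indicE memNset ?mulr0// => ok; apply: nm.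
  by exists k.
suff : cvgn (series (fun k => odd_term k w)) by [].
apply/cvg_ex; exists (series (fun k => odd_term k w) m).
apply: cvg_near_cst; near=> k.
have mk : (m <= k)%N by near: k; exact: nbhs_infty_ge.
rewrite /series/= (big_cat_nat (leq0n m) mk)/= [X in _ + X]big_nat_cond.
by rewrite [X in _ + X]big1 ?addr0// => j /andP[/andP[mj _] _]; exact: fin.
Unshelve. all: by end_near. Qed.

End odd_sum.

Lemma cvg_sumr (R : realType) (T I : Type) (F : set_system T) (r : seq I) (Q : pred I)
    (f : I -> T -> R) (l : I -> R) : Filter F ->
  (forall i, Q i -> f i x @[x --> F] --> l i) ->
  \sum_(i <- r | Q i) f i x @[x --> F] --> \sum_(i <- r | Q i) l i.
Proof.
move=> FF fl; elim: r => [|i r IH].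
  by rewrite big_nil; under eq_cvg do rewrite big_nil; exact: cvg_cst.
rewrite big_cons; under eq_cvg do rewrite big_cons.
by case: ifPn => // Qi; apply: cvgD => //; exact: fl.
Qed.

Section complex_modulus.
Context (R : realType).
Implicit Types (x y z : R[i]).

(** The norm of [R[i]] is itself an element of [R[i]]; limits and linear arithmetic are carried out
    in R. *)
Definition cmod z : R := complex.Re `|z|.

Lemma cmodE z : `|z| = (cmod z)%:C%C.
Proof. by rewrite /cmod normc_def. Qed.

Lemma cmod_ge0 z : 0 <= cmod z.
Proof. by rewrite -lecR -cmodE normr_ge0. Qed.

Lemma cmodD x y : cmod (x + y) <= cmod x + cmod y.
Proof. by rewrite -lecR rmorphD/= -!cmodE ler_normD. Qed.

Lemma cmodM x y : cmod (x * y) = cmod x * cmod y.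
Proof. by apply: (@complexI R); rewrite rmorphM/= -!cmodE normrM. Qed.

Lemma cmodN x : cmod (- x) = cmod x.
Proof. by rewrite /cmod normrN. Qed.

Lemma cmodB x y : cmod (x - y) <= cmod x + cmod y.
Proof. by rewrite (le_trans (cmodD _ _))// cmodN. Qed.

Lemma cmod_real (a : R) : cmod a%:C%C = `|a|.
Proof. by rewrite /cmod normc_def/= expr0n/= addr0 sqrtr_sqr. Qed.

Lemma cmod_sum (I : Type) (s : seq I) (Q : pred I) (z : I -> R[i]) :
  cmod (\sum_(i <- s | Q i) z i) <= \sum_(i <- s | Q i) cmod (z i).
Proof.
elim/big_rec2: _ => [|i a b _ ab]; first by rewrite /cmod normr0.
by rewrite (le_trans (cmodD _ _))// lerD2l.
Qed.

Lemma cmod_le_ReIm z : cmod z <= `|complex.Re z| + `|complex.Im z|.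
Proof.
case: z => a b; rewrite /cmod normc_def/= -[leRHS]ger0_norm ?addr_ge0//.
rewrite -sqrtr_sqr ler_wsqrtr// sqrrD !real_normK ?num_real// lerD2r lerDl.
by rewrite mulrn_wge0// mulr_ge0.
Qed.

Lemma Re_le_cmod z : `|complex.Re z| <= cmod z.
Proof.
case: z => a b; rewrite /cmod normc_def/= -sqrtr_sqr ler_wsqrtr// lerDl sqr_ge0//.
Qed.

Lemma Im_le_cmod z : `|complex.Im z| <= cmod z.
Proof.
case: z => a b; rewrite /cmod normc_def/= -sqrtr_sqr ler_wsqrtr// lerDr sqr_ge0//.
Qed.

(** Factors are exchanged one at a time; all others have modulus at most 1, so the errors just add
    up. *)
Lemma cmod_prodB (a b : nat -> R[i]) m :
  (forall k, cmod (a k) <= 1) -> (forall k, cmod (b k) <= 1) ->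
  cmod (\prod_(k < m) a k - \prod_(k < m) b k) <= \sum_(k < m) cmod (a k - b k).
Proof.
move=> a1 b1; elim: m => [|m IH].
  by rewrite !big_ord0 subrr /cmod normr0.
have pb : cmod (\prod_(k < m) b k) <= 1.
  elim: m {IH} => [|m IH]; first by rewrite big_ord0 /cmod normr1.
  by rewrite big_ord_recr/= cmodM -[leRHS]mulr1 ler_pM ?cmod_ge0.
rewrite !big_ord_recr/=.
set pa := \prod_(k < m) a k in IH *; set qb := \prod_(k < m) b k in IH pb *.
have -> : pa * a m - qb * b m = (pa - qb) * a m + qb * (a m - b m) by ring.
rewrite (le_trans (cmodD _ _))// !cmodM lerD//.
  by rewrite -[leRHS]mulr1 ler_pM ?cmod_ge0.
by rewrite ler_piMl ?cmod_ge0.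
Qed.

(** The upper bound on exp(-y) is 1 / (1 + y) <= 1 - y + y^2, which holds because (1 - y + y^2)(1 +
    y) = 1 + y^3. *)
Lemma expRN_taylor1 (y : R) : 0 <= y -> `|1 - y - expR (- y)| <= y ^+ 2.
Proof.
move=> y0; have h1 : 1 - y <= expR (- y) by exact: expR_ge1Dx.
have h2 : expR (- y) <= 1 - y + y ^+ 2.
  rewrite expRN; apply: (@le_trans _ _ (1 + y)^-1).
    rewrite lef_pV2 ?posrE ?expR_gt0 ?expR_ge1Dx//.
    by rewrite (lt_le_trans ltr01)// lerDl.
  rewrite -[leLHS]mul1r ler_pdivrMr; last by rewrite (lt_le_trans ltr01)// lerDl.
  rewrite (_ : _ * (1 + y) = 1 + y ^+ 3); last by ring.
  by rewrite lerDl exprn_ge0.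
by rewrite ler_norml; apply/andP; split; lra.
Qed.

End complex_modulus.

(** * Comparison with an exponential at a fixed intensity *)

Section prelimit.
Context (R : realType) (d : measure_display) (E : measurableType d).
Context (mu : {measure set E -> \bar R}).
Context d1 (Omega : measurableType d1) (P : probability Omega R).
Context (N : nat -> Omega -> point_measure E R) (eps : nat -> {RV P >-> R}).
Context (lam : nat -> R).
Hypothesis lam0 : forall k, 0 < lam k.
Hypothesis NP : forall k, poisson_point_process P (N k) (fun A => ((lam k)%:E * mu A)%E).
Hypothesis N_indep : independent_family P N.
Hypothesis eps_indep : independent_family P (fun k => eps k : Omega -> R).
Hypothesis eps_id : identically_distributed P (fun k => eps k : Omega -> R).
Hypothesis eps_N : independent_systems P
  (sigma_of_family (fun k => eps k : Omega -> R)) (sigma_of_family N).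
Context (n : nat) (A : 'I_n -> set E).
Hypothesis mA : forall i, measurable (A i).
Hypothesis fA : forall i, (mu (A i) < +oo)%E.
Implicit Types (J K : {set 'I_n}).
Let mass K : R := fine (mu (symdiff A K)).
Let mN k : measurable_fun setT (N k). Proof. by case: (NP k). Qed.
Hypothesis sumK : forall K,
  (\sum_(k <oo) (1 - expR (- (2 * mass K * lam k)))%:E < +oo)%E.
Hypothesis sumA : forall i,
  (\sum_(k <oo) (1 - expR (- (2 * fine (mu (A i)) * lam k)))%:E < +oo)%E.

Definition parity_total J : R := \sum_K parity_coef R J K *
  fine (\sum_(k <oo) (1 - expR (- (2 * mass K * lam k)))%:E)%E.

Let q := parity_prob P N A.

Lemma parity_prob_ge0 k J : 0 <= q k J.
Proof. exact: fine_ge0. Qed.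

Lemma sum_parity_prob k : \sum_J q k J = 1.
Proof.
have mNJ J : measurable (N k @^-1` parity_set A J).
  by rewrite -[_ @^-1` _]setTI; apply: mN => //; exact: measurable_parity_set.
rewrite /q /parity_prob.
transitivity (\int[P]_w (\sum_J \1_(N k @^-1` parity_set A J) w : R)).
  rewrite Rint_sum; last by move=> J _; exact: bounded_rv_indic.
  by apply: eq_bigr => J _; rewrite Rint_indic.
rewrite -[RHS](Rint_cst P); apply: eq_Rintegral => w _.
rewrite (bigD1 (parity_pattern N A k w))//= big1 ?addr0 => [|J JJ].
  by rewrite indicE mem_set//; exact/parity_patternP.
rewrite indicE memNset// => /parity_patternP => JE; move/eqP: JJ; apply.
exact/esym.
Qed.

Lemma cvg_parity_total J : J != finset.set0 -> series (q ^~ J) @ \oo --> parity_total J.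
Proof.
move=> J0.
have qE k : q k J = \sum_K parity_coef R J K * (1 - expR (- (2 * mass K * lam k))).
  rewrite /q /parity_prob (prob_scaled_parity_set (lam0 k) (NP k) mA fA J0).
  by apply: eq_bigr => K _; congr (_ * (1 - expR (- _))); rewrite /mass; ring.
have -> : series (q ^~ J) = fun m => \sum_K parity_coef R J K *
    series (fun k => 1 - expR (- (2 * mass K * lam k))) m.
  apply/funext => m; rewrite /series/=.
  under eq_bigr do rewrite qE.
  by rewrite exchange_big/=; apply: eq_bigr => K _; rewrite mulr_sumr.
apply: cvg_sumr => K _; apply: cvgM; first exact: cvg_cst.
apply: cvg_series_nneseries => // k.
rewrite subr_ge0 expR_le1 oppr_le0 mulr_ge0// ?(ltW (lam0 k))// mulr_ge0//.
exact: fine_ge0.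
Qed.

Lemma series_parity_le J m : J != finset.set0 -> \sum_(k < m) q k J <= parity_total J.
Proof.
move=> J0; have c := cvg_parity_total J0.
rewrite -(cvg_lim _ c)// -(big_mkord xpredT (q ^~ J)).
apply: (nondecreasing_cvgn_le (u_ := series (q ^~ J))); last exact: cvgP c.
by apply/nondecreasing_seqP => k; rewrite /series/= big_nat_recr//= lerDl parity_prob_ge0.
Qed.

Lemma ae_cvg_odd_sums : {ae P, forall w, forall i,
  series (fun k => odd_term N eps (A i) k w) @ \oo --> odd_sum (fun k => eps k) N (A i) w}.
Proof.
apply: filter_forall => i; apply: ae_cvg_odd_sum => //.
apply: le_lt_trans (sumA i); apply: lee_nneseries => // k _.
have mO : measurable (N k @^-1` [set m | odd_count m (A i)]).
  by rewrite -[_ @^-1` _]setTI; apply: mN => //; exact: measurable_odd_count.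
rewrite -[P _]fineK; last exact: fin_num_measure.
rewrite (prob_scaled_odd_count (lam0 k) (NP k) (mA i) (fA i)) lee_fin.
set e := expR _; set e' := expR _.
have -> : e = e' by rewrite /e /e'; congr expR; ring.
have : e' <= 1.
  rewrite expR_le1 oppr_le0; apply: mulr_ge0; last exact: ltW.
  by apply: mulr_ge0 => //; exact: fine_ge0.
by move=> ?; lra.
Qed.

Context (theta : 'I_n -> R) (tau : {set 'I_n} -> R).
Hypothesis tau0 : forall J, 0 <= tau J.
Let phi J : R[i] := char_fun P (eps 0%N) (subset_sum theta J).
Let odd_comb w := dotp theta ((fun i => odd_sum (fun k => eps k) N (A i)) ^~ w).
Let partial m w := \sum_(k < m) eps k w * subset_sum theta (parity_pattern N A k w).

Definition char_gap J : R := cmod (1 - phi J - (tau J)%:C%C).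
(** The gaps come from replacing 1 - phi by tau, the square from replacing 1 - y by exp(-y). Both
    are summed over k through the probability of a nonempty pattern, whence the last factor. [tau]
    is arbitrary, so that the bound serves the limit and, with tau = 0, tightness. *)
Definition char_error : R :=
  (\sum_(J | J != finset.set0) char_gap J + (\sum_(J | J != finset.set0) tau J) ^+ 2) *
  \sum_(J | J != finset.set0) parity_total J.

Let a k : R[i] := \sum_J phi J * (q k J)%:C%C.
Let y k : R := \sum_(J | J != finset.set0) tau J * q k J.
Let Q k : R := \sum_(J | J != finset.set0) q k J.

Let y0 k : 0 <= y k.
Proof. by apply: sumr_ge0 => J _; rewrite mulr_ge0// parity_prob_ge0. Qed.

Let Q01 k : 0 <= Q k <= 1.
Proof.
apply/andP; split; first by apply: sumr_ge0 => J _; exact: parity_prob_ge0.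
by rewrite -(sum_parity_prob k) [leRHS](bigD1 finset.set0)//= lerDr parity_prob_ge0.
Qed.

Let phi0 : phi finset.set0 = 1.
Proof.
rewrite /phi /subset_sum big_set0 char_funE /cexp.
under eq_Rintegral do rewrite mul0r cos0.
under [X in (_ +i* X)%C]eq_Rintegral do rewrite mul0r sin0.
by rewrite !Rint_cst.
Qed.

Let a1 k : cmod (a k) <= 1.
Proof.
rewrite (le_trans (cmod_sum _ _ _))// -(sum_parity_prob k); apply: ler_sum => J _.
rewrite cmodM cmod_real ger0_norm ?parity_prob_ge0// ler_piMl ?parity_prob_ge0//.
rewrite -lecR -cmodE /phi char_funE norm_cexp_le1//.
exact: measurable_funM.
Qed.

Let exp1 k : cmod (expR (- y k))%:C%C <= 1.
Proof. by rewrite cmod_real ger0_norm ?expR_ge0// expR_le1 oppr_le0. Qed.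

(** The quadratic error keeps a single factor [Q k]: y <= (sum tau) Q, and Q^2 <= Q since Q is a
    probability. Linearity in Q makes the sum over k finite. *)
Let term_gap k : cmod (a k - (expR (- y k))%:C%C) <=
  (\sum_(J | J != finset.set0) char_gap J + (\sum_(J | J != finset.set0) tau J) ^+ 2) * Q k.
Proof.
have -> : a k - (expR (- y k))%:C%C =
    (1 - y k - expR (- y k))%:C%C -
    \sum_(J | J != finset.set0) (1 - phi J - (tau J)%:C%C) * (q k J)%:C%C.
  have -> : a k = 1 - \sum_(J | J != finset.set0) (1 - phi J) * (q k J)%:C%C.
    transitivity (\sum_J (q k J)%:C%C -
        \sum_(J | J != finset.set0) (1 - phi J) * (q k J)%:C%C); last first.
      by rewrite -rmorph_sum sum_parity_prob rmorph1.
    rewrite /a (bigD1 finset.set0)//= [X in _ = X - _](bigD1 finset.set0)//= phi0 mul1r.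
    by rewrite -addrA; congr (_ + _); rewrite -sumrB; apply: eq_bigr => J _; ring.
  under [in RHS]eq_bigr do rewrite mulrBl.
  rewrite sumrB !rmorphB rmorph1 /y rmorph_sum.
  under [in RHS]eq_bigr do rewrite rmorphM.
  by rewrite /=; ring.
rewrite (le_trans (cmodB _ _))// addrC mulrDl lerD//.
  rewrite (le_trans (cmod_sum _ _ _))// mulr_suml; apply: ler_sum => J J0.
  rewrite cmodM cmod_real ger0_norm ?parity_prob_ge0// ler_wpM2l ?cmod_ge0//.
  by rewrite /Q (bigD1 J)//= lerDl sumr_ge0// => K _; exact: parity_prob_ge0.
rewrite cmod_real (le_trans (expRN_taylor1 (y0 k)))//.
set t := \sum_(J | _) tau J.
have t0 : 0 <= t by apply: sumr_ge0.
have yt : y k <= t * Q k.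
  rewrite /y /t mulr_suml; apply: ler_sum => J J0; rewrite ler_wpM2l//.
  by rewrite /Q (bigD1 J)//= lerDl sumr_ge0// => K _; exact: parity_prob_ge0.
have /andP[Q0 Q1] := Q01 k.
apply: (@le_trans _ _ ((t * Q k) ^+ 2)).
  by rewrite ler_pXn2r ?nnegrE ?mulr_ge0.
by rewrite exprMn ler_wpM2l ?exprn_ge0// expr2 ler_piMl.
Qed.

Lemma partial_odd_comb m w :
  partial m w = dotp theta ((fun i => series (fun k => odd_term N eps (A i) k w) m)).
Proof.
rewrite /partial /dotp /series/=.
under [RHS]eq_bigr do rewrite mulr_sumr.
rewrite exchange_big/= big_mkord; apply: eq_bigr => k _.
rewrite /subset_sum mulr_sumr big_mkcond/=; apply: eq_bigr => i _.
rewrite /odd_term indicE /parity_pattern inE.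
have -> : odd_countb (N k w) (A i) = (w \in [set w' | odd_count (N k w') (A i)]).
  by apply/asboolP/idP; rewrite inE.
by case: (w \in _); rewrite ?mulr1 ?mulr0// mulrC.
Qed.

(** The estimate for the first m terms is uniform in m. Almost sure convergence of the partial sums
    and dominated convergence for cosine and sine carry it to the full sum. *)
Lemma cexp_odd_comb_bound :
  cmod (cexp P odd_comb -
    (expR (- \sum_(J | J != finset.set0) tau J * parity_total J))%:C%C) <= char_error.
Proof.
have bound m : cmod (cexp P (partial m) - (expR (- \sum_(k < m) y k))%:C%C) <= char_error.
  rewrite (cexp_partial_sum mN N_indep eps_indep eps_id eps_N theta mA m).
  have -> : (expR (- \sum_(k < m) y k))%:C%C = \prod_(k < m) (expR (- y k))%:C%C.
    by rewrite -rmorph_prod -expR_sum sumrN.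
  rewrite (le_trans (cmod_prodB m a1 exp1))//.
  apply: (@le_trans _ _ (\sum_(k < m) (\sum_(J | J != finset.set0) char_gap J +
      (\sum_(J | J != finset.set0) tau J) ^+ 2) * Q k)).
    by apply: ler_sum => k _; exact: term_gap.
  rewrite -mulr_sumr.
  rewrite ler_wpM2l//.
    rewrite addr_ge0 ?exprn_ge0 ?sumr_ge0// => J _; exact: cmod_ge0.
  rewrite exchange_big/=; apply: ler_sum => J J0; exact: series_parity_le.
have mt k i : measurable_fun setT (odd_term N eps (A i) k) by exact: measurable_odd_term.
have mP m : measurable_fun setT (partial m).
  rewrite (_ : partial m = fun w => dotp theta
    ((fun i w => series (fun k => odd_term N eps (A i) k w) m) ^~ w)).
    by apply: measurable_dotp => i; apply: measurable_sum => k.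
  by apply/funext => w; rewrite partial_odd_comb.
have mO : measurable_fun setT odd_comb.
  by apply: measurable_dotp => i; exact: measurable_odd_sum.
have cP : {ae P, forall w, partial m w @[m --> \oo] --> odd_comb w}.
  apply: filterS ae_cvg_odd_sums => w h.
  under eq_cvg do rewrite partial_odd_comb.
  by apply: cvg_sumr => i _; apply: cvgM; [exact: cvg_cst|exact: h].
have cRe : complex.Re (cexp P (partial m)) @[m --> \oo] --> complex.Re (cexp P odd_comb).
  apply: (@Rint_dominated_cvg _ _ _ _ _ _ 1).
  - by move=> m; case: (bounded_rv_cos (mP m)).
  - by case: (bounded_rv_cos mO).
  - by move=> m w; exact: cos_max.
  - apply: filterS cP => w h; apply: (cvg_comp _ _ h); exact: continuous_cos.
have cIm : complex.Im (cexp P (partial m)) @[m --> \oo] --> complex.Im (cexp P odd_comb).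
  apply: (@Rint_dominated_cvg _ _ _ _ _ _ 1).
  - by move=> m; case: (bounded_rv_sin (mP m)).
  - by case: (bounded_rv_sin mO).
  - by move=> m w; exact: sin_max.
  - apply: filterS cP => w h; apply: (cvg_comp _ _ h); exact: continuous_sin.
have cy : expR (- \sum_(k < m) y k) @[m --> \oo] -->
    expR (- \sum_(J | J != finset.set0) tau J * parity_total J).
  have : \sum_(k < m) y k @[m --> \oo] --> \sum_(J | J != finset.set0) tau J * parity_total J.
    rewrite (_ : (fun m => _) = (fun m => \sum_(J | J != finset.set0) tau J * series (q ^~ J) m)).
      apply: cvg_sumr => J J0; apply: cvgM; [exact: cvg_cst|exact: cvg_parity_total].
    apply/funext => m; rewrite exchange_big/=; apply: eq_bigr => J _.
    by rewrite /series/= big_mkord mulr_sumr.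
  by move=> /cvgN h; apply: (cvg_comp _ _ h); exact: continuous_expR.
apply/ler_addgt0Pr => e e0.
have e3 : 0 < e / 3 by rewrite divr_gt0.
have /cvgrPdist_le/(_ _ e3) hR := cRe.
have /cvgrPdist_le/(_ _ e3) hI := cIm.
have /cvgrPdist_le/(_ _ e3) hy := cy.
have [m [[mR mI] my]] : exists m, (`|complex.Re (cexp P odd_comb) - complex.Re (cexp P (partial m))| <= e / 3
  /\ `|complex.Im (cexp P odd_comb) - complex.Im (cexp P (partial m))| <= e / 3) /\
  `|expR (- \sum_(J | J != finset.set0) tau J * parity_total J) - expR (- \sum_(k < m) y k)| <= e / 3.
  have [m mm] := filter_ex (filterI (filterI hR hI) hy); by exists m.
set B := expR _ in my *; set b := expR (- \sum_(k < m) y k) in my.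
have -> : cexp P odd_comb - B%:C%C = (cexp P odd_comb - cexp P (partial m)) +
   (cexp P (partial m) - b%:C%C) + (b - B)%:C%C by rewrite rmorphB/=; ring.
rewrite (le_trans (cmodD _ _))//.
have h1 : cmod (cexp P odd_comb - cexp P (partial m)) <= e / 3 + e / 3.
  by rewrite (le_trans (cmod_le_ReIm _))// lerD.
have h2 := cmodD (cexp P odd_comb - cexp P (partial m)) (cexp P (partial m) - b%:C%C).
have h3 := bound m.
have h4 : cmod (b - B)%:C%C <= e / 3 by rewrite cmod_real distrC.
by move: h1 h2 h3 h4; rewrite -/b => h1 h2 h3 h4; lra.
Qed.

End prelimit.

Section char_asymptotics.
Context (R : realType) (alpha sigma : R) (phi : R -> R[i]).
Hypothesis alpha0 : 0 < alpha.
Hypothesis sigma0 : 0 < sigma.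
Hypothesis phi_ratio :
  (((1 - phi theta) / (sigma `^ alpha * `|theta| `^ alpha)%:C%C : R[i]^o)
     @[theta --> (0 : R)^'] --> (1 : R[i]^o)).
Hypothesis phi0 : phi 0 = 1.

(** The ratio is known only away from theta = 0; multiplying out gives a bound that also holds at 0,
    where some subset sums lie. *)
Lemma char_gap_small e : 0 < e -> exists2 eta : R, 0 < eta &
  forall theta, `|theta| < eta ->
    cmod (1 - phi theta - (sigma `^ alpha * `|theta| `^ alpha)%:C%C) <=
      e * (sigma `^ alpha * `|theta| `^ alpha).
Proof.
move=> e0; have eC : (0 : R[i]) < e%:C%C by rewrite ltcR.
have /cvgrPdist_le/(_ _ eC) := phi_ratio.
move=> /nbhs_ballP[eta /= eta0 he]; exists eta => // theta th.
have [->|t0] := eqVneq theta 0.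
  by rewrite phi0 subrr normr0 powR0 ?gt_eqF// mulr0 sub0r oppr0 mulr0 /cmod normr0.
have := he theta; rewrite /ball/= sub0r normrN => /(_ th t0).
set tau := sigma `^ alpha * `|theta| `^ alpha.
have tau0 : 0 < tau by rewrite mulr_gt0 ?powR_gt0// normr_gt0.
have tauC : tau%:C%C != 0 :> R[i] by rewrite -(rmorph0 (real_complex R)) (inj_eq (@complexI R)) gt_eqF.
rewrite cmodE lecR => h.
have -> : 1 - phi theta - tau%:C%C = - (tau%:C%C * (1 - (1 - phi theta) / tau%:C%C)).
  by field.
by rewrite cmodN cmodM cmod_real gtr0_norm// mulrC ler_wpM2r// ltW.
Qed.

(** Near 0 the asymptotics apply. For |theta| >= eta the trivial bound 2 is at most 2 (|theta| /
    eta)^alpha. *)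
Lemma char_global_bound : (forall theta, cmod (phi theta) <= 1) ->
  exists2 C : R, 0 <= C & forall theta, cmod (1 - phi theta) <= C * `|theta| `^ alpha.
Proof.
move=> phi1; have [eta eta0 h] := char_gap_small ltr01.
pose C1 := 2 * sigma `^ alpha; pose C2 := 2 * eta^-1 `^ alpha.
have C10 : 0 <= C1 by rewrite mulr_ge0 ?powR_ge0.
have C20 : 0 <= C2 by rewrite mulr_ge0 ?powR_ge0.
exists (C1 + C2); first by rewrite addr_ge0.
move=> theta; have t0 : 0 <= `|theta| `^ alpha by exact: powR_ge0.
have c1 := mulr_ge0 C10 t0; have c2 := mulr_ge0 C20 t0.
have [th|th] := ltP `|theta| eta.
  rewrite mulrDl ler_wpDr//.
  have := h _ th; rewrite mul1r => hh.
  set tau := sigma `^ alpha * `|theta| `^ alpha in hh.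
  have tau0 : 0 <= tau by rewrite mulr_ge0 ?powR_ge0.
  have := cmodD (1 - phi theta - tau%:C%C) tau%:C%C.
  rewrite subrK cmod_real ger0_norm// /C1 -mulrA -/tau => h2; lra.
rewrite mulrDl ler_wpDl// (@le_trans _ _ 2)//.
  rewrite (le_trans (cmodB _ _))// (_ : 2 = 1 + 1)//.
  by rewrite lerD// -(rmorph1 (real_complex R)) cmod_real normr1.
rewrite /C2 -mulrA ler_peMr// -powRM ?invr_ge0 ?(ltW eta0)//.
have e1 : 1 `^ alpha = 1 :> R by rewrite powR1.
rewrite -[leLHS]e1 ge0_ler_powR ?(ltW alpha0)// ?nnegrE ?mulr_ge0 ?invr_ge0 ?(ltW eta0)//.
by rewrite mulrC ler_pdivlMr// mul1r.
Qed.

End char_asymptotics.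

(** * Convergence of characteristic functions and tightness as rho grows *)

Section convergence.
Context (R : realType) (alpha beta : R).
Hypothesis alpha0 : 0 < alpha.
Hypothesis hbeta : 0 < beta < 1.
Context (d : measure_display) (E : measurableType d) (mu : {measure set E -> \bar R}).
Context (p : nat -> R) (nu : R -> nat) (L : R -> R).
Hypothesis hp0 : forall k, 0 < p k.
Hypothesis hp : forall j k, (j <= k)%N -> p k <= p j.
Hypothesis hnu : forall t, 0 < t -> is_count p t (nu t).
Hypothesis hL : slowly_varying L.
Hypothesis hnuL : forall t, 0 < t -> (nu t)%:R = t `^ beta * L t.
Context (d1 : measure_display) (Omega : measurableType d1) (P : probability Omega R).
Context (N : R -> nat -> Omega -> point_measure E R).
Hypothesis hN : forall rho k, 0 < rho ->
  poisson_point_process P (N rho k) (fun A => ((rho * p k)%:E * mu A)%E).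
Hypothesis hNindep : forall rho, 0 < rho -> independent_family P (N rho).
Context (eps : nat -> {RV P >-> R}).
Hypothesis heps_indep : independent_family P (fun k => eps k : Omega -> R).
Hypothesis heps_id : identically_distributed P (fun k => eps k : Omega -> R).
Hypothesis heps_N : forall rho, 0 < rho ->
  independent_systems P (sigma_of_family (fun k => eps k : Omega -> R))
                        (sigma_of_family (N rho)).
Context (sigma : R).
Hypothesis sigma0 : 0 < sigma.
Hypothesis heps_char :
  (((1 - char_fun P (eps 0%N) theta) /
    (sigma `^ alpha * `|theta| `^ alpha)%:C%C : R[i]^o)
     @[theta --> (0 : R)^'] --> (1 : R[i]^o)).
Context (n : nat) (A : 'I_n -> set E).
Hypothesis mA : forall i, measurable (A i).
Hypothesis fA : forall i, (mu (A i) < +oo)%E.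
Implicit Types (J K : {set 'I_n}) (theta : 'I_n -> R).

Definition norming rho : R :=
  ((beta / karlin_const beta) * rho `^ beta * L rho) `^ alpha^-1 * sigma.

Let phi := char_fun P (eps 0%N).
Let kappa := beta / karlin_const beta.
Let kappa0 : 0 < kappa.
Proof. by rewrite divr_gt0 ?karlin_const_gt0//; case/andP: hbeta. Qed.
Let T rho J := parity_total mu (fun k => rho * p k) A J.
Let X rho i w := odd_sum (fun k => eps k) (N rho) (A i) w / norming rho.

Let phi0 : phi 0 = 1.
Proof.
rewrite /phi char_funE /cexp.
under eq_Rintegral do rewrite mul0r cos0.
under [X in (_ +i* X)%C]eq_Rintegral do rewrite mul0r sin0.
by rewrite !Rint_cst.
Qed.

Let phi1 t : cmod (phi t) <= 1.
Proof.
rewrite -lecR -cmodE /phi char_funE norm_cexp_le1//.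
exact: measurable_funM.
Qed.

Let near_gt0 : \forall rho \near +oo, (0 : R) < rho.
Proof. by apply: nbhs_pinfty_gt; exact: num_real. Qed.

Let near_count (c : R) : \forall rho \near +oo, c < (nu rho)%:R.
Proof. by have /cvgryPgt := cvg_count hp0 hp hnu; exact. Qed.

Let near_sums : \forall rho \near +oo,
  (forall K, (\sum_(k <oo) (1 - expR (- (2 * fine (mu (symdiff A K)) * (rho * p k))))%:E < +oo)%E) /\
  (forall i, (\sum_(k <oo) (1 - expR (- (2 * fine (mu (A i)) * (rho * p k))))%:E < +oo)%E).
Proof.
near=> rho; split.
  near: rho; apply: filter_forall => K.
  by apply: (karlin_sum_lty hbeta hp0 hp hnu hL hnuL); rewrite mulr_ge0// fine_ge0.
near: rho; apply: filter_forall => i.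
by apply: (karlin_sum_lty hbeta hp0 hp hnu hL hnuL); rewrite mulr_ge0// fine_ge0.
Unshelve. all: by end_near. Qed.

(** Since rho^beta L(rho) is the count itself, the norming to the power alpha is proportional to nu
    rho: this fixes the order 1 / nu rho of all comparison values. *)
Lemma norming_powR rho : 0 < rho -> (0 < nu rho)%N ->
  0 < norming rho /\ norming rho `^ alpha = kappa * (nu rho)%:R * sigma `^ alpha.
Proof.
move=> r0 n0; rewrite /norming -mulrA -hnuL// -/kappa.
have kn : 0 < kappa * (nu rho)%:R by rewrite mulr_gt0// ltr0n.
split; first by rewrite mulr_gt0// powR_gt0.
rewrite powRM ?powR_ge0 ?(ltW sigma0)// -powRrM mulVf ?gt_eqF// powRr1//.
exact: ltW.
Qed.

Definition parity_ratio J : R :=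
  \sum_K parity_coef R J K * exp_weight_moment beta (2 * fine (mu (symdiff A K))).

Lemma cvg_parity_ratio J : T rho J / (nu rho)%:R @[rho --> +oo] --> parity_ratio J.
Proof.
rewrite (_ : (fun rho => _) = (fun rho => \sum_K parity_coef R J K *
    (karlin_sum p (2 * fine (mu (symdiff A K))) rho / (nu rho)%:R))); last first.
  apply/funext => rho; rewrite /T /parity_total mulr_suml.
  by apply: eq_bigr => K _; rewrite mulrA.
apply: cvg_sumr => K _; apply: cvgM; first exact: cvg_cst.
apply: (cvg_karlin_sum hbeta hp0 hp hnu hL hnuL).
by rewrite mulr_ge0// fine_ge0.
Qed.

Lemma cvg_sum_parity_ratio :
  (\sum_(J | J != finset.set0) T rho J) / (nu rho)%:R @[rho --> +oo] -->
  \sum_(J | J != finset.set0) parity_ratio J.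
Proof.
under eq_cvg do rewrite mulr_suml.
by apply: cvg_sumr => J _; exact: cvg_parity_ratio.
Qed.

Lemma prelimit_bound rho theta (tau : {set 'I_n} -> R) : 0 < rho ->
  (forall K, (\sum_(k <oo) (1 - expR (- (2 * fine (mu (symdiff A K)) * (rho * p k))))%:E < +oo)%E) ->
  (forall i, (\sum_(k <oo) (1 - expR (- (2 * fine (mu (A i)) * (rho * p k))))%:E < +oo)%E) ->
  (forall J, 0 <= tau J) ->
  cmod (cexp P (fun w => dotp theta ((X rho) ^~ w)) -
    (expR (- \sum_(J | J != finset.set0) tau J * T rho J))%:C%C) <=
  (\sum_(J | J != finset.set0)
     cmod (1 - phi (subset_sum theta J / norming rho) - (tau J)%:C%C) +
   (\sum_(J | J != finset.set0) tau J) ^+ 2) * \sum_(J | J != finset.set0) T rho J.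
Proof.
move=> r0 sK sA tau0.
have lam0 k : 0 < rho * p k by rewrite mulr_gt0.
have := cexp_odd_comb_bound lam0 (fun k => hN k r0) (hNindep r0) heps_indep heps_id
  (heps_N r0) mA fA sK sA (fun i => theta i / norming rho) tau0.
rewrite /char_error /char_gap.
have -> : (fun w => dotp (fun i => theta i / norming rho)
    ((fun i => odd_sum (fun k => eps k) (N rho) (A i)) ^~ w)) =
    (fun w => dotp theta ((X rho) ^~ w)).
  apply/funext => w; apply: eq_bigr => i _; rewrite /X; ring.
have sE J : subset_sum (fun i => theta i / norming rho) J = subset_sum theta J / norming rho.
  by rewrite /subset_sum mulr_suml.
by under [X in (X + _) * _]eq_bigr do rewrite sE.
Qed.

Lemma norm_div_norming_powR (s rho : R) : 0 < rho -> (0 < nu rho)%N ->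
  `|s / norming rho| `^ alpha = `|s| `^ alpha / kappa / ((nu rho)%:R * sigma `^ alpha).
Proof.
move=> r0 n0; have [b0 bE] := norming_powR r0 n0.
rewrite normrM normfV (gtr0_norm b0) powRM ?invr_ge0 ?(ltW b0)//.
rewrite -[(norming rho)^-1]powR_inv1 ?(ltW b0)// powRAC bE.
rewrite powR_inv1; last by rewrite -bE powR_ge0.
by rewrite !invfM; ring.
Qed.

(** The gap is o(|s / b|^alpha), and |s / b|^alpha is a constant over nu rho, so multiplying by nu
    rho still leaves o(1). *)
Lemma cvg_scaled_char_gap (s : R) :
  cmod (1 - phi (s / norming rho) -
    (sigma `^ alpha * `|s / norming rho| `^ alpha)%:C%C) * (nu rho)%:R
  @[rho --> +oo] --> (0 : R).
Proof.
apply/cvgr0Pnorm_le => e e0.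
pose S := `|s| `^ alpha / kappa.
have S0 : 0 <= S by rewrite divr_ge0 ?powR_ge0// ltW.
have e1 : 0 < e / (S + 1) by rewrite divr_gt0// ltr_wpDl.
have [eta eta0 h] := char_gap_small alpha0 sigma0 heps_char phi0 e1.
near=> rho.
have r0 : 0 < rho by near: rho.
(* Solved for nu rho, this is exactly |s / b|^alpha < eta^alpha. *)
have nuS : S / (sigma `^ alpha * eta `^ alpha) < (nu rho)%:R by near: rho; exact: near_count.
have n0 : (0 : R) < (nu rho)%:R by near: rho; exact: near_count.
have tE := norm_div_norming_powR s r0 ltac:(by rewrite -(ltr0n R)).
rewrite -/S in tE.
have small : `|s / norming rho| < eta.
  rewrite ltNge; apply/negP => es.
  have := ge0_ler_powR (ltW alpha0) (ltW eta0 : eta \in Num.nneg) (normr_ge0 _ : _ \in Num.nneg) es.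
  rewrite tE leNgt => /negP; apply.
  rewrite invfM mulrA ltr_pdivrMr ?powR_gt0// ltr_pdivrMr//.
  move: nuS; rewrite ltr_pdivrMr ?mulr_gt0 ?powR_gt0//.
  by rewrite [ltRHS](_ : _ = eta `^ alpha * sigma `^ alpha * (nu rho)%:R)//; ring.
rewrite ger0_norm ?mulr_ge0 ?cmod_ge0//.
apply: (@le_trans _ _ (e / (S + 1) * (sigma `^ alpha * `|s / norming rho| `^ alpha) * (nu rho)%:R)).
  by rewrite ler_wpM2r// h.
rewrite tE (_ : _ * _ = e / (S + 1) * S); last first.
  by field; rewrite !gt_eqF ?powR_gt0// ltr_wpDl.
by rewrite mulrAC ler_pdivrMr ?ltr_wpDl// ler_wpM2l ?(ltW e0)// lerDl.
Unshelve. all: by end_near. Qed.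

Lemma cvg_inv_count : (nu rho)%:R^-1 @[rho --> +oo] --> (0 : R).
Proof.
apply/cvgr0Pnorm_le => e e0; near=> rho.
have ne : e^-1 < (nu rho)%:R by near: rho; exact: near_count.
have n0 : (0 : R) < (nu rho)%:R by apply: lt_trans ne; rewrite invr_gt0.
by rewrite ger0_norm ?invr_ge0 ?(ltW n0)// invf_ple ?posrE// ltW.
Unshelve. all: by end_near. Qed.

Lemma cvg_cexp_prelimit theta :
  cmod (cexp P (fun w => dotp theta ((X rho) ^~ w)) -
    (expR (- \sum_(J | J != finset.set0)
      parity_moment beta mu A J * `|subset_sum theta J| `^ alpha))%:C%C)
  @[rho --> +oo] --> (0 : R).
Proof.
pose s J := subset_sum theta J.
pose S J := `|s J| `^ alpha / kappa.
pose tau rho J := sigma `^ alpha * `|s J / norming rho| `^ alpha.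
pose gap rho J := cmod (1 - phi (s J / norming rho) - (tau rho J)%:C%C).
(* The error bound with powers of nu rho redistributed: the first factor tends to 0 and the second
   converges. [g2] is the distance between the comparison exponential and its limit. *)
pose g1 rho := (\sum_(J | J != finset.set0) gap rho J * (nu rho)%:R +
  (\sum_(J | J != finset.set0) S J) ^+ 2 * (nu rho)%:R^-1) *
  ((\sum_(J | J != finset.set0) T rho J) / (nu rho)%:R).
pose W := \sum_(J | J != finset.set0) S J * parity_ratio J.
pose g2 rho := `|expR (- \sum_(J | J != finset.set0) S J * (T rho J / (nu rho)%:R)) - expR (- W)|.
have WE : \sum_(J | J != finset.set0)
    parity_moment beta mu A J * `|subset_sum theta J| `^ alpha = W.
  (* Here c_beta / beta from the control measure meets 1 / kappa from the norming. *)
  apply: eq_bigr => J _; rewrite /parity_moment -/(parity_ratio J) /S /s /kappa invf_div; ring.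
have c1 : g1 rho @[rho --> +oo] --> (0 : R).
  rewrite -[X in _ --> X](mul0r (\sum_(J | J != finset.set0) parity_ratio J)).
  apply: cvgM; last exact: cvg_sum_parity_ratio.
  rewrite -[X in _ --> X]addr0; apply: cvgD.
    have : \sum_(J | J != finset.set0) gap rho J * (nu rho)%:R @[rho --> +oo] -->
        \sum_(J : {set 'I_n} | J != finset.set0) (0 : R).
      by apply: cvg_sumr => J _; exact: cvg_scaled_char_gap.
    by rewrite [X in _ --> X -> _]big1.
  rewrite -[X in _ --> X](mulr0 ((\sum_(J | J != finset.set0) S J) ^+ 2)).
  by apply: cvgM; [exact: cvg_cst|exact: cvg_inv_count].
have c2 : g2 rho @[rho --> +oo] --> (0 : R).
  rewrite -(normr0 R) -(subrr (expR (- W))); apply: cvg_norm; apply: cvgB; last exact: cvg_cst.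
  have : \sum_(J | J != finset.set0) S J * (T rho J / (nu rho)%:R) @[rho --> +oo] --> W.
    by apply: cvg_sumr => J _; apply: cvgM; [exact: cvg_cst|exact: cvg_parity_ratio].
  by move=> /cvgN h; apply: (cvg_comp _ _ h); exact: continuous_expR.
have c12 : g1 rho + g2 rho @[rho --> +oo] --> (0 : R).
  by rewrite -[X in _ --> X]addr0; exact: cvgD.
apply: (squeeze_cvgr _ (cvg_cst 0) c12); near=> rho.
rewrite cmod_ge0/=.
have r0 : 0 < rho by near: rho.
have n0 : (0 : R) < (nu rho)%:R by near: rho; exact: near_count.
have n0' : (0 < nu rho)%N by rewrite -(ltr0n R).
have [sK sA] : (forall K, (\sum_(k <oo) (1 - expR (- (2 * fine (mu (symdiff A K)) * (rho * p k))))%:E < +oo)%E) /\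
    (forall i, (\sum_(k <oo) (1 - expR (- (2 * fine (mu (A i)) * (rho * p k))))%:E < +oo)%E).
  by near: rho.
have tauE J : tau rho J = S J / (nu rho)%:R.
  rewrite /tau norm_div_norming_powR// -/(S J).
  by field; rewrite !gt_eqF ?powR_gt0.
have tau0 J : 0 <= tau rho J by rewrite mulr_ge0 ?powR_ge0.
have b := prelimit_bound theta r0 sK sA tau0.
rewrite WE; set c := cexp _ _ in b *.
set e := expR _ in b.
have -> : c - (expR (- W))%:C%C = (c - e%:C%C) + (e - expR (- W))%:C%C.
  by rewrite rmorphB/=; ring.
rewrite (le_trans (cmodD _ _))// lerD//.
  rewrite (le_trans b)// le_eqVlt; apply/orP; left; apply/eqP.
  rewrite /g1 -mulr_suml.
  have -> : \sum_(J | J != finset.set0) tau rho J =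
      (\sum_(J | J != finset.set0) S J) / (nu rho)%:R.
    by rewrite mulr_suml; apply: eq_bigr => J _; exact: tauE.
  by rewrite /gap; field; rewrite gt_eqF.
rewrite cmod_real /g2 /e.
rewrite (eq_bigr (fun J => S J * (T rho J / (nu rho)%:R)))// => J _.
by rewrite tauE; ring.
Unshelve. all: by end_near. Qed.

Lemma measurable_prelimit rho i : 0 < rho -> measurable_fun setT (X rho i).
Proof.
move=> r0; apply: measurable_funM => //.
by apply: measurable_odd_sum => // k; case: (hN k r0).
Qed.

(** The comparison bound with tau = 0 and theta supported at i compares the characteristic function
    with 1. The global bound on 1 - phi then holds for every t, with one constant for all large
    rho. *)
Lemma char_bound_prelimit i : exists C a : R, [/\ 0 <= C, 0 < a &
  \forall rho \near +oo, forall t : R,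
    \int[P]_w (1 - cos (t * X rho i w)) <= C * `|t| `^ a].
Proof.
have [C0 C00 hC] := char_global_bound alpha0 sigma0 heps_char phi0 phi1.
pose B := \sum_(J | J != finset.set0) parity_ratio J.
pose m : R := \sum_(J : {set 'I_n} | J != finset.set0) 1.
have m0 : 0 <= m by apply: sumr_ge0.
(* Here m is the number of nonempty patterns, and |B| + 1 eventually bounds the sum of the pattern
   totals over nu rho. *)
pose C := C0 * (m / (kappa * sigma `^ alpha)) * (`|B| + 1).
have ks : 0 < kappa * sigma `^ alpha by rewrite mulr_gt0// powR_gt0.
exists C, alpha; split => //.
  by rewrite mulr_ge0 ?addr_ge0// mulr_ge0// divr_ge0// ltW.
near=> rho => t.
have r0 : 0 < rho by near: rho.
have n0 : (0 : R) < (nu rho)%:R by near: rho; exact: near_count.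
have n0' : (0 < nu rho)%N by rewrite -(ltr0n R).
have [sK sA] : (forall K, (\sum_(k <oo) (1 - expR (- (2 * fine (mu (symdiff A K)) * (rho * p k))))%:E < +oo)%E) /\
    (forall i, (\sum_(k <oo) (1 - expR (- (2 * fine (mu (A i)) * (rho * p k))))%:E < +oo)%E).
  by near: rho.
have TB : (\sum_(J | J != finset.set0) T rho J) / (nu rho)%:R <= `|B| + 1.
  near: rho; apply: (cvgr_le _ cvg_sum_parity_ratio).
  by rewrite (le_lt_trans (ler_norm _))// ltrDl.
pose theta j : R := if j == i then t else 0.
have dE w : dotp theta ((X rho) ^~ w) = t * X rho i w.
  rewrite /dotp (bigD1 i)//= /theta eqxx big1 ?addr0// => j ji.
  by rewrite (negbTE ji) mul0r.
have sE J : `|subset_sum theta J| <= `|t|.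
  rewrite /subset_sum; have [iJ|iJ] := boolP (i \in J).
    rewrite (bigD1 i)//= /theta eqxx big1 ?addr0// => j /andP[_ ji].
    by rewrite (negbTE ji).
  rewrite big1 ?normr0// => j jJ; rewrite /theta; case: eqP => // ji.
  by move: iJ; rewrite -ji jJ.
have := prelimit_bound theta r0 sK sA (tau := fun=> 0) (fun=> lexx 0).
rewrite [X in _ + X ^+ 2]big1// expr0n/= addr0.
rewrite [X in expR (- X)]big1; last by move=> J _; rewrite mul0r.
rewrite oppr0 expR0 => b.
have mX : measurable_fun setT (fun w => t * X rho i w).
  by apply: measurable_funM => //; exact: measurable_prelimit.
have bc := bounded_rv_cos mX.
rewrite RintB ?Rint_cst//; last exact: bounded_rv_cst.
have -> : 1 - \int[P]_w cos (t * X rho i w) =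
    - complex.Re (cexp P (fun w => dotp theta ((X rho) ^~ w)) - 1%:C%C).
  rewrite /cexp/= opprB; congr (_ - _).
  by apply: eq_Rintegral => w _; rewrite dE.
rewrite (le_trans (ler_norm _))// normrN (le_trans (Re_le_cmod _))// (le_trans b)//.
pose D := C0 * (`|t| `^ alpha / (kappa * sigma `^ alpha)) / (nu rho)%:R.
have T0 : 0 <= \sum_(J | J != finset.set0) T rho J.
  apply: sumr_ge0 => J J0.
  have lam0 k : 0 < rho * p k by rewrite mulr_gt0.
  apply: le_trans (series_parity_le lam0 (fun k => hN k r0) mA fA sK 0 J0).
  by rewrite big_ord0.
apply: (@le_trans _ _ (m * D * \sum_(J | J != finset.set0) T rho J)).
  rewrite ler_wpM2r// /m mulr_suml; apply: ler_sum => J _.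
  rewrite mul1r subr0 (le_trans (hC _))// /D -mulrA ler_wpM2l//.
  rewrite norm_div_norming_powR//.
  have tJ : `|subset_sum theta J| `^ alpha <= `|t| `^ alpha.
    by rewrite ge0_ler_powR ?(ltW alpha0)// nnegrE.
  rewrite (_ : _ / kappa / _ = `|subset_sum theta J| `^ alpha / (kappa * sigma `^ alpha) / (nu rho)%:R).
    by rewrite !ler_wpM2r ?invr_ge0// ltW.
  by field; rewrite !gt_eqF ?powR_gt0.
rewrite (_ : m * D * _ = C0 * (m / (kappa * sigma `^ alpha)) *
  ((\sum_(J | J != finset.set0) T rho J) / (nu rho)%:R) * `|t| `^ alpha); last by rewrite /D; ring.
rewrite ler_wpM2r ?powR_ge0// ler_wpM2l// mulr_ge0// divr_ge0// ltW.
Unshelve. all: by end_near. Qed.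

End convergence.

Theorem theorem5p1 (R : realType) (alpha beta : R)
  (halpha : 0 < alpha <= 2) (hbeta : 0 < beta < 1)
  (d : measure_display) (E : measurableType d)
  (mu : {measure set E -> \bar R}) (hmu : sigma_finite setT mu)
  (p : nat -> R) (hp0 : forall k, 0 < p k)
  (hp : forall j k, (j <= k)%N -> p k <= p j)
  (nu : R -> nat) (hnu : forall t, 0 < t -> is_count p t (nu t))
  (L : R -> R) (hL : slowly_varying L)
  (hnuL : forall t, 0 < t -> (nu t)%:R = t `^ beta * L t)
  (d1 : measure_display) (Omega : measurableType d1) (P : probability Omega R)
  (N : R -> nat -> Omega -> point_measure E R)
  (hN : forall rho k, 0 < rho ->
     poisson_point_process P (N rho k) (fun A => ((rho * p k)%:E * mu A)%E))
  (hNindep : forall rho, 0 < rho -> independent_family P (N rho))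
  (eps : nat -> {RV P >-> R})
  (heps_indep : independent_family P (fun k => eps k : Omega -> R))
  (heps_id : identically_distributed P (fun k => eps k : Omega -> R))
  (heps_N : forall rho, 0 < rho ->
     independent_systems P (sigma_of_family (fun k => eps k : Omega -> R))
                           (sigma_of_family (N rho)))
  (sigma : R) (hsigma : 0 < sigma)
  (heps_char :
     (((1 - char_fun P (eps 0%N) theta) /
       (sigma `^ alpha * `|theta| `^ alpha)%:C%C : R[i]^o)
        @[theta --> (0 : R)^'] --> (1 : R[i]^o)))
  (d2 : measure_display) (Omega' : measurableType d2)
  (P' : probability Omega' R)
  (M : set (point_measure E R) -> Omega' -> R)
  (hM : sas_random_measure P' alpha (karlin_control beta mu) M) :
  let b rho := ((beta / karlin_const beta) * rho `^ beta * L rho) `^ alpha^-1 * sigma in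
  cvg_fdd [set A : set E | measurable A /\ (mu A < +oo)%E]
    P (fun rho A w => odd_sum (fun k => eps k) (N rho) A w / b rho)
    P' (karlin_process M).
Proof.
move=> b n A hA f cf bf.
have alpha0 : 0 < alpha by case/andP: halpha.
have mA i : measurable (A i) by case: (hA i).
have fA i : (mu (A i) < +oo)%E by case: (hA i).
(* The Poisson law of mean measure r mu exists since N (r / p 0) 0 has it. *)
have plaw r : 0 < r -> poisson_point_process
    (poisson_law (fun A => (r%:E * mu A)%E) : probability _ R) id
    (fun A => (r%:E * mu A)%E).
  move=> r0; have rp : 0 < r / p 0%N by rewrite divr_gt0.
  apply: (@poisson_lawP _ _ _ _ _ P (N (r / p 0%N) 0%N)).
  have := hN _ 0%N rp; congr (poisson_point_process _ _ _).
  by apply/funext => B; rewrite divfK// gt_eqF.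
(* [bounded_fun] provides bounds strictly above some threshold, hence the added 1. *)
have [C fC] : exists C : R, forall x, `|f x| <= C.
  have [C [_ hC]] := bf; exists (C + 1) => x; apply: hC => //.
  by rewrite ltrDl.
pose X rho (i : 'I_n) w := odd_sum (fun k => eps k) (N rho) (A i) w / b rho.
pose Y (i : 'I_n) := karlin_process M (A i).
have mX rho : 0 < rho -> forall i, measurable_fun setT (X rho i).
  by move=> r0 i; exact: (measurable_prelimit alpha beta L hN eps sigma mA i r0).
have mY i : measurable_fun setT (Y i) by exact: (measurable_karlin_process hbeta plaw hM mA fA).
have near0 : \forall rho \near +oo, (0 : R) < rho.
  by apply: nbhs_pinfty_gt; exact: num_real.
have cC theta := cvg_cexp_prelimit alpha0 hbeta hp0 hp hnu hL hnuL hN hNindep heps_indep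
  heps_id heps_N hsigma heps_char mA fA theta.
have cY theta := cexp_karlin_process alpha0 hbeta plaw hM mA fA theta.
have cRe theta : complex.Re (cexp P (fun w => dotp theta ((X rho) ^~ w))) @[rho --> +oo] -->
    complex.Re (cexp P' (fun w => dotp theta (Y ^~ w))).
  apply/cvgrPdist_le => e e0; have /cvgr0Pnorm_le/(_ e e0) := cC theta.
  apply: filterS => rho; rewrite ger0_norm ?cmod_ge0// -cY; apply: le_trans.
  rewrite distrC; exact: (le_trans _ (Re_le_cmod _)).
have cIm theta : complex.Im (cexp P (fun w => dotp theta ((X rho) ^~ w))) @[rho --> +oo] -->
    complex.Im (cexp P' (fun w => dotp theta (Y ^~ w))).
  apply/cvgrPdist_le => e e0; have /cvgr0Pnorm_le/(_ e e0) := cC theta.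
  apply: filterS => rho; rewrite ger0_norm ?cmod_ge0// -cY; apply: le_trans.
  rewrite distrC; exact: (le_trans _ (Im_le_cmod _)).
have lev : \int[P]_w f (\row_i X rho i w) @[rho --> +oo] --> \int[P']_w f (\row_i Y i w).
  apply: (levy_continuity _ mY cRe cIm _ cf fC).
    by near=> rho; apply: mX; near: rho.
  exact: (char_bound_prelimit alpha0 hbeta hp0 hp hnu hL hnuL hN hNindep heps_indep
    heps_id heps_N hsigma heps_char mA fA).
(* Expectations are extended reals; they are finite once rho > 0, where the prelimit is
   measurable. *)
rewrite expectation.unlock -(EFin_Rint P' (bounded_rv_continuous cf fC mY)).
apply/fine_cvgP; split; last exact: lev.
near=> rho; rewrite -(EFin_Rint P (bounded_rv_continuous cf fC (mX rho _)))//.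
Unshelve. all: by end_near. Qed.
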